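(* Let $F$ be a local field. Fix integers $0<i<j<k$ and define the representations $\beta=[0,j)\times[i,k)$, $\tilde\beta=[i,k)\times[0,j)$, $\gamma=[0,k)\times[i,j)$, $\tilde\gamma=[i,j)\times[0,k)$ of $GL(k+j-i,F)$. Then there exist non-zero intertwining operators $$\gamma\to\beta,\qquad \tilde\gamma\to\beta,\qquad \tilde\beta\to\gamma,\qquad \tilde\beta\to\tilde\gamma .$$
   Context: $F$ is a local field ($\mathbb{R}$, $\mathbb{C}$, or non-archimedean of any characteristic), $G_n=GL(n,F)$. For $z\in F^\times$, $\nu(z)>0$ is the scalar by which additive Haar measure on $F$ is multiplied under multiplication by $z$, and $\nu(g):=\nu(\det g)$ for $g\in G_n$. For integers $i\le j$, $[i,j)$ denotes the character $\nu^{(i+j)/2}$ of $G_{j-i}$. For $p_1+p_2=n$ let $P=P_{p_1,p_2}\subset G_n$ be the subgroup of block upper triangular matrices $x=\begin{pmatrix}x_{11}&x_{12}\\0&x_{22}\end{pmatrix}$ with $x_{ij}$ of size $p_i\times p_j$; its modular function is $\Delta_P=\nu^{p_2}\otimes\nu^{-p_1}$. For characters $\chi_i$ of $G_{p_i}$, $(\chi_1\otimes\chi_2)(x)=\chi_1(x_{11})\chi_2(x_{22})$, and $\chi_1\times\chi_2$ denotes the normalized induced representation: $G_n$ acts by right translation $(R_gf)(x)=f(xg)$ on the space of $f\in C^\infty(G_n)$ with $f(px)=(\chi_1\otimes\chi_2)(p)\,\Delta_P^{1/2}(p)f(x)$ for all $p\in P$, $x\in G_n$. Intertwining operators are $G_n$-equivariant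 linear maps (continuous in the archimedean case). *)

(* Defs.v *)
From HB Require Import structures.
From mathcomp Require Import all_boot all_order all_algebra.
From mathcomp Require Import all_classical all_reals all_analysis.
From mathcomp Require Import complex.
From mathcomp Require Import zify.

Set Implicit Arguments.
Unset Strict Implicit.
Unset Printing Implicit Defensive.

Import Order.TTheory GRing.Theory Num.Theory.
Import numFieldNormedType.Exports.

Local Open Scope classical_set_scope.
Local Open Scope ring_scope.
Local Open Scope complex_scope.

(* No compatibility between the two structures is required here; it comes from
   [nonarch_local_field] below, or from the usual topology of R and C. *)
#[short(type="topFieldType")]
HB.structure Definition TopField := {F of GRing.Field F & Topological F}.

(* The absolute value [a] is not part of the data, only the topology that it
   defines; it need not be normalized. *)
Definition nonarch_local_field (R : realType) (F : topFieldType) : Prop :=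
  locally_compact [set: F] /\
  exists a : F -> R,
    [/\ forall x, 0 <= a x,
        forall x, a x = 0 <-> x = 0,
        forall x y, a (x * y) = a x * a y
      & forall x y, a (x + y) <= Num.max (a x) (a y)] /\
    (exists2 x, x != 0 & a x != 1) /\
    (forall (x : F) (A : set F),
       nbhs x A <-> exists2 e : R, 0 < e & [set y | a (y - x) < e] `<=` A).

Definition realTopField (R : realType) : topFieldType :=
  HB.pack_for topFieldType (R : Type)
    (GRing.Field.on R) (Topological.on R).

Definition complexTopField (R : realType) : topFieldType :=
  HB.pack_for topFieldType (R[i] : Type)
    (GRing.Field.on R[i]) (Topological.on (R[i] : numFieldType)).

Variant localField (R : realType) : Type :=
| RealField
| ComplexField
| NonarchField (F : topFieldType) of nonarch_local_field R F.

Definition lf_carrier (R : realType) (F : localField R) : topFieldType :=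
  match F with
  | RealField => realTopField R
  | ComplexField => complexTopField R
  | NonarchField F _ => F
  end.
Coercion lf_carrier : localField >-> topFieldType.

Section Haar.
Variables (R : realType) (F : topFieldType).

Definition borel : Type := F.
HB.instance Definition _ := Choice.copy borel F.
HB.instance Definition _ := isPointed.Build borel (0 : F).

(* No regularity is imposed: it is automatic, the topology of a local field
   being second countable. *)
Definition is_haar (mu : set F -> \bar R) : Prop :=
  [/\ mu setT != 0%E,
      forall K : set F, compact K -> (mu K < +oo)%E
    & forall (a : F) (A : set F), <<s @open F>> A ->
        mu (+%R a @` A) = mu A].

(* Haar measures being proportional, the choice of mu does not matter; the value
   of nu at 0 is left free. *)
Definition is_modulus (nu : F -> R) : Prop :=
  exists2 mu : {measure set (@g_sigma_algebraType borel (@open F)) -> \bar R},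
    is_haar mu &
    forall z : F, z != 0 ->
      0 < nu z /\
      forall A : set F, <<s @open F>> A ->
        mu ( *%R z @` A) = ((nu z)%:E * mu A)%E.

End Haar.

Section Smooth.
Variables (R : realType) (V : normedModType R).
Implicit Types (U K : set V) (w : seq V) (f g : V -> R[i]).

(* [iter_derive [:: v1; ...; vr] f] is D_v1 (... (D_vr f)). *)
Definition iter_derive w (f : V -> R) : V -> R :=
  foldr (fun v h => 'D_v h) f w.

Definition smooth_on U (f : V -> R) : Prop :=
  forall w x, U x ->
    {for x, continuous (iter_derive w f)} /\
    forall v, derivable (iter_derive w f) x v.

Definition csmooth_on U f : Prop :=
  smooth_on U (fun x => complex.Re (f x)) /\
  smooth_on U (fun x => complex.Im (f x)).

Definition citer_derive w f : V -> R[i] := fun x =>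
  iter_derive w (fun y => complex.Re (f y)) x +i*
  iter_derive w (fun y => complex.Im (f y)) x.

(* Neighbourhoods of f for the topology of uniform convergence of all
   derivatives on the compact subsets of U. *)
Definition smooth_nbhs U f : set_system (V -> R[i]) := [set A |
  exists (K : set V) (s : seq (seq V)) (e : R),
    [/\ compact K, K `<=` U, 0 < e
      & [set g | forall w x, w \in s -> K x ->
                   `|citer_derive w g x - citer_derive w f x| < e%:C] `<=` A]].

End Smooth.

Section GeneralLinear.
Variables (R : realType) (n : nat).

Definition real_GL : set 'M[R]_n := [set x | x \in unitmx].

(* The matrix A + iB, in the real coordinates (A, B). *)
Definition complex_mx (p : 'M[R]_n * 'M[R]_n) : 'M[R[i]]_n :=
  \matrix_(a, b) (p.1 a b +i* p.2 a b).

Definition complex_GL : set ('M[R]_n * 'M[R]_n) :=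
  [set p | complex_mx p \in unitmx].

Definition GL_smooth (F : localField R) : set ('M[F]_n -> R[i]) :=
  match F return set ('M[F]_n -> R[i]) with
  | RealField => csmooth_on real_GL
  | ComplexField => fun f => csmooth_on complex_GL (f \o complex_mx)
  | NonarchField F _ => fun f : 'M[F]_n -> R[i] =>
      forall x, x \in unitmx -> \forall y \near x, f y = f x
  end.

(* A function on GL(n, F) is encoded as a function on all n x n matrices that
   vanishes at the non-invertible ones. *)
Definition Cinfty_GL (F : localField R) : set ('M[F]_n -> R[i]) :=
  [set f | (forall x, x \notin unitmx -> f x = 0) /\ GL_smooth f].

(* Over a non-archimedean field no continuity is asked of the operators, which
   is what the discrete topology expresses. *)
Definition Cinfty_nbhs (F : localField R) (f : 'M[F]_n -> R[i]) :
    set_system ('M[F]_n -> R[i]) :=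
  match F return ('M[F]_n -> R[i]) -> set_system ('M[F]_n -> R[i]) with
  | RealField => smooth_nbhs real_GL
  | ComplexField => fun f : 'M[R[i]]_n -> R[i] => [set A |
      exists2 B, smooth_nbhs complex_GL (f \o complex_mx) B
        & [set g : 'M[R[i]]_n -> R[i] | B (g \o complex_mx)] `<=` A]
  | NonarchField _ _ => fun f => [set A | A f]
  end f.

End GeneralLinear.

Section Representations.
Variables (R : realType) (F : localField R).

Definition right_transl n (g : 'M[F]_n) (f : 'M[F]_n -> R[i]) :
  'M[F]_n -> R[i] := fun x => f (x *m g).

(* T intertwines the spaces V1 and V2 of functions on GL(n, F), on which the
   group acts by right translation; its values outside V1 are irrelevant. *)
Definition intertwining n (V1 V2 : set ('M[F]_n -> R[i]))
    (T : ('M[F]_n -> R[i]) -> 'M[F]_n -> R[i]) : Prop :=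
  [/\ forall f, V1 f -> V2 (T f),
      forall (a : R[i]) f g, V1 f -> V1 g ->
        T (fun x => a * f x + g x) = (fun x => a * T f x + T g x),
      forall g f, g \in unitmx -> V1 f ->
        T (right_transl g f) = right_transl g (T f)
    & forall f, V1 f -> forall A, Cinfty_nbhs (T f) A ->
        within V1 (Cinfty_nbhs f) (T @^-1` A)].

Definition exists_nonzero_intertwining n (V1 V2 : set ('M[F]_n -> R[i])) :
    Prop :=
  exists2 T, intertwining V1 V2 T & exists2 f, V1 f & T f <> (fun=> 0).

Variable nu : F -> R.

(* Delta_P^{1/2} at a block upper triangular matrix with diagonal blocks a, d,
   where Delta_P = nu^p2 (x) nu^-p1. *)
Definition modular_sqrt p1 p2 (a : 'M[F]_p1) (d : 'M[F]_p2) : R :=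
  (nu (\det a) ^+ p2 / nu (\det d) ^+ p1) `^ 2^-1.

Definition normalized_ind n p1 p2 (e : (p1 + p2)%N = n)
    (chi1 : 'M[F]_p1 -> R[i]) (chi2 : 'M[F]_p2 -> R[i]) :
    set ('M[F]_n -> R[i]) :=
  [set f | Cinfty_GL f /\
    forall (a : 'M[F]_p1) (b : 'M[F]_(p1, p2)) (d : 'M[F]_p2) (x : 'M[F]_n),
      a \in unitmx -> d \in unitmx -> x \in unitmx ->
      f (castmx (e, e) (block_mx a b 0 d) *m x) =
      chi1 a * chi2 d * (modular_sqrt a d)%:C * f x].

(* nu^((i + j) / 2) on GL(j - i, F), usually written [i, j); [segment_prod] is
   then [i1, j1) x [i2, j2). *)
Definition segment_char (i j : nat) (g : 'M[F]_(j - i)) : R[i] :=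
  (nu (\det g) `^ ((i + j)%:R / 2))%:C.

Definition segment_prod n i1 j1 i2 j2 (e : ((j1 - i1) + (j2 - i2))%N = n) :
    set ('M[F]_n -> R[i]) :=
  normalized_ind e (@segment_char i1 j1) (@segment_char i2 j2).

End Representations.

Section Sizes.
Variables (i j k : nat) (ij : (i < j)%N) (jk : (j < k)%N).

Lemma beta_size : ((j - 0) + (k - i) = k + j - i)%N. Proof. lia. Qed.
Lemma tbeta_size : ((k - i) + (j - 0) = k + j - i)%N. Proof. lia. Qed.
Lemma gamma_size : ((k - 0) + (j - i) = k + j - i)%N. Proof. lia. Qed.
Lemma tgamma_size : ((j - i) + (k - 0) = k + j - i)%N. Proof. lia. Qed.

End Sizes.

(* Main.v *)
(* Each of the four representations consists of the smooth functions f on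
   GL(n) with f(p x) = nu(det a)^s nu(det d)^t f(x), p running over the block
   upper triangular matrices with diagonal blocks a, d.  If s - t = m + l and
   e = s - l, then moving l rows from one block to the other is achieved by
     T f (x) = int f(iota(y) x) nu(det y)^(-e) dy,
   where iota embeds GL(m + l) as a diagonal block and y runs over the quotient
   of GL(m + l) by the block upper triangular subgroup P_{m,l}: the condition
   on s, t and e says exactly that the integrand transforms under P_{m,l} by
   its modular function, so that the integral makes sense and is right
   invariant.  By Weil's formula it can be computed as an integral over
   GL(m + l) against a nonnegative compactly supported density w.  Since w has
   compact support, T preserves smoothness and is continuous (differentiation
   under the integral sign); since w is nonnegative and positive at 1, T f <> 0
   as soon as f is positive.  Positive vectors are built from nu(det x) and the
   maximal minors of the last rows of x. *)
Require Import Defs.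
From mathcomp Require Import all_boot all_order all_algebra perm.
From mathcomp Require Import all_classical all_reals all_analysis measurable_realfun.
From mathcomp Require Import complex ring lra zify.

Set Implicit Arguments.
Unset Strict Implicit.
Unset Printing Implicit Defensive.

Import Order.TTheory GRing.Theory Num.Theory.
Import numFieldNormedType.Exports.

Local Open Scope classical_set_scope.
Local Open Scope ring_scope.

(** * Compactly supported functions and positive functionals *)

(** No Haar measure on a group is built as a measure. The given additive Haar measure is turned once
    into a positive functional on continuous functions of compact support on the field; integrals
    over matrices are iterated from it, and those over GL(b) and over the parabolic subgroup add
    powers of [nu] of determinants as densities. Fubini is proved for such functionals directly.
    Compactness of the quotient is used through representatives: every orbit contains a matrix with
    entries of absolute value at most 1 and determinant of absolute value 1. The density w is a bump
    around these representatives divided by its own orbit integral, so that its orbit integrals all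
    equal 1; a right translate of w has the same property, whence the invariance. The three kinds of
    fields share all this through an absolute value with compact balls, and separate only for the
    smoothness of the averages and for the positive vectors. In the archimedean case the latter need
    [nu] to be smooth, while only its scaling law is given: [nu] is shown to be a real power of the
    absolute value, by way of continuous additive functions on the real line. *)

Section Radon.
Variable R : realType.

(** A function on an open subset such as GL(n) is kept as a function on the ambient space. The
    compact support lies inside [U], so the function vanishes off [U]; in a Hausdorff space it is
    then continuous everywhere, by [csuppT]. *)
Definition csupp_on (T : topologicalType) (U : set T) (f : T -> R) : Prop :=
  (forall x, U x -> {for x, continuous f}) /\
  exists K, [/\ compact K, K `<=` U & forall x, ~ K x -> f x = 0].

Local Notation csupp f := (csupp_on setT f).

(* A positive functional on continuous functions of compact support plays the
   role of a Radon measure of full support; the group integrals below only ever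
   meet such functions, so that no measure on a group is needed. *)
Definition radon (T : topologicalType) (U : set T) (I : (T -> R) -> R) : Prop :=
  (forall c f g, csupp_on U f -> csupp_on U g ->
     I (fun x => c * f x + g x) = c * I f + I g) /\
  (forall f, csupp_on U f -> (forall x, 0 <= f x) -> 0 <= I f) /\
  (forall f, csupp_on U f -> (forall x, 0 <= f x) -> (exists x, 0 < f x) ->
     0 < I f).

(** Stands for local compactness together with Urysohn's lemma; it is all that partitions of unity
    require. *)
Definition has_bumps (T : topologicalType) : Prop :=
  forall (x : T) A, nbhs x A -> exists g : T -> R,
    [/\ csupp g, forall y, 0 <= g y, 0 < g x & forall y, ~ A y -> g y = 0].

Section Basic.
Variables (T : topologicalType) (U : set T).
Implicit Types f g : T -> R.

Lemma csupp0 : csupp_on U (fun=> 0).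
Proof.
split=> [x _|]; first exact: cst_continuous.
by exists set0; split=> //; exact: compact0.
Qed.

Lemma csupp_lin c f g : csupp_on U f -> csupp_on U g ->
  csupp_on U (fun x => c * f x + g x).
Proof.
move=> [cf [K [cK KU Kf]]] [cg [L [cL LU Lg]]]; split=> [x Ux|].
  apply: continuousD; last exact: cg.
  by apply: continuousM; [exact: cst_continuous|exact: cf].
exists (K `|` L); split; first exact: compactU.
  by move=> x [/KU|/LU].
move=> x nKL; rewrite Kf ?Lg ?mulr0 ?addr0// => ?; apply: nKL; by [left|right].
Qed.

Lemma csuppD f g : csupp_on U f -> csupp_on U g ->
  csupp_on U (fun x => f x + g x).
Proof.
move=> cf cg; have := csupp_lin 1 cf cg; congr csupp_on.
by apply/funext => x; rewrite mul1r.
Qed.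

Lemma csuppZ c f : csupp_on U f -> csupp_on U (fun x => c * f x).
Proof.
move=> cf; have := csupp_lin c cf csupp0; congr csupp_on.
by apply/funext => x; rewrite addr0.
Qed.

Lemma csuppB f g : csupp_on U f -> csupp_on U g ->
  csupp_on U (fun x => f x - g x).
Proof.
move=> cf cg; have := csupp_lin (-1) cg cf; congr csupp_on.
by apply/funext => x; rewrite mulN1r addrC.
Qed.

Lemma csupp_sum (I : Type) (s : seq I) (f : I -> T -> R) :
  (forall i, csupp_on U (f i)) -> csupp_on U (fun x => \sum_(i <- s) f i x).
Proof.
move=> cf; elim: s => [|i s IH].
  rewrite [X in csupp_on _ X](_ : _ = fun=> 0); first exact: csupp0.
  by apply/funext => x; rewrite big_nil.
rewrite [X in csupp_on _ X](_ : _ = fun x => f i x + \sum_(i <- s) f i x).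
  exact: csuppD.
by apply/funext => x; rewrite big_cons.
Qed.

Lemma csuppM f g : csupp_on U f -> (forall x, U x -> {for x, continuous g}) ->
  csupp_on U (fun x => f x * g x).
Proof.
move=> [cf [K [cK KU Kf]]] cg; split=> [x Ux|].
  by apply: continuousM; [exact: cf|exact: cg].
by exists K; split=> // x /Kf ->; rewrite mul0r.
Qed.

Lemma csuppT f : hausdorff_space T -> csupp_on U f -> csupp f.
Proof.
move=> hT [cf [K [cK KU Kf]]]; split; last by exists K.
move=> x _; have [Kx|nKx] := pselect (K x); first exact/cf/KU.
have oK : open (~` K) by apply: closed_openC; exact: compact_closed.
rewrite /prop_for /continuous_at (Kf _ nKx); apply: cvg_near_cst.
by apply: filterS (open_nbhs_nbhs (conj oK nKx)) => y; exact: Kf.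
Qed.

Section I.
Variables (I : (T -> R) -> R) (rI : radon U I).

Lemma radon_lin c f g : csupp_on U f -> csupp_on U g ->
  I (fun x => c * f x + g x) = c * I f + I g.
Proof. by move=> cf cg; rewrite (rI.1 c). Qed.

Lemma radonD f g : csupp_on U f -> csupp_on U g ->
  I (fun x => f x + g x) = I f + I g.
Proof.
move=> cf cg; rewrite -[I f]mul1r -radon_lin//; congr I.
by apply/funext => x; rewrite mul1r.
Qed.

Lemma radonB f g : csupp_on U f -> csupp_on U g ->
  I (fun x => f x - g x) = I f - I g.
Proof.
move=> cf cg; rewrite addrC -mulN1r -radon_lin//; congr I.
by apply/funext => x; rewrite mulN1r addrC.
Qed.

Lemma radon0 : I (fun=> 0) = 0.
Proof.
rewrite -[RHS](subrr (I (fun=> 0))) -(radonB csupp0 csupp0); congr I.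
by apply/funext => x; rewrite subr0.
Qed.

Lemma radonZ c f : csupp_on U f -> I (fun x => c * f x) = c * I f.
Proof.
move=> cf; rewrite -[RHS]addr0 -radon0 -radon_lin//; last exact: csupp0.
by congr I; apply/funext => x; rewrite addr0.
Qed.

Lemma radon_sum (J : Type) (s : seq J) (f : J -> T -> R) :
  (forall i, csupp_on U (f i)) ->
  I (fun x => \sum_(i <- s) f i x) = \sum_(i <- s) I (f i).
Proof.
move=> cf; elim: s => [|i s IH].
  rewrite big_nil -[RHS]radon0; congr I.
  by apply/funext => x; rewrite big_nil.
rewrite big_cons -IH -radonD//; last exact: csupp_sum.
by congr I; apply/funext => x; rewrite big_cons.
Qed.

Lemma radon_ge0 f : csupp_on U f -> (forall x, 0 <= f x) -> 0 <= I f.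
Proof. by move: rI.2.1; exact. Qed.

Lemma radon_gt0 f x : csupp_on U f -> (forall x, 0 <= f x) -> 0 < f x ->
  0 < I f.
Proof. by move=> cf f0 fx; apply: rI.2.2 => //; exists x. Qed.

Lemma radon_le f g : csupp_on U f -> csupp_on U g -> (forall x, f x <= g x) ->
  I f <= I g.
Proof.
move=> cf cg fg; rewrite -subr_ge0 -radonB//; apply: radon_ge0.
  exact: csuppB.
by move=> x; rewrite subr_ge0.
Qed.

Lemma radon_norm_le f g : csupp_on U f -> csupp_on U g ->
  (forall x, `|f x| <= g x) -> `|I f| <= I g.
Proof.
move=> cf cg fg; rewrite ler_norml; apply/andP; split.
  rewrite -mulN1r -radonZ//; apply: radon_le => //; first exact: csuppZ.
  by move=> x; rewrite mulN1r; move: (fg x); rewrite ler_norml => /andP[].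
by apply: radon_le => // x; move: (fg x); rewrite ler_norml => /andP[].
Qed.

End I.

End Basic.

(** The weight may be singular on the boundary of [U], as a negative power of a determinant is; the
    product with a function supported inside [U] is still continuous of compact support on the whole
    space. *)
Lemma radon_weight (T : topologicalType) (U : set T) (I : (T -> R) -> R) (w : T -> R) :
  hausdorff_space T -> radon setT I ->
  (forall x, U x -> {for x, continuous w}) -> (forall x, U x -> 0 < w x) ->
  radon U (fun f => I (fun x => f x * w x)).
Proof.
move=> hT rI cw w0.
have cM f : csupp_on U f -> csupp (fun x => f x * w x).
  by move=> cf; exact: csuppT hT (csuppM cf cw).
have fw0 f : csupp_on U f -> (forall x, 0 <= f x) -> forall x, 0 <= f x * w x.
  move=> [_ [K [_ KU Kf]]] f0 x; have [/KU/w0 /ltW|/Kf ->] := pselect (K x).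
    exact: mulr_ge0.
  by rewrite mul0r.
split=> [c f g cf cg|].
  rewrite -(radon_lin rI); [|exact: cM|exact: cM].
  by congr I; apply/funext => x; rewrite mulrDl mulrA.
split=> f cf f0; first by apply: (radon_ge0 rI); [exact: cM|exact: fw0].
move=> [x fx]; apply: (radon_gt0 (x := x) rI); [exact: cM|exact: fw0|].
apply: mulr_gt0 => //; apply: w0; have [_ [K [_ KU Kf]]] := cf.
by apply: KU; apply: contrapT => /Kf E; rewrite E ltxx in fx.
Qed.

Lemma has_bumps_prod (T1 T2 : topologicalType) :
  has_bumps T1 -> has_bumps T2 -> has_bumps (T1 * T2)%type.
Proof.
move=> b1 b2 [x1 x2] A [[A1 A2] [/= /b1[g1 [c1 p1 q1 v1]] /b2[g2 [c2 p2 q2 v2]]] sA].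
exists (fun z => g1 z.1 * g2 z.2); split=> /=.
- have [k1 [K1 [cK1 _ sK1]]] := c1; have [k2 [K2 [cK2 _ sK2]]] := c2.
  split=> [[y1 y2] _|].
    apply: (@continuousM _ _ (fun z => g1 z.1) (fun z => g2 z.2)).
      by apply: continuous_comp; [exact: cvg_fst|exact: k1].
    by apply: continuous_comp; [exact: cvg_snd|exact: k2].
  exists (K1 `*` K2); split=> //; first exact: compact_setX.
  move=> [y1 y2] /not_andP[/= /sK1 ->|/= /sK2 ->]; rewrite ?mul0r ?mulr0//.
- by move=> y; exact: mulr_ge0.
- exact: mulr_gt0.
- move=> [y1 y2] nA; have [/v1 ->|h1] := pselect (~ A1 y1); first by rewrite mul0r.
  have [/v2 ->|h2] := pselect (~ A2 y2); first by rewrite mulr0.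
  by case: nA; apply: sA; split=> /=; apply: contrapT.
Qed.

(** * Partitions of unity and continuity of positive functionals *)

Section Bumps.
Variables (T : topologicalType) (bT : has_bumps T).

(** A partition of unity before normalization: finitely many bumps subordinate to the given
    neighbourhoods, with sum at least 1 on [K]. *)
Lemma bump_cover (K : set T) (U : T -> set T) : compact K ->
  (forall x, K x -> nbhs x (U x)) ->
  exists (s : seq T) (g : T -> T -> R),
    [/\ forall x, csupp (g x), forall x y, 0 <= g x y,
        forall x y, x \in s -> ~ U x y -> g x y = 0,
        forall x, x \in s -> K x
      & forall y, K y -> 1 <= \sum_(x <- s) g x y].
Proof.
move=> cK KU.
have /choice[g gP] x : exists g : T -> R, [/\ csupp g, forall y, 0 <= g y &
    K x -> 1 < g x /\ forall y, ~ U x y -> g y = 0].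
  have [Kx|nKx] := pselect (K x); last first.
    by exists (fun=> 0); split=> //; exact: csupp0.
  have [g [cg g0 gx gU]] := bT (KU _ Kx).
  (* Scaled to take the value 2 at [x], so that it stays above 1 near [x]. *)
  exists (fun y => 2 / g x * g y); split; first exact: csuppZ.
    by move=> y; rewrite mulr_ge0// divr_ge0// ltW.
  by move=> _; split=> [|y /gU ->]; rewrite ?mulr0// divfK ?gt_eqF// ltr1n.
(* The filter of large finite subsets of [K]: compactness, in its near-covering form, says that for
   a large enough list each point of [K] sees one of its bumps exceed 1. *)
pose G : set_system (seq T) := [set A | exists2 s : seq T,
  (forall x, x \in s -> K x) & forall s' : seq T, (forall x, x \in s -> x \in s') ->
  (forall x, x \in s' -> K x) -> A s'].
have FG : Filter G.
  split; first by exists [::].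
  - move=> A B [s sK sA] [t tK tB]; exists (s ++ t).
      by move=> x; rewrite mem_cat => /orP[/sK|/tK].
    move=> u su uK; split; [apply: sA|apply: tB] => // x xs.
      by apply: su; rewrite mem_cat xs.
    by apply: su; rewrite mem_cat xs orbT.
  - by move=> A B AB [s sK sA]; exists s => // t ts tK; exact/AB/sA.
have /compact_near_coveringP/(_ _ G (fun (s : seq T) z => exists2 x, x \in s & 1 < g x z) FG) := cK.
case.
  move=> x Kx; exists ([set z | 1 < g x z], [set s : seq T | x \in s]); last first.
    by move=> [z s] /= [gz xs]; exists x.
  have [[cg _] _ /(_ Kx)[gx _]] := gP x.
  split=> /=.
    by move/cvgrPdist_lt: (cg x I) => /(_ (g x x - 1)); rewrite subr_gt0 => /(_ gx);
      apply: filterS => z /(le_lt_trans (ler_norm _)); rewrite ltrD2l ltrN2.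
  exists [:: x] => [y|t xt tK]; first by rewrite inE => /eqP ->.
  by apply: xt; rewrite inE.
move=> s sK /(_ s (fun _ => id) sK) Ks; exists s, g; split.
- by move=> x; have [] := gP x.
- by move=> x; have [] := gP x.
- by move=> x y /sK Kx; have [_ _ /(_ Kx)[_]] := gP x; exact.
- by [].
move=> y /Ks[x /= xD gx]; rewrite (big_rem x)//= (le_trans (ltW gx))//.
by rewrite lerDl; apply: sumr_ge0 => z _; have [] := gP z.
Qed.

Lemma plateau (K : set T) : compact K ->
  exists g : T -> R, [/\ csupp g, forall y, 0 <= g y & forall y, K y -> 1 <= g y].
Proof.
move=> cK; have [||s [g [cg g0 _ _ gK]]] := @bump_cover K (fun=> setT) => //.
  by move=> x _; exact: filterT.
exists (fun y => \sum_(x <- s) g x y); split=> //; first exact: csupp_sum.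
by move=> y; apply: sumr_ge0.
Qed.

(** A positive functional is bounded on the functions supported in a fixed compact set: such a
    function is dominated by its bound times a plateau function, whose integral is the constant. *)
Lemma radon_bound I (K : set T) : radon setT I -> compact K ->
  exists2 C : R, 0 <= C & forall f M, csupp f -> (forall x, ~ K x -> f x = 0) ->
    (forall x, K x -> `|f x| <= M) -> 0 <= M -> `|I f| <= M * C.
Proof.
move=> rI /plateau[g [cg g0 gK]]; exists (I g); first exact: (radon_ge0 rI).
move=> f M cf fK fM M0; rewrite -(radonZ rI)//.
apply: (radon_norm_le rI) => //; first exact: csuppZ.
move=> x; have [Kx|/fK ->] := pselect (K x); last by rewrite normr0 mulr_ge0.
by rewrite (le_trans (fM _ Kx))// ler_peMr// gK.
Qed.

Lemma radon_cvg S (G : set_system S) (f : S -> T -> R) (g : T -> R) I K :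
  Filter G -> radon setT I -> compact K -> csupp g ->
  (forall x, ~ K x -> g x = 0) ->
  (\forall s \near G, csupp (f s)) ->
  (\forall s \near G, forall x, ~ K x -> f s x = 0) ->
  (forall e, 0 < e -> \forall s \near G, forall x, K x -> `|f s x - g x| <= e) ->
  I (f s) @[s --> G] --> I g.
Proof.
move=> FG rI cK cg gK cf fK fg; have [C C0 hC] := radon_bound rI cK.
apply/cvgrPdist_le => e e0.
have e'0 : 0 < e / (C + 1) by rewrite divr_gt0// ltr_wpDl.
near=> s; rewrite distrC -(radonB rI)//; last by near: s.
apply: (@le_trans _ _ (e / (C + 1) * C)).
  apply: hC; [apply: csuppB => //; by near: s| | |exact: ltW].
    move=> x nKx; rewrite gK// subr0; move: (x) nKx; by near: s.
  by near: s; exact: fg.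
by rewrite mulrAC ler_pdivrMr ?ltr_wpDl// ler_pM2l// lerDl.
Unshelve. all: by end_near. Qed.

End Bumps.

(** The tube argument: joint continuity along the compact slice over [s] gives an estimate uniform
    in the second variable. *)
Lemma near_uniform (S T : topologicalType) (f : S -> T -> R) (s : S) K :
  compact K -> (forall y, K y -> {for (s, y), continuous (fun p => f p.1 p.2)}) ->
  forall e, 0 < e ->
  \forall t \near s, forall y, K y -> `|f t y - f s y| <= e.
Proof.
move=> cK cf e e0.
have /compact_near_coveringP/(_ S (nbhs s)) := cK.
move=> /(_ (fun t y => `|f t y - f s y| <= e)); apply=> y Ky.
have e2 : 0 < e / 2 by rewrite divr_gt0.
have /cvgrPdist_le/(_ _ e2) := cf y Ky.
rewrite /= !near_simpl => h.
have h1 : \forall y' \near y, `|f s y - f s y'| <= e / 2.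
  have [[A B] [/= As By] AB] := h.
  apply: filterS By => y' By'; exact: (AB (s, y') (conj (nbhs_singleton As) By')).
have [[A B] [/= As By] AB] := h.
exists ([set y' | B y' /\ `|f s y - f s y'| <= e / 2], A).
  by split=> //=; exact: filterI.
move=> [y' t] [/= [By' Hy'] At].
rewrite [leLHS](_ : _ = `|(f t y' - f s y) + (f s y - f s y')|); last first.
  by rewrite addrA subrK.
rewrite (le_trans (ler_normD _ _))// [leRHS](splitr e) lerD//.
by rewrite distrC; exact: (AB (t, y')).
Qed.

Lemma radon_continuous (S T : topologicalType) (f : S -> T -> R) (s : S) I K :
  has_bumps T -> radon setT I -> compact K ->
  (\forall t \near s, csupp (f t)) ->
  (\forall t \near s, forall x, ~ K x -> f t x = 0) ->
  (forall y, K y -> {for (s, y), continuous (fun p => f p.1 p.2)}) ->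
  {for s, continuous (fun t => I (f t))}.
Proof.
move=> bT rI cK cf fK fc; apply: (@radon_cvg _ bT _ _ f (f s) I K) => //.
- exact: nbhs_singleton cf.
- exact: nbhs_singleton fK.
- exact: near_uniform.
Qed.

(** * Products of functionals and exchange of integrals *)

Section Fubini.
Variables (T1 T2 : topologicalType).
Variables (b1 : has_bumps T1) (b2 : has_bumps T2).
Variables (I1 : (T1 -> R) -> R) (r1 : radon setT I1).
Variables (I2 : (T2 -> R) -> R) (r2 : radon setT I2).

Lemma csupp_pair (f : T1 * T2 -> R) : csupp f ->
  exists K1 K2, [/\ compact K1, compact K2, (forall x y, ~ K1 x -> f (x, y) = 0)
    & forall x y, ~ K2 y -> f (x, y) = 0].
Proof.
move=> [cf [K [cK _ Kf]]]; exists (fst @` K), (snd @` K); split.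
- apply: continuous_compact => //; apply: continuous_subspaceT => x.
  exact: cvg_fst.
- apply: continuous_compact => //; apply: continuous_subspaceT => x.
  exact: cvg_snd.
- by move=> x y nK; apply: Kf => Kxy; apply: nK; exists (x, y).
- by move=> x y nK; apply: Kf => Kxy; apply: nK; exists (x, y).
Qed.

Lemma csupp_pairr (f : T1 * T2 -> R) x : csupp f -> csupp (fun y => f (x, y)).
Proof.
move=> cf; have [K1 [K2 [cK1 cK2 K1f K2f]]] := csupp_pair cf.
split; last by exists K2; split=> // y /K2f.
move=> y _; apply: (@continuous_comp _ _ _ (fun y => (x, y)) f).
  by apply: cvg_pair => //=; exact: cvg_cst.
by have [+ _] := cf; exact.
Qed.

Lemma csupp_pairl (f : T1 * T2 -> R) y : csupp f -> csupp (fun x => f (x, y)).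
Proof.
move=> cf; have [K1 [K2 [cK1 cK2 K1f K2f]]] := csupp_pair cf.
split; last by exists K1; split=> // x /K1f.
move=> x _; apply: (@continuous_comp _ _ _ (fun x => (x, y)) f).
  by apply: cvg_pair => //=; exact: cvg_cst.
by have [+ _] := cf; exact.
Qed.

Lemma csupp_int2 (f : T1 * T2 -> R) : csupp f ->
  csupp (fun x => I2 (fun y => f (x, y))).
Proof.
move=> cf; have [K1 [K2 [cK1 cK2 K1f K2f]]] := csupp_pair cf.
split=> [x _|].
  apply: (@radon_continuous _ _ (fun x y => f (x, y)) x I2 K2) => //.
  - by near=> t; exact: csupp_pairr.
  - by near=> t => y; exact: K2f.
  - move=> y _; rewrite (_ : (fun p => _) = f); first by have [+ _] := cf; exact.
    by apply/funext => -[].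
exists K1; split=> // x nK; rewrite -[RHS](radon0 r2); congr I2.
by apply/funext => y; exact: K1f.
Unshelve. all: by end_near. Qed.

Lemma csupp_int1 (f : T1 * T2 -> R) : csupp f ->
  csupp (fun y => I1 (fun x => f (x, y))).
Proof.
move=> cf; have [K1 [K2 [cK1 cK2 K1f K2f]]] := csupp_pair cf.
split=> [y _|].
  apply: (@radon_continuous _ _ (fun y x => f (x, y)) y I1 K1) => //.
  - by near=> t; exact: csupp_pairl.
  - by near=> t => x; exact: K1f.
  - move=> x _; apply: (@continuous_comp _ _ _ (fun p => (p.2, p.1)) f).
      by apply: cvg_pair => /=; [exact: cvg_snd|exact: cvg_fst].
    by have [+ _] := cf; exact.
exists K2; split=> // y nK; rewrite -[RHS](radon0 r1); congr I1.
by apply/funext => x; exact: K2f.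
Unshelve. all: by end_near. Qed.

Lemma radon_prod : radon setT (fun f => I1 (fun x => I2 (fun y => f (x, y)))).
Proof.
split=> [c f g cf cg|].
  rewrite -(radon_lin r1); [|exact: csupp_int2|exact: csupp_int2].
  congr I1; apply/funext => x.
  by rewrite -(radon_lin r2 _ (csupp_pairr x cf) (csupp_pairr x cg)).
have i0 (f : T1 * T2 -> R) : csupp f -> (forall x, 0 <= f x) -> forall x, 0 <= I2 (fun y => f (x, y)).
  by move=> cf f0 x; apply: (radon_ge0 r2 (csupp_pairr x cf)) => y; exact: f0.
split=> f cf f0; first by apply: (radon_ge0 r1); [exact: csupp_int2|exact: i0].
move=> [[x y] fxy]; apply: (radon_gt0 (x := x) r1); [exact: csupp_int2|exact: i0|].
by apply: (radon_gt0 (x := y) r2 (csupp_pairr x cf)) => // z; exact: f0.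
Qed.

Lemma csupp_tensor (g : T1 -> R) (h : T2 -> R) : csupp g -> csupp h ->
  csupp (fun z => g z.1 * h z.2).
Proof.
move=> [k1 [K1 [cK1 _ sK1]]] [k2 [K2 [cK2 _ sK2]]].
split=> [[y1 y2] _|].
  apply: (@continuousM _ _ (fun z => g z.1) (fun z => h z.2)).
    by apply: continuous_comp; [exact: cvg_fst|exact: k1].
  by apply: continuous_comp; [exact: cvg_snd|exact: k2].
exists (K1 `*` K2); split=> //; first exact: compact_setX.
by move=> [y1 y2] /not_andP[/= /sK1 ->|/= /sK2 ->]; rewrite ?mul0r ?mulr0.
Qed.

(* The [r t] form a partition of unity in the first variable. *)
Lemma tensor_approx (f : T1 * T2 -> R) : csupp f ->
  exists (g : T1 -> R) (h : T2 -> R), [/\ csupp g, csupp h &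
    forall e, 0 < e -> exists (s : seq T1) (r : T1 -> T1 -> R),
     (forall x, csupp (r x)) /\ forall x y,
       `|f (x, y) - \sum_(t <- s) r t x * f (t, y)| <= e * (g x * h y)].
Proof.
move=> cf; have [K1 [K2 [cK1 cK2 K1f K2f]]] := csupp_pair cf.
have [g [cg g0 gK]] := plateau b1 cK1; have [h [ch h0 hK]] := plateau b2 cK2.
exists g, h; split=> // e e0.
pose U x := [set t | forall y, K2 y -> `|f (t, y) - f (x, y)| <= e].
have UK x : K1 x -> nbhs x (U x).
  move=> _; apply: (near_uniform (f := fun x y => f (x, y))) => // y _.
  rewrite (_ : (fun p => _) = f); first by have [+ _] := cf; exact.
  by apply/funext => -[].
have [s [r [cr r0 rU sK rK]]] := bump_cover b1 cK1 UK.
pose G x := \sum_(t <- s) r t x.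
have G0 x : 0 <= G x by apply: sumr_ge0.
have M0 x : 0 < Order.max 1 (G x) by rewrite lt_max ltr01.
(* Normalizing factor for the bumps: [G x * w x] equals 1 on [K1], where both [g] and [G] are at
   least 1, and never exceeds [g x]. This makes the error estimate hold off [K1] as well. *)
pose w x := Order.min 1 (g x) / Order.max 1 (G x).
have w0 x : 0 <= w x by apply: divr_ge0; [rewrite le_min ler01 g0|exact: ltW].
have cw x : {for x, continuous w}.
  apply: continuousM.
    by apply: (@continuous_min R T1 (fun=> 1) g); [exact: cvg_cst|exact: cg.1].
  apply: continuousV; first by rewrite gt_eqF.
  apply: (@continuous_max R T1 (fun=> 1) G); first exact: cvg_cst.
  by have [+ _] := csupp_sum s cr; exact.
exists s, (fun t x => r t x * w x); split=> [x|x y]; first exact: csuppM.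
have Gw x' : G x' * w x' <= Order.min 1 (g x').
  rewrite /w mulrCA ler_piMr ?le_min ?ler01 ?g0// ler_pdivrMr// mul1r.
  by rewrite le_max lexx orbT.
have [K2y|nK2y] := pselect (K2 y); last first.
  rewrite K2f// big1 ?subr0 ?normr0 ?mulr_ge0 ?(ltW e0)// => t _.
  by rewrite K2f ?mulr0.
have key : `|G x * w x * f (x, y) - \sum_(t <- s) r t x * w x * f (t, y)| <=
    e * (G x * w x).
  rewrite !mulr_suml -sumrB (le_trans (ler_norm_sum _ _ _))// mulr_sumr.
  rewrite big_seq [leRHS]big_seq; apply: ler_sum => t ts.
  have rw0 : 0 <= r t x * w x by apply: mulr_ge0; [exact: r0|exact: w0].
  rewrite -mulrBr normrM (ger0_norm rw0) mulrC.
  have [Ux|/(rU _ _ ts) ->] := pselect (U t x); last by rewrite mul0r !mulr0.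
  by apply: ler_wpM2r => //; exact: Ux.
have hy : 1 <= h y by exact: hK.
have [K1x|nK1x] := pselect (K1 x).
  have E : G x * w x = 1.
    rewrite /w min_l ?gK// max_r ?rK// div1r divff// gt_eqF//.
    by rewrite (lt_le_trans ltr01)// rK.
  move: key; rewrite E mul1r mulr1 => /le_trans; apply.
  by rewrite ler_peMr ?(ltW e0)// -[1]mulr1 ler_pM ?gK.
move: key; rewrite K1f// mulr0 => /le_trans; apply.
rewrite ler_pM2l// (le_trans (Gw x))// ge_min; apply/orP; right.
by rewrite ler_peMr.
Qed.

(** Both iterated integrals agree on finite sums of products. By [tensor_approx] such sums
    approximate [f] within a multiple of a fixed product function, so both sides are arbitrarily
    close to a common value. *)
Lemma radon_swap (f : T1 * T2 -> R) : csupp f ->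
  I1 (fun x => I2 (fun y => f (x, y))) = I2 (fun y => I1 (fun x => f (x, y))).
Proof.
move=> cf; have [g [h [cg ch hap]]] := tensor_approx cf.
have ap e : 0 < e -> exists c,
    `|I1 (fun x => I2 (fun y => f (x, y))) - c| <= e * (I1 g * I2 h) /\
    `|I2 (fun y => I1 (fun x => f (x, y))) - c| <= e * (I1 g * I2 h).
  move=> /hap[s [r [cr fr]]].
  have ct t : csupp (fun z => r t z.1 * f (t, z.2)).
    exact: (csupp_tensor (cr t) (csupp_pairr t cf)).
  have cF : csupp (fun z => f z - \sum_(t <- s) r t z.1 * f (t, z.2)).
    exact: (csuppB cf (csupp_sum s ct)).
  have cgh : csupp (fun z => e * (g z.1 * h z.2)).
    exact: (csuppZ e (csupp_tensor cg ch)).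
  exists (\sum_(t <- s) I1 (r t) * I2 (fun y => f (t, y))); split.
  - rewrite (_ : _ - _ = I1 (fun x => I2 (fun y => f (x, y) - \sum_(t <- s) r t x * f (t, y)))).
      rewrite [leRHS](_ : _ = I1 (fun x => I2 (fun y => e * (g x * h y)))).
        by apply: (radon_norm_le radon_prod cF cgh) => -[].
      rewrite mulrA -(radonZ r1)// mulrC -(radonZ r1); last exact: csuppZ.
      congr I1; apply/funext => x; rewrite mulrC -(radonZ r2)//.
      by congr I2; apply/funext => y; rewrite mulrA.
    rewrite [RHS](_ : _ = I1 (fun x => I2 (fun y => f (x, y)) -
        \sum_(t <- s) I2 (fun y => r t x * f (t, y)))); last first.
      congr I1; apply/funext => x; rewrite (radonB r2) ?(radon_sum r2)//.
      + by move=> t; exact: csupp_pairr (ct t).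
      + exact: csupp_pairr.
      + by apply: csupp_sum => t; exact: csupp_pairr (ct t).
    rewrite (radonB r1) ?(radon_sum r1).
    + congr (_ - _); apply: eq_bigr => t _; rewrite mulrC -(radonZ r1)//.
      by congr I1; apply/funext => x; rewrite (radonZ r2) 1?mulrC//; exact: csupp_pairr.
    + by move=> t; exact: csupp_int2 (ct t).
    + exact: csupp_int2.
    + by apply: csupp_sum => t; exact: csupp_int2 (ct t).
  - rewrite (_ : _ - _ = I2 (fun y => I1 (fun x => f (x, y) - \sum_(t <- s) r t x * f (t, y)))).
      rewrite [leRHS](_ : _ = I2 (fun y => I1 (fun x => e * (g x * h y)))).
        have h1 := csupp_int1 cF; have h2 := csupp_int1 cgh.
        apply: (radon_norm_le r2 h1 h2) => y.
        apply: (radon_norm_le r1 (csupp_pairl y cF) (csupp_pairl y cgh)) => x.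
        exact: fr.
      rewrite mulrA -(radonZ r2)//.
      congr I2; apply/funext => y; rewrite mulrAC -(radonZ r1)//.
      by congr I1; apply/funext => x; rewrite -mulrA [h y * _]mulrC.
    rewrite [RHS](_ : _ = I2 (fun y => I1 (fun x => f (x, y)) -
        \sum_(t <- s) I1 (fun x => r t x * f (t, y)))); last first.
      congr I2; apply/funext => y; rewrite (radonB r1) ?(radon_sum r1)//.
      + by move=> t; exact: csupp_pairl (ct t).
      + exact: csupp_pairl.
      + by apply: csupp_sum => t; exact: csupp_pairl (ct t).
    rewrite (radonB r2) ?(radon_sum r2).
    + congr (_ - _); apply: eq_bigr => t _; rewrite -(radonZ r2)//; last exact: csupp_pairr.
      congr I2; apply/funext => y; rewrite mulrC -(radonZ r1)//.
      by congr I1; apply/funext => x; rewrite mulrC.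
    + by move=> t; exact: csupp_int1 (ct t).
    + exact: csupp_int1.
    + by apply: csupp_sum => t; exact: csupp_int1 (ct t).
set a := I1 (fun x => I2 (fun y => f (x, y))) in ap *.
set b := I2 (fun y => I1 (fun x => f (x, y))) in ap *.
apply/eqP; rewrite -subr_eq0 -normr_le0; apply/ler_addgt0Pl => e e0; rewrite addr0.
pose C := I1 g * I2 h.
have C0 : 0 < `|C| + 1 by rewrite ltr_wpDl.
have [|c [ac bc]] := ap (e / 2 / (`|C| + 1)); first by rewrite !divr_gt0.
have le2 : e / 2 / (`|C| + 1) * C <= e / 2.
  rewrite mulrAC ler_pdivrMr// ler_pM2l ?divr_gt0//.
  by rewrite (le_trans (ler_norm _))// lerDl.
rewrite [X in `|X|](_ : _ = (a - c) - (b - c)); last by rewrite opprB addrA subrK.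
rewrite (le_trans (ler_normB _ _))// (splitr e) lerD//.
- exact: le_trans ac le2.
- exact: le_trans bc le2.
Qed.

End Fubini.
End Radon.
Local Notation csupp f := (csupp_on setT f).

(** * Matrices over a field with an absolute value *)

(** What the real, complex and non-archimedean cases have in common: the triangle inequality rather
    than its ultrametric form, the topology given by balls, and local compactness in the strong form
    of compact closed balls. *)
Definition absval (R : realType) (F : topFieldType) (a : F -> R) : Prop :=
  [/\ forall x, 0 <= a x /\ (a x = 0 <-> x = 0),
      forall x y, a (x * y) = a x * a y,
      forall x y, a (x + y) <= a x + a y,
      forall (x : F) (A : set F),
        nbhs x A <-> exists2 e : R, 0 < e & [set y | a (y - x) < e] `<=` A
    & forall r, compact [set x | a x <= r]].

Lemma hausdorff_prod (T1 T2 : topologicalType) :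
  hausdorff_space T1 -> hausdorff_space T2 -> hausdorff_space (T1 * T2)%type.
Proof.
move=> h1 h2 [x1 x2] [y1 y2] cl; congr pair.
- apply: h1 => A B xA yB.
  have [||z [/= Az Bz]] := cl [set z | A z.1] [set z | B z.1].
  + by exists (A, setT) => //=; [split=> //; exact: filterT|move=> z []].
  + by exists (B, setT) => //=; [split=> //; exact: filterT|move=> z []].
  by exists z.1.
- apply: h2 => A B xA yB.
  have [||z [/= Az Bz]] := cl [set z | A z.2] [set z | B z.2].
  + by exists (setT, A) => //=; [split=> //; exact: filterT|move=> z []].
  + by exists (setT, B) => //=; [split=> //; exact: filterT|move=> z []].
  by exists z.2.
Qed.

Lemma eq_continuous (T U : topologicalType) (f g : T -> U) x :
  f =1 g -> {for x, continuous g} -> {for x, continuous f}.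
Proof. by move=> /funext ->. Qed.

Lemma continuous_idf (T : topologicalType) (x : T) : {for x, continuous id}.
Proof. by move=> A. Qed.

Lemma continuous_cstf (T U : topologicalType) (c : U) (x : T) :
  {for x, continuous (fun=> c)}.
Proof. exact: cvg_cst. Qed.

Lemma continuous_pair (T U V : topologicalType) (f : T -> U) (g : T -> V) x :
  {for x, continuous f} -> {for x, continuous g} ->
  {for x, continuous (fun y => (f y, g y))}.
Proof. by move=> cf cg; apply: cvg_pair. Qed.

Lemma near_continuous (T U : topologicalType) (f g : T -> U) x :
  (\forall y \near x, f y = g y) -> {for x, continuous g} ->
  {for x, continuous f}.
Proof.
move=> fg cg A; rewrite (nbhs_singleton fg) => /cg.
by apply: filterS2 fg => y /= ->.
Qed.

Section MxEntry.
Variables (F : topologicalType).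

Lemma cvg_mx T (G : set_system T) p q (f : T -> 'M[F]_(p, q))
    (M : 'M[F]_(p, q)) : Filter G ->
  (forall i j, f y i j @[y --> G] --> M i j) -> f @ G --> M.
Proof.
move=> FG fM A [P /= MP PA]; apply: (@filterS _ G _ (fun y => forall i j, P i j (f y i j))).
  by move=> y; exact: PA.
apply: filter_forall => i; apply: filter_forall => j; exact: (fM i j _ (MP i j)).
Qed.

Lemma entry_continuous p q (i : 'I_p) (j : 'I_q) :
  continuous (fun M : 'M[F]_(p, q) => M i j).
Proof.
move=> M A MA; exists (fun i' j' => if (i' == i) && (j' == j) then A else setT).
  move=> i' j' /=; case: ifP => [/andP[/eqP -> /eqP ->]//|_]; exact: filterT.
by move=> N /= /(_ i j); rewrite !eqxx.
Qed.

Lemma continuous_mx (T : topologicalType) p q (f : T -> 'M[F]_(p, q)) x :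
  (forall i j, {for x, continuous (fun y => f y i j)}) -> {for x, continuous f}.
Proof. by move=> cf; apply: cvg_mx => i j; exact: cf. Qed.

Lemma continuous_entry (T : topologicalType) p q (f : T -> 'M[F]_(p, q)) x i j :
  {for x, continuous f} -> {for x, continuous (fun y => f y i j)}.
Proof.
move=> cf; apply: (@continuous_comp _ _ _ f (fun M : 'M[F]_(p, q) => M i j)) => //.
exact: entry_continuous.
Qed.

End MxEntry.

Section AbsVal.
Variables (R : realType) (F : topFieldType) (a : F -> R).
Hypothesis av : absval a.

Lemma av_ge0 x : 0 <= a x. Proof. by case: av => h _ _ _ _; case: (h x). Qed.
Lemma av_eq0 x : (a x == 0) = (x == 0).
Proof. by case: av => h _ _ _ _; case: (h x) => _ E; apply/eqP/eqP; rewrite E. Qed.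
Lemma av0 : a 0 = 0. Proof. by apply/eqP; rewrite av_eq0. Qed.
Lemma av_gt0 x : (0 < a x) = (x != 0).
Proof. by rewrite lt_neqAle av_ge0 andbT eq_sym av_eq0. Qed.
Lemma avM x y : a (x * y) = a x * a y. Proof. by case: av. Qed.
Lemma avD x y : a (x + y) <= a x + a y. Proof. by case: av. Qed.
Lemma av1 : a 1 = 1.
Proof.
have := avM 1 1; rewrite mulr1 => E; apply: (@mulfI _ (a 1)).
  by rewrite av_eq0 oner_eq0.
by rewrite -E mulr1.
Qed.
Lemma avN x : a (- x) = a x.
Proof.
suff E : a (-1) = 1 by rewrite -mulN1r avM E mul1r.
have : a (-1) * a (-1) = 1 by rewrite -avM mulrNN mulr1 av1.
move=> /eqP; rewrite -expr2 sqrf_eq1 => /orP[/eqP//|/eqP E].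
by have := av_ge0 (-1); rewrite E ler0N1.
Qed.
Lemma avV x : a (x^-1) = (a x)^-1.
Proof.
have [->|x0] := eqVneq x 0; first by rewrite invr0 av0 invr0.
apply: (@mulfI _ (a x)); first by rewrite av_eq0.
by rewrite -avM !mulfV ?av_eq0// av1.
Qed.
Lemma avX x n : a (x ^+ n) = a x ^+ n.
Proof. by elim: n => [|n IH]; rewrite ?av1// !exprS avM IH. Qed.
Lemma av_nbhs (x : F) (A : set F) :
  nbhs x A <-> exists2 e : R, 0 < e & [set y | a (y - x) < e] `<=` A.
Proof. by case: av. Qed.

Lemma av_compact r : compact [set x | a x <= r]. Proof. by case: av. Qed.

Lemma cvgFP T (G : set_system T) (f : T -> F) l : Filter G ->
  f @ G --> l <-> (forall e, 0 < e -> \forall y \near G, a (f y - l) < e).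
Proof.
move=> FG; split=> [fl e e0|fl A /av_nbhs[e e0 eA]].
  by apply: (fl [set y | a (y - l) < e]); apply/av_nbhs; exists e.
by apply: filterS (fl _ e0) => y /eA.
Qed.

Lemma av_continuous : continuous a.
Proof.
move=> x; apply/cvgrPdist_lt => e e0.
have : nbhs x [set y | a (y - x) < e] by apply/av_nbhs; exists e.
apply: filterS => y /=; apply: le_lt_trans; rewrite ler_norml; apply/andP; split.
  rewrite lerNl opprB lerBlDr -{1}(subrK x y); exact: avD.
rewrite lerBlDr -{1}(subrK y x) -(avN (y - x)) opprB; exact: avD.
Qed.

Section Cont.
Variable T : topologicalType.
Implicit Types f g : T -> F.

Lemma continuousDF f g x : {for x, continuous f} -> {for x, continuous g} ->
  {for x, continuous (fun y => f y + g y)}.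
Proof.
move=> /cvgFP cf /cvgFP cg; apply/cvgFP => e e0.
have e2 : 0 < e / 2 by rewrite divr_gt0.
near=> y; rewrite opprD addrACA (le_lt_trans (avD _ _))// [ltRHS]splitr ltrD//.
  by near: y; exact: cf.
by near: y; exact: cg.
Unshelve. all: by end_near. Qed.

Lemma continuousMF f g x : {for x, continuous f} -> {for x, continuous g} ->
  {for x, continuous (fun y => f y * g y)}.
Proof.
move=> /cvgFP cf /cvgFP cg; apply/cvgFP => e e0.
have C0 : 0 < 1 + a (f x) + a (g x) by rewrite addrAC ltr_wpDr ?av_ge0// ltr_wpDr ?av_ge0.
pose d := Order.min 1 (e / (1 + a (f x) + a (g x)) / 2).
have d0 : 0 < d by rewrite lt_min ltr01 !divr_gt0.
near=> y.
have h1 : a (f y - f x) < d by near: y; exact: cf.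
have h2 : a (g y - g x) < d by near: y; exact: cg.
have -> : f y * g y - f x * g x = (f y - f x) * (g y - g x) +
    ((f y - f x) * g x + f x * (g y - g x)).
  by ring.
rewrite (le_lt_trans (avD _ _))// (le_lt_trans (lerD (lexx _) (avD _ _)))// !avM.
apply: (@le_lt_trans _ _ (d * 1 + (d * a (g x) + a (f x) * d))).
  apply: lerD; first by rewrite ler_pM ?av_ge0 ?ltW// (lt_le_trans h2)// ge_min lexx.
  by apply: lerD; [rewrite ler_wpM2r ?av_ge0// ltW|rewrite ler_wpM2l ?av_ge0// ltW].
rewrite (mulrC (a (f x))) -!mulrDr [a (g x) + _]addrC addrA.
apply: (@le_lt_trans _ _ (e / 2)); last first.
  by rewrite ltr_pdivrMr// ltr_pMr// ltr1n.
by rewrite -ler_pdivlMr// mulrAC ge_min lexx orbT.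
Unshelve. all: by end_near. Qed.

Lemma continuousNF f x : {for x, continuous f} ->
  {for x, continuous (fun y => - f y)}.
Proof.
by move=> /cvgFP cf; apply/cvgFP => e /cf; apply: filterS => y; rewrite -opprD avN.
Qed.

Lemma continuousVF f x : {for x, continuous f} -> f x != 0 ->
  {for x, continuous (fun y => (f y)^-1)}.
Proof.
move=> /cvgFP cf fx0; apply/cvgFP => e e0.
have A0 : 0 < a (f x) by rewrite av_gt0.
pose d := Order.min (a (f x) / 2) (e * (a (f x) * (a (f x) / 2))).
have d0 : 0 < d by rewrite lt_min !mulr_gt0// ?invr_gt0.
near=> y.
have h : a (f y - f x) < d by near: y; exact: cf.
have hA : a (f x) / 2 < a (f y).
  have : a (f x) <= a (f y) + a (f y - f x).
    by rewrite -(avN (f y - f x)) opprB (le_trans _ (avD _ _))// addrC subrK.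
  rewrite {1}(splitr (a (f x))) => h'.
  rewrite -(ltrD2r (a (f x) / 2)) (le_lt_trans h')// ltrD2l (lt_le_trans h)//.
  by rewrite ge_min lexx.
have A0' : 0 < a (f y) by rewrite (lt_trans _ hA)// divr_gt0.
have fy0 : f y != 0 by rewrite -av_gt0.
have -> : (f y)^-1 - (f x)^-1 = (f x - f y) * ((f x)^-1 * (f y)^-1).
  rewrite mulrBl mulrA mulfV// mul1r mulrCA mulfV// mulr1 //.
rewrite avM -avN opprB avM !avV -invfM ltr_pdivrMr ?mulr_gt0//.
apply: (lt_le_trans h); rewrite ge_min; apply/orP; right.
by rewrite ler_pM2l// ler_pM2l// ltW.
Unshelve. all: by end_near. Qed.

Lemma continuous_sumF (I : Type) (s : seq I) (f : I -> T -> F) x :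
  (forall i, {for x, continuous (f i)}) ->
  {for x, continuous (fun y => \sum_(i <- s) f i y)}.
Proof.
move=> cf; elim: s => [|i s IH].
  by apply: eq_continuous => [y|]; [by rewrite big_nil|exact: cvg_cst].
apply: eq_continuous => [y|]; [by rewrite big_cons|exact: continuousDF].
Qed.

Lemma continuous_prodF (I : Type) (s : seq I) (f : I -> T -> F) x :
  (forall i, {for x, continuous (f i)}) ->
  {for x, continuous (fun y => \prod_(i <- s) f i y)}.
Proof.
move=> cf; elim: s => [|i s IH].
  by apply: eq_continuous => [y|]; [by rewrite big_nil|exact: cvg_cst].
apply: eq_continuous => [y|]; [by rewrite big_cons|exact: continuousMF].
Qed.

Lemma continuousDmx p q (f g : T -> 'M[F]_(p, q)) x :
  {for x, continuous f} -> {for x, continuous g} ->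
  {for x, continuous (fun y => f y + g y)}.
Proof.
move=> cf cg; apply: continuous_mx => i j; apply: eq_continuous => [y|]; first by rewrite mxE.
by apply: continuousDF; exact: continuous_entry.
Qed.

Lemma continuousNmx p q (f : T -> 'M[F]_(p, q)) x :
  {for x, continuous f} -> {for x, continuous (fun y => - f y)}.
Proof.
move=> cf; apply: continuous_mx => i j; apply: eq_continuous => [y|]; first by rewrite mxE.
by apply: continuousNF; exact: continuous_entry.
Qed.

Lemma continuousMmx p q r (f : T -> 'M[F]_(p, q)) (g : T -> 'M[F]_(q, r)) x :
  {for x, continuous f} -> {for x, continuous g} ->
  {for x, continuous (fun y => f y *m g y)}.
Proof.
move=> cf cg; apply: continuous_mx => i j; apply: eq_continuous => [y|]; first by rewrite mxE.
apply: continuous_sumF => k; apply: continuousMF; exact: continuous_entry.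
Qed.

Lemma continuousZmx p q (f : T -> F) (g : T -> 'M[F]_(p, q)) x :
  {for x, continuous f} -> {for x, continuous g} ->
  {for x, continuous (fun y => f y *: g y)}.
Proof.
move=> cf cg; apply: continuous_mx => i j; apply: eq_continuous => [y|]; first by rewrite mxE.
by apply: continuousMF => //; exact: continuous_entry.
Qed.

Lemma continuous_det n (f : T -> 'M[F]_n) x :
  {for x, continuous f} -> {for x, continuous (fun y => \det (f y))}.
Proof.
move=> cf; apply: continuous_sumF => s; apply: continuousMF; first exact: cvg_cst.
by apply: continuous_prodF => i; exact: continuous_entry.
Qed.

Lemma continuous_tr p q (f : T -> 'M[F]_(p, q)) x :
  {for x, continuous f} -> {for x, continuous (fun y => (f y)^T)}.
Proof.
move=> cf; apply: continuous_mx => i j; apply: eq_continuous => [y|]; first by rewrite mxE.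
exact: continuous_entry.
Qed.

Lemma continuous_scalar n (f : T -> F) x :
  {for x, continuous f} -> {for x, continuous (fun y => (f y)%:M : 'M[F]_n)}.
Proof.
move=> cf; apply: continuous_mx => i j; apply: eq_continuous => [y|]; first by rewrite mxE.
by case: (i == j); [exact: cf|apply: eq_continuous => [y|]; [by rewrite mulr0n|exact: cvg_cst]].
Qed.

Lemma continuous_row_mx p q1 q2 (f : T -> 'M[F]_(p, q1)) (g : T -> 'M[F]_(p, q2)) x :
  {for x, continuous f} -> {for x, continuous g} ->
  {for x, continuous (fun y => row_mx (f y) (g y))}.
Proof.
move=> cf cg; apply: continuous_mx => i j; apply: eq_continuous => [y|]; first by rewrite mxE.
by case: (fintype.split j) => k; exact: continuous_entry.
Qed.

Lemma continuous_col_mx p1 p2 q (f : T -> 'M[F]_(p1, q)) (g : T -> 'M[F]_(p2, q)) x :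
  {for x, continuous f} -> {for x, continuous g} ->
  {for x, continuous (fun y => col_mx (f y) (g y))}.
Proof.
move=> cf cg; apply: continuous_mx => i j; apply: eq_continuous => [y|]; first by rewrite mxE.
by case: (fintype.split i) => k; exact: continuous_entry.
Qed.

Lemma continuous_invmx n (f : T -> 'M[F]_n) x : {for x, continuous f} ->
  f x \in unitmx -> {for x, continuous (fun y => invmx (f y))}.
Proof.
move=> cf ux.
have dx0 : \det (f x) != 0 by rewrite -unitfE -unitmxE.
have near_unit : \forall y \near x, f y \in unitmx.
  have /cvgFP/(_ (a (\det (f x)))) := continuous_det cf.
  rewrite av_gt0 => /(_ dx0); apply: filterS => y; rewrite unitmxE unitfE.
  by apply: contraTneq => ->; rewrite sub0r avN ltxx.
apply: (@near_continuous _ _ _ (fun y => (\det (f y))^-1 *: \adj (f y))).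
  by apply: filterS near_unit => y uy; rewrite /invmx uy.
apply: continuousZmx; first by apply: continuousVF => //; exact: continuous_det.
apply: continuous_mx => i j; apply: eq_continuous => [y|]; first by rewrite mxE.
apply: continuousMF; first exact: cvg_cst.
apply: continuous_det; apply: continuous_mx => i' j'; apply: eq_continuous => [y|]; first by rewrite !mxE.
exact: continuous_entry.
Qed.

Lemma continuous_av f x : {for x, continuous f} ->
  {for x, continuous (fun y => a (f y))}.
Proof.
by move=> cf; apply: (@continuous_comp _ _ _ f a) => //; exact: av_continuous.
Qed.

End Cont.

Definition mxnorm p q (y : 'M[F]_(p, q)) : R := \sum_i \sum_j a (y i j).

Lemma le_mxnorm p q (y : 'M[F]_(p, q)) i j : a (y i j) <= mxnorm y.
Proof.
rewrite /mxnorm (bigD1 i)//= (bigD1 j)//= -addrA lerDl addr_ge0//.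
  by apply: sumr_ge0 => ? _; exact: av_ge0.
by apply: sumr_ge0 => ? _; apply: sumr_ge0 => ? _; exact: av_ge0.
Qed.

Lemma continuous_sumR (T : topologicalType) (I : Type) (s : seq I) (f : I -> T -> R) x :
  (forall i, {for x, continuous (f i)}) ->
  {for x, continuous (fun y => \sum_(i <- s) f i y)}.
Proof.
move=> cf; elim: s => [|i s IH].
  by apply: eq_continuous => [y|]; [by rewrite big_nil|exact: cvg_cst].
apply: eq_continuous => [y|]; [by rewrite big_cons|exact: continuousD].
Qed.

Lemma continuous_mxnorm (T : topologicalType) p q (f : T -> 'M[F]_(p, q)) x :
  {for x, continuous f} -> {for x, continuous (fun y => mxnorm (f y))}.
Proof.
move=> cf; apply: continuous_sumR => i; apply: continuous_sumR => j.
by apply: continuous_av; exact: continuous_entry.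
Qed.

Lemma hausdorff_mx p q : hausdorff_space 'M[F]_(p, q).
Proof.
move=> x y cl; apply/matrixP => i j; apply: contrapT => /eqP xy.
have e0 : 0 < a (x i j - y i j) / 2.
  by rewrite divr_gt0// av_gt0 subr_eq0.
have nb (z : 'M[F]_(p, q)) : nbhs z [set t : 'M[F]_(p, q) | a (t i j - z i j) < a (x i j - y i j) / 2].
  apply: (@entry_continuous F p q i j z [set t | a (t - z i j) < a (x i j - y i j) / 2]).
  by apply/av_nbhs; exists (a (x i j - y i j) / 2).
have [z [/= zx zy]] := cl _ _ (nb x) (nb y).
have : a (x i j - y i j) < a (x i j - y i j).
  rewrite [ltRHS]splitr -{1}(subrK (z i j) (x i j)) -addrA.
  by rewrite (le_lt_trans (avD _ _))// ltrD// -avN opprB.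
by rewrite ltxx.
Qed.

(** Reduced to products of two compact sets, splitting off one column at a time for a single row and
    then one row at a time. *)
Lemma compact_box p q r : compact [set y : 'M[F]_(p, q) | forall i j, a (y i j) <= r].
Proof.
have c1 q' : compact [set y : 'M[F]_(1, q') | forall i j, a (y i j) <= r].
  elim: q' => [|q' IH].
    rewrite [X in compact X](_ : _ = [set 0]); first exact: compact_set1.
    by rewrite eqEsubset; split=> [y _|y _ i []//]; apply/matrixP => i [].
  pose f (z : F * 'M[F]_(1, q')) : 'M[F]_(1, 1 + q') := row_mx z.1%:M z.2.
  have -> : [set y : 'M[F]_(1, q'.+1) | forall i j, a (y i j) <= r] =
     f @` ([set x | a x <= r] `*` [set y : 'M[F]_(1, q') | forall i j, a (y i j) <= r]).
    rewrite eqEsubset; split=> [y /= yr|_ [[t v] [/= tr vr] <-] i j].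
      exists ((y : 'M[F]_(1, 1 + q')) 0 0, rsubmx (y : 'M[F]_(1, 1 + q'))).
        by split=> [|i j] /=; rewrite ?mxE; exact: yr.
      rewrite /f /= -[RHS](@hsubmxK _ _ 1 q'); congr row_mx.
      by apply/matrixP => i j; rewrite !ord1 !mxE/= mulr1n; congr (y _ _); apply/val_inj.
    by rewrite /f /= mxE; case: splitP => k _; rewrite ?mxE ?ord1.
  apply: continuous_compact; last by apply: compact_setX => //; exact: av_compact.
  apply: continuous_subspaceT => z.
  apply: (continuous_row_mx (f := fun z => z.1%:M) (g := snd)); last exact: cvg_snd.
  by apply: (continuous_scalar (f := fst)); exact: cvg_fst.
elim: p => [|p IH].
  rewrite [X in compact X](_ : _ = [set 0]); first exact: compact_set1.
  by rewrite eqEsubset; split=> [y _|y _ []//]; apply/matrixP => -[].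
pose f (z : 'M[F]_(1, q) * 'M[F]_(p, q)) : 'M[F]_(1 + p, q) := col_mx z.1 z.2.
have -> : [set y : 'M[F]_(p.+1, q) | forall i j, a (y i j) <= r] =
   f @` ([set y : 'M[F]_(1, q) | forall i j, a (y i j) <= r] `*`
         [set y : 'M[F]_(p, q) | forall i j, a (y i j) <= r]).
  rewrite eqEsubset; split=> [y /= yr|_ [[u v] [/= ur vr] <-] i j].
    exists (usubmx (y : 'M[F]_(1 + p, q)), dsubmx (y : 'M[F]_(1 + p, q))).
      by split=> i j /=; rewrite mxE; exact: yr.
    exact: vsubmxK.
  by rewrite /f /= mxE; case: splitP.
apply: continuous_compact; last exact: compact_setX.
apply: continuous_subspaceT => z.
apply: (@continuous_col_mx _ 1 p q (@fst 'M[F]_(1, q) 'M[F]_(p, q)) snd z).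
- exact: cvg_fst.
- exact: cvg_snd.
Qed.

Lemma compact_closed_box p q (A : set 'M[F]_(p, q)) r :
  closed A -> (forall y, A y -> mxnorm y <= r) -> compact A.
Proof.
move=> cA Ar; apply: (subclosed_compact cA (@compact_box p q r)) => y Ay i j.
exact: le_trans (le_mxnorm _ _ _) (Ar _ Ay).
Qed.

Lemma closed_mxle (T : topologicalType) (f : T -> R) r : continuous f ->
  closed [set y | f y <= r].
Proof.
move=> cf; rewrite (_ : mkset _ = f @^-1` [set x | x <= r])//.
by apply: preimage_closed => [x|]; [move=> _; exact: cf|exact: closed_le].
Qed.

Lemma closed_mxge (T : topologicalType) (f : T -> R) r : continuous f ->
  closed [set y | r <= f y].
Proof.
move=> cf; rewrite (_ : mkset _ = f @^-1` [set x | r <= x])//.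
by apply: preimage_closed => [x|]; [move=> _; exact: cf|exact: closed_ge].
Qed.

Lemma nbhs_mxnorm p q (x : 'M[F]_(p, q)) A : nbhs x A ->
  exists2 e : R, 0 < e & forall y, mxnorm (y - x) < e -> A y.
Proof.
move=> [P /= xP PA].
have /choice[e eP] (ij : 'I_p * 'I_q) : exists e : R, 0 < e /\
    forall t, a (t - x ij.1 ij.2) < e -> P ij.1 ij.2 t.
  by have /av_nbhs[e e0 eP] := xP ij.1 ij.2; exists e.
exists (\big[Order.min/1]_ij e ij).
  by apply: lt_bigmin; [exact: ltr01|move=> ij _; case: (eP ij)].
move=> y ye; apply: PA => i j; have [_] := eP (i, j); apply => /=.
apply: (@le_lt_trans _ _ (mxnorm (y - x))).
  by rewrite (le_trans _ (le_mxnorm _ i j))// !mxE.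
by apply: (lt_le_trans ye); exact: (@bigmin_le _ _ _ 1 (i, j)).
Qed.

Lemma has_bumps_mx p q : has_bumps R 'M[F]_(p, q).
Proof.
move=> x A /nbhs_mxnorm[e e0 eA].
pose g (y : 'M[F]_(p, q)) : R := Order.max 0 (e / 2 - mxnorm (y - x)).
have cn : continuous (fun y : 'M[F]_(p, q) => mxnorm (y - x)).
  move=> y; apply: (@continuous_mxnorm _ p q (fun y : 'M[F]_(p, q) => y - x) y).
  by apply: (@continuousDmx 'M[F]_(p, q) p q id (fun=> - x)); [exact: continuous_idf|exact: continuous_cstf].
exists g; split.
- split=> [y _|].
    apply: (@continuous_max R 'M[F]_(p, q) (fun=> 0)
      (fun y : 'M[F]_(p, q) => e / 2 - mxnorm (y - x)) y); first exact: continuous_cstf.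
    by apply: continuousB; [exact: continuous_cstf|exact: cn].
  exists [set y | mxnorm (y - x) <= e]; split=> //.
    apply: (@compact_closed_box _ _ _ (e + mxnorm x)) => [|y yx].
      exact: closed_mxle.
    apply: le_trans (lerD yx (lexx (mxnorm x))).
    rewrite /mxnorm -big_split/=; apply: ler_sum => i _.
    rewrite -big_split/=; apply: ler_sum => j _.
    by rewrite (le_trans _ (avD _ _))// !mxE subrK.
  move=> y /negP; rewrite -ltNge => ey; rewrite /g max_l// subr_le0 ltW//.
  by rewrite (le_lt_trans _ ey)// ler_pdivrMr// ler_peMr ?ler1n// ltW.
- by move=> y; rewrite /g le_max lexx.
- rewrite /g lt_max subrr; apply/orP; right.
  rewrite [mxnorm _](_ : _ = 0) ?subr0 ?divr_gt0// /mxnorm big1// => i _.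
  by rewrite big1// => j _; rewrite mxE av0.
- move=> y nA; rewrite /g max_l// subr_le0 leNgt; apply/negP => ye; apply: nA.
  by apply: eA; rewrite (lt_trans ye)// ltr_pdivrMr// ltr_pMr// ltr1n.
Qed.

Lemma open_unitmx n : open [set y : 'M[F]_n | y \in unitmx].
Proof.
rewrite (_ : mkset _ = (fun y => a (\det y)) @^-1` [set r | 0 < r]).
  apply: open_comp; last exact: open_gt.
  by move=> y _; apply: continuous_av; apply: continuous_det; exact: continuous_idf.
by rewrite predeqE => y /=; rewrite av_gt0 unitmxE unitfE.
Qed.

End AbsVal.

(** * Haar functionals on matrices *)

Section Transport.
Variables (R : realType) (T1 T2 : topologicalType) (h : T1 -> T2) (k : T2 -> T1).
Hypotheses (ch : continuous h) (ck : continuous k) (hk : cancel h k).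

Lemma csupp_comp (f : T2 -> R) : csupp f -> csupp (fun x => f (h x)).
Proof.
move=> [cf [K [cK _ Kf]]]; split=> [x _|].
  by apply: (@continuous_comp _ _ _ h f); [exact: ch|exact: cf].
exists (k @` K); split=> //.
  by apply: continuous_compact => //; exact: continuous_subspaceT.
by move=> x nK; apply: Kf => Khx; apply: nK; exists (h x).
Qed.

Lemma radon_transport (I : (T1 -> R) -> R) : cancel k h -> radon setT I ->
  radon setT (fun f : T2 -> R => I (fun x => f (h x))).
Proof.
move=> kh rI; split=> [c f g cf cg|].
  by rewrite -(radon_lin rI c (csupp_comp cf) (csupp_comp cg)).
split=> f cf f0; first by apply: (radon_ge0 rI (csupp_comp cf)) => x; exact: f0.
move=> [y fy]; apply: (radon_gt0 (x := k y) rI (csupp_comp cf)) => [x|].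
  exact: f0.
by rewrite kh.
Qed.

End Transport.

Section Haar.
Variables (R : realType) (F : topFieldType) (a nu : F -> R).
Hypothesis av : absval a.

Let bmx p q : has_bumps R 'M[F]_(p, q) := @has_bumps_mx R F a av p q.
Arguments bmx : clear implicits.

(** Additive Haar measure as a functional. [nu c] multiplies the measure of sets, so substituting
    [c * t] in the integrand divides the integral by it. *)
Definition haar_fun (IF : (F -> R) -> R) : Prop :=
  [/\ radon setT IF,
      forall f s, csupp f -> IF (fun t => f (t + s)) = IF f
    & forall f c, csupp f -> c != 0 ->
        0 < nu c /\ IF (fun t => f (c * t)) = (nu c)^-1 * IF f].

(** The exponent [d] is separate from the length [q] so that integration over stacked rows can be
    set up once. It is used with [d = 1] for rows of length 1, then with [d = q] for rows of length
    [q]. *)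
Definition haar_row q d (IE : ('M[F]_(1, q) -> R) -> R) : Prop :=
  [/\ radon setT IE,
      forall f (v : 'M[F]_(1, q)), csupp f ->
        IE (fun u : 'M[F]_(1, q) => f (u + v)) = IE f
    & forall f c, csupp f -> c != 0 ->
        IE (fun u => f (c *: u)) = (nu c ^+ d)^-1 * IE f].

Section Columns.
Variables (q d : nat) (IE : ('M[F]_(1, q) -> R) -> R).
Hypothesis hE : haar_row d IE.

Fixpoint col_int p : ('M[F]_(p, q) -> R) -> R :=
  match p return ('M[F]_(p, q) -> R) -> R with
  | 0 => fun f => f 0
  | p'.+1 => fun f => IE (fun u => col_int (fun y => f (col_mx u y)))
  end.

Let rE : radon setT IE. Proof. by case: hE. Qed.

Lemma continuous_col_pair p :
  continuous (fun z : 'M[F]_(1, q) * 'M[F]_(p, q) => col_mx z.1 z.2).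
Proof.
move=> z; apply: (@continuous_col_mx _ _ 1 p q (@fst 'M[F]_(1, q) 'M[F]_(p, q)) snd z).
- exact: cvg_fst.
- exact: cvg_snd.
Qed.

Lemma continuous_submx_pair p :
  continuous (fun z : 'M[F]_(1 + p, q) => (usubmx z, dsubmx z)).
Proof.
move=> z; apply: continuous_pair; apply: continuous_mx => i j.
- apply: eq_continuous => [y|]; first by rewrite mxE.
  exact/continuous_entry/continuous_idf.
- apply: eq_continuous => [y|]; first by rewrite mxE.
  exact/continuous_entry/continuous_idf.
Qed.

Lemma col_pairK p : cancel (fun z : 'M[F]_(1, q) * 'M[F]_(p, q) => col_mx z.1 z.2)
  (fun z : 'M[F]_(1 + p, q) => (usubmx z, dsubmx z)).
Proof. by move=> [u v] /=; rewrite col_mxKu col_mxKd. Qed.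

Lemma csupp_col p (f : 'M[F]_(1 + p, q) -> R) : csupp f ->
  csupp (fun z : 'M[F]_(1, q) * 'M[F]_(p, q) => f (col_mx z.1 z.2)).
Proof.
exact: (csupp_comp (@continuous_col_pair p) (@continuous_submx_pair p) (@col_pairK p)).
Qed.

Lemma radon_col p : radon setT (@col_int p).
Proof.
elim: p => [|p IH].
  split=> [//|]; split=> [f _ f0|f _ f0 [x fx]] /=; first exact: f0.
  by rewrite (_ : 0 = x)//; apply/matrixP => -[].
have rP := radon_prod (bmx p q) rE IH.
apply: (radon_transport (@continuous_col_pair p) (@continuous_submx_pair p)
  (@col_pairK p) _ rP) => z /=.
exact: vsubmxK.
Qed.

Lemma col_int_swap p (f : 'M[F]_(1 + p, q) -> R) : csupp f ->
  @col_int p.+1 f = col_int (fun y => IE (fun u => f (col_mx u y))).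
Proof.
move=> cf; exact: (radon_swap (bmx 1 q) (bmx p q) rE
  (radon_col p) (csupp_col cf)).
Qed.

Lemma csupp_translate m n (f : 'M[F]_(m, n) -> R) (z : 'M[F]_(m, n)) : csupp f ->
  csupp (fun y : 'M[F]_(m, n) => f (y + z)).
Proof.
apply: (@csupp_comp R 'M[F]_(m, n) 'M[F]_(m, n) (fun y : 'M[F]_(m, n) => y + z) (fun y : 'M[F]_(m, n) => y - z)) => y.
- apply: (@continuousDmx _ _ _ av 'M[F]_(m, n) m n id (fun=> z)).
  + exact: continuous_idf.
  + exact: continuous_cstf.
- apply: (@continuousDmx _ _ _ av 'M[F]_(m, n) m n id (fun=> - z)).
  + exact: continuous_idf.
  + exact: continuous_cstf.
- by rewrite addrK.
Qed.

Lemma csupp_mull m n (f : 'M[F]_(m, n) -> R) g : g \in unitmx -> csupp f ->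
  csupp (fun y => f (g *m y)).
Proof.
move=> ug; apply: (@csupp_comp R 'M[F]_(m, n) 'M[F]_(m, n) (fun y => g *m y) (fun y => invmx g *m y)) => y.
- apply: (@continuousMmx _ _ _ av 'M[F]_(m, n) m m n (fun=> g) id).
  + exact: continuous_cstf.
  + exact: continuous_idf.
- apply: (@continuousMmx _ _ _ av 'M[F]_(m, n) m m n (fun=> invmx g) id).
  + exact: continuous_cstf.
  + exact: continuous_idf.
- by rewrite mulKmx.
Qed.

Lemma csupp_mulr m n (f : 'M[F]_(m, n) -> R) g : g \in unitmx -> csupp f ->
  csupp (fun y => f (y *m g)).
Proof.
move=> ug; apply: (@csupp_comp R 'M[F]_(m, n) 'M[F]_(m, n) (fun y => y *m g) (fun y => y *m invmx g)) => y.
- apply: (@continuousMmx _ _ _ av 'M[F]_(m, n) m n n id (fun=> g)).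
  + exact: continuous_idf.
  + exact: continuous_cstf.
- apply: (@continuousMmx _ _ _ av 'M[F]_(m, n) m n n id (fun=> invmx g)).
  + exact: continuous_idf.
  + exact: continuous_cstf.
- by rewrite mulmxK.
Qed.

Lemma col_int_translate p (f : 'M[F]_(p, q) -> R) (z : 'M[F]_(p, q)) : csupp f ->
  col_int (fun y : 'M[F]_(p, q) => f (y + z)) = col_int f.
Proof.
elim: p f z => [|p IH] f z cf /=; first by congr f; apply/matrixP => -[].
pose g (u : 'M[F]_(1, q)) := col_int (fun y : 'M[F]_(p, q) => f (col_mx u y)).
have cg : csupp g.
  exact: (csupp_int2 (bmx p q) (radon_col p) (csupp_col cf)).
case: hE => _ /(_ g (usubmx (z : 'M[F]_(1 + p, q))) cg) <- _; congr IE.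
apply/funext => u; rewrite /g.
rewrite -[in RHS](IH _ (dsubmx (z : 'M[F]_(1 + p, q)))).
  congr col_int; apply/funext => y.
  by congr f; rewrite -add_col_mx vsubmxK.
exact: csupp_pairr (csupp_col cf).
Qed.

(** The change of variables formula for a single matrix. It is stable under products, so it can be
    verified on the factors of a triangular decomposition. *)
Definition scales p (g : 'M[F]_p) := forall f : 'M[F]_(p, q) -> R, csupp f ->
  col_int (fun y => f (g *m y)) = (nu (\det g) ^+ d)^-1 * col_int f.

Hypothesis nuM : forall x y, x != 0 -> y != 0 -> nu (x * y) = nu x * nu y.
Hypothesis nu1 : nu 1 = 1.

Lemma scalesM p (g h : 'M[F]_p) : g \in unitmx -> h \in unitmx ->
  scales g -> scales h -> scales (g *m h).
Proof.
move=> ug uh sg sh f cf.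
have -> : (fun y => f (g *m h *m y)) = (fun y => (fun y => f (g *m y)) (h *m y)).
  by apply/funext => y; rewrite mulmxA.
apply: etrans; first exact: (sh _ (csupp_mull ug cf)).
rewrite sg// det_mulmx nuM -?unitfE -?unitmxE// exprMn invfM mulrA.
by congr (_ * _); rewrite mulrC.
Qed.

(** This matrix adds a combination of the lower rows to the first one. With the first row integrated
    innermost it is a translation, hence the exchange of integrals. *)
Lemma scales_upper p (b : 'M[F]_(1, p)) : scales (block_mx 1%:M b 0 1%:M : 'M[F]_(1 + p)).
Proof.
move=> f cf; rewrite det_ublock !det1 mulr1 nu1 expr1n invr1 mul1r.
have ug : (block_mx 1%:M b 0 1%:M : 'M[F]_(1 + p)) \in unitmx.
  by rewrite unitmxE det_ublock !det1 mulr1 unitr1.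
rewrite (col_int_swap (csupp_mull ug cf)) (col_int_swap cf).
congr col_int; apply/funext => y.
have cfy : csupp (fun u => f (col_mx u y)) by exact: csupp_pairl (csupp_col cf).
case: hE => _ /(_ _ (b *m y) cfy) <- _; congr IE; apply/funext => u.
by rewrite mul_block_col !mul1mx mul0mx add0r.
Qed.

(** For a fixed first row [u], the lower rows are translated by a multiple of [u] and multiplied by
    [D]; the first row is then only scaled by [s]. *)
Lemma scales_lower p (s : F) (c : 'M[F]_(p, 1)) (D : 'M[F]_p) : s != 0 -> scales D ->
  D \in unitmx -> scales (block_mx s%:M 0 c D : 'M[F]_(1 + p)).
Proof.
move=> s0 sD uD f cf; rewrite det_lblock det_scalar1 nuM//; last by rewrite -unitfE -unitmxE.
rewrite exprMn invfM /=.
pose g (u : 'M[F]_(1, q)) := col_int (fun y : 'M[F]_(p, q) => f (col_mx u y)).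
have cg : csupp g.
  exact: (csupp_int2 (bmx p q) (radon_col p) (csupp_col cf)).
rewrite [LHS](_ : _ = IE (fun u => (nu (\det D) ^+ d)^-1 * g (s *: u))); last first.
  congr IE; apply/funext => u; rewrite /g.
  have cf1 : csupp (fun y => f (col_mx (s *: u) y)).
    exact: csupp_pairr (csupp_col cf).
  rewrite -sD//.
  rewrite -[in RHS](col_int_translate (invmx D *m (c *m u)) (csupp_mull uD cf1)).
  congr col_int; apply/funext => y; congr f.
  rewrite mul_block_col mul_scalar_mx mul0mx addr0.
  by rewrite mulmxDr mulKVmx// addrC.
case: hE => _ _ /(_ _ s cg s0) Eg.
have cgs : csupp (fun u : 'M[F]_(1, q) => g (s *: u)).
  rewrite (_ : (fun u => _) = (fun u => g (s%:M *m u))).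
    by apply: csupp_mull => //; rewrite unitmxE det_scalar1 unitfE.
  by apply/funext => u; rewrite mul_scalar_mx.
by rewrite (radonZ rE)// Eg mulrCA mulrA.
Qed.

(** Gaussian elimination by induction on the size: a nonzero corner entry permits a block triangular
    factorization, and a vanishing one is repaired by adding another row to the first. *)
Lemma scales_unit p (g : 'M[F]_p) : g \in unitmx -> scales g.
Proof.
elim: p g => [|p IH] g ug.
  move=> f cf; rewrite (_ : \det g = 1); last by rewrite -(det1 F 0); congr determinant; apply/matrixP => -[].
  by rewrite nu1 expr1n invr1 mul1r /=; congr f; apply/matrixP => -[].
have uU (b : 'M[F]_(1, p)) : (block_mx 1%:M b 0 1%:M : 'M[F]_(1 + p)) \in unitmx.
  by rewrite unitmxE det_ublock !det1 mulr1 unitr1.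
(* The case of a nonzero pivot [s]; [D'] is its Schur complement, of size [p], to which the
   induction hypothesis applies. *)
have main (h : 'M[F]_(1 + p)) : h \in unitmx -> ulsubmx h 0 0 != 0 -> scales h.
  move=> uh h0; rewrite -(submxK h).
  set A := ulsubmx h in h0 *; set B := ursubmx h; set C := dlsubmx h; set D := drsubmx h.
  pose s := A 0 0; pose D' := D - C *m (s^-1 *: B).
  have EA : A = s%:M by rewrite [LHS]mx11_scalar.
  have E : block_mx A B C D = block_mx s%:M 0 C D' *m block_mx 1%:M (s^-1 *: B) 0 1%:M.
    rewrite mulmx_block !mulmx1 ?mulmx0 ?mul0mx !addr0 EA mul_scalar_mx scalerA mulfV//.
    by rewrite scale1r /D' addrCA subrr addr0.
  have uD' : D' \in unitmx.
    move: uh; rewrite -(submxK h) -/A -/B -/C -/D E unitmx_mul => /andP[+ _].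
    by rewrite !unitmxE det_lblock unitrM => /andP[].
  rewrite E; apply: scalesM; [|exact: uU| |exact: scales_upper].
    by rewrite unitmxE det_lblock unitrM det_scalar1 unitfE h0 -unitmxE uD'.
  by apply: scales_lower => //; exact: IH.
have [A0|] := eqVneq (ulsubmx (g : 'M[F]_(1 + p)) 0 0) 0; last exact: main.
have [j Cj] : exists j, dlsubmx (g : 'M[F]_(1 + p)) j 0 != 0.
  apply: contrapT => nC.
  have : \det g = 0.
    pose e0 : 'I_(1 + p) := lshift p 0.
    rewrite -det_tr; apply/eqP/det0P; exists (delta_mx 0 e0 : 'M[F]_(1, 1 + p)).
      by apply/eqP => /matrixP/(_ 0 e0)/eqP; rewrite !mxE !eqxx oner_eq0.
    rewrite -rowE; apply/matrixP => i k; rewrite !mxE -[k](@splitK 1 p).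
    case: (fintype.split (k : 'I_(1 + p))) => l /=.
      by rewrite ord1; move: A0; rewrite !mxE.
    apply/eqP; apply: contrapT => /negP gl; apply: nC; exists l; move: gl.
    by rewrite !mxE.
  by move/eqP; apply/negP; rewrite -unitfE -unitmxE.
(* [U 1] adds row [j] of the lower part, whose first entry is nonzero, to the first row; [U (-1)]
   undoes it. *)
pose U (e : F) : 'M[F]_(1 + p) := block_mx 1%:M (e *: delta_mx 0 j) 0 1%:M.
have EU : g = U (-1) *m (U 1 *m g).
  rewrite mulmxA /U mulmx_block ?mul1mx ?mulmx1 ?mulmx0 ?mul0mx ?addr0 ?add0r.
  by rewrite -scalerDl subrr scale0r -(@scalar_mx_block _ 1 p) mul1mx.
rewrite EU; apply: scalesM; [exact: uU|by rewrite unitmx_mul uU|exact: scales_upper|].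
apply: main; first by rewrite unitmx_mul uU.
pose g' : 'M[F]_(1 + p) := g.
rewrite (_ : U 1 *m g = U 1 *m
  block_mx (ulsubmx g') (ursubmx g') (dlsubmx g') (drsubmx g')); last by rewrite submxK.
rewrite /U (@mulmx_block _ 1 p 1 p 1 p) block_mxKul mul1mx scale1r.
rewrite mxE {1}[ulsubmx _]mx11_scalar A0 -rowE !mxE add0r.
by move: Cj; rewrite !mxE.
Qed.

End Columns.
End Haar.

Section MatInt.
Variables (R : realType) (F : topFieldType) (a nu : F -> R).
Hypothesis av : absval a.
Variable IF : (F -> R) -> R.
Hypothesis hF : haar_fun nu IF.

Let rF : radon setT IF. Proof. by case: hF. Qed.

Lemma nu_gt0 c : c != 0 -> 0 < nu c.
Proof. by move=> c0; case: hF => _ _ /(_ (fun=> 0) c (csupp0 _ _) c0)[]. Qed.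

Let IF_mul f c : csupp f -> c != 0 -> IF (fun t => f (c * t)) = (nu c)^-1 * IF f.
Proof. by move=> cf c0; case: hF => _ _ /(_ f c cf c0)[]. Qed.

Lemma continuous_scalar1 : continuous (fun t : F => t%:M : 'M[F]_1).
Proof. by move=> t; apply: (@continuous_scalar F F 1 id t); exact: continuous_idf. Qed.

Lemma continuous_entry1 : continuous (fun y : 'M[F]_1 => y 0 0).
Proof. by move=> t; exact: entry_continuous. Qed.

Lemma scalar1K : cancel (fun t : F => t%:M : 'M[F]_1) (fun y : 'M[F]_1 => y 0 0).
Proof. by move=> t; rewrite mxE mulr1n. Qed.

Lemma csupp_scalar1 (f : 'M[F]_1 -> R) : csupp f -> csupp (fun t => f t%:M).
Proof. exact: (csupp_comp continuous_scalar1 continuous_entry1 scalar1K). Qed.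

Lemma has_bumps_field : has_bumps R F.
Proof.
move=> x A xA.
have : nbhs (x%:M : 'M[F]_1) [set y : 'M[F]_1 | A (y 0 0)].
  by apply: (continuous_entry1 (x := x%:M)); rewrite /= scalar1K.
move=> /(has_bumps_mx av)[g [cg g0 gx gA]]; exists (fun t => g t%:M); split=> //.
  exact: csupp_scalar1.
by move=> y nA; apply: gA; rewrite /= scalar1K.
Qed.

(** A test function of positive integral that depends on [t] only through [a t]. Comparing its
    dilates gives the multiplicativity and continuity of [nu], and the fact that [nu] depends only
    on the absolute value. *)
Definition tent (t : F) : R := Order.max 0 (1 - a t).

Lemma tent_ge0 t : 0 <= tent t. Proof. by rewrite le_max lexx. Qed.

Lemma csupp_tent : csupp tent.
Proof.
split=> [x _|].
  apply: (@continuous_max R F (fun=> 0) (fun t => 1 - a t)); first exact: continuous_cstf.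
  by apply: continuousB; [exact: continuous_cstf|exact: (av_continuous av)].
exists [set x | a x <= 1]; split=> //; first exact: (av_compact av).
by move=> x /negP; rewrite -ltNge => x1; rewrite /tent max_l// subr_le0 ltW.
Qed.

Lemma IF_tent_gt0 : 0 < IF tent.
Proof.
apply: (radon_gt0 (x := 0) rF csupp_tent tent_ge0).
by rewrite /tent (av0 av) subr0 lt_max ltr01 orbT.
Qed.

Let csupp_scale (f : F -> R) c : c != 0 -> csupp f -> csupp (fun t => f (c * t)).
Proof.
move=> c0; apply: (@csupp_comp _ _ _ (fun t => c * t) (fun t => c^-1 * t)) => y.
- by apply: (@continuousMF _ _ _ av F (fun=> c) id); [exact: continuous_cstf|exact: continuous_idf].
- by apply: (@continuousMF _ _ _ av F (fun=> c^-1) id); [exact: continuous_cstf|exact: continuous_idf].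
- by rewrite mulKf.
Qed.

(** Dilate [tent] by [x * y] at once or by the two factors in turn, and cancel its nonzero
    integral. *)
Lemma nuM x y : x != 0 -> y != 0 -> nu (x * y) = nu x * nu y.
Proof.
move=> x0 y0; apply: invr_inj; apply: (@mulIf _ (IF tent)).
  by rewrite gt_eqF// IF_tent_gt0.
rewrite -IF_mul ?mulf_neq0//; last exact: csupp_tent.
rewrite [LHS](_ : _ = IF (fun t => (fun t => tent (x * t)) (y * t))).
  rewrite (IF_mul (csupp_scale x0 csupp_tent) y0).
  rewrite IF_mul//; last exact: csupp_tent.
  by rewrite invfM mulrA [(nu y)^-1 * _]mulrC.
by congr IF; apply/funext => t; rewrite mulrA.
Qed.

Lemma nu1 : nu 1 = 1.
Proof.
have n1 : nu 1 != 0 by rewrite gt_eqF// nu_gt0// oner_eq0.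
by apply: (mulfI n1); rewrite -nuM ?oner_eq0// !mulr1.
Qed.

Lemma nuV x : x != 0 -> nu (x^-1) = (nu x)^-1.
Proof.
move=> x0; have n0 : nu x != 0 by rewrite gt_eqF// nu_gt0.
by apply: (mulfI n0); rewrite -nuM ?invr_eq0// !mulfV// nu1.
Qed.

(** By the scaling law, [nu t] is the quotient of the integral of [tent] by that of its dilate by
    [t]; the latter is an integral depending continuously on a parameter. *)
Lemma nu_continuous c : c != 0 -> {for c, continuous nu}.
Proof.
move=> c0; have Ac : 0 < a c by rewrite (av_gt0 av).
have near_c : \forall t \near c, a c / 2 < a t.
  have /cvgrPdist_lt/(_ (a c / 2)) := av_continuous av (x := c).
  rewrite divr_gt0// => /(_ isT); apply: filterS => t /(le_lt_trans (ler_norm _)).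
  by rewrite {1}[a c]splitr ltrBlDr ltrD2l.
have near_c0 : \forall t \near c, t != 0.
  apply: filterS near_c => t; apply: contraTneq => ->.
  by rewrite (av0 av) -leNgt divr_ge0// ltW.
apply: (@near_continuous _ _ nu (fun t => IF tent / IF (fun s => tent (t * s)))).
  apply: filterS near_c0 => t t0; rewrite IF_mul//; last exact: csupp_tent.
  by rewrite invfM invrK mulrCA mulfV ?mulr1// gt_eqF// IF_tent_gt0.
apply: continuousM; first exact: continuous_cstf.
apply: continuousV.
  rewrite IF_mul//; last exact: csupp_tent.
  by rewrite gt_eqF// mulr_gt0 ?invr_gt0 ?nu_gt0// IF_tent_gt0.
(* For [t] with [a t] above [a c / 2], the dilates of [tent] all vanish outside this one ball. *)
apply: (@radon_continuous _ _ _ (fun t s => tent (t * s)) c IF [set s | a s <= 2 / a c]).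
- exact: has_bumps_field.
- exact: rF.
- exact: (av_compact av).
- by apply: filterS near_c0 => t t0; exact/csupp_scale/csupp_tent.
- apply: filterS near_c => t tc s /negP; rewrite -ltNge => sc.
  rewrite /tent max_l// subr_le0 (avM av).
  have : 1 = a c / 2 * (2 / a c) by rewrite mulrA divfK// mulfV// gt_eqF.
  by move=> ->; rewrite ler_pM ?divr_ge0// ltW.
- move=> s _; apply: (@continuous_comp _ _ _ (fun p : F * F => p.1 * p.2) tent).
    by apply: (@continuousMF _ _ _ av (F * F)%type fst snd); [exact: cvg_fst|exact: cvg_snd].
  exact: csupp_tent.1.
Qed.

Lemma nuX_continuous (T : topologicalType) (f : T -> F) x n :
  {for x, continuous f} -> f x != 0 ->
  {for x, continuous (fun y => nu (f y) ^+ n)}.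
Proof.
move=> cf fx; apply: (@continuous_comp _ _ _ (fun y => nu (f y)) (fun r => r ^+ n)).
  by apply: (@continuous_comp _ _ _ f nu) => //; exact: nu_continuous.
exact: exprn_continuous.
Qed.

Definition row1_int (f : 'M[F]_(1, 1) -> R) : R := IF (fun t => f t%:M).

Lemma haar_row1 : haar_row nu 1 row1_int.
Proof.
split.
- apply: (radon_transport continuous_scalar1 continuous_entry1 scalar1K _ rF) => y.
  by rewrite -mx11_scalar.
- move=> f v cf; rewrite /row1_int; case: hF => _ /(_ _ (v 0 0) (csupp_scalar1 cf)) <- _.
  by congr IF; apply/funext => t; rewrite {1}[v]mx11_scalar -raddfD.
- move=> f c cf c0; rewrite /row1_int expr1 -IF_mul//; last exact: csupp_scalar1.
  by congr IF; apply/funext => t; rewrite scale_scalar_mx.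
Qed.

(** A row is integrated as the transpose of a stack of rows of length 1. Right multiplication of a
    row is thereby a left multiplication of a column, for which [scales_unit] is available. *)
Definition row_int q (f : 'M[F]_(1, q) -> R) : R :=
  @col_int R F 1 row1_int q (fun y => f y^T).

Lemma continuous_trmx p q : continuous (fun y : 'M[F]_(p, q) => y^T).
Proof. by move=> y; apply: (@continuous_tr F _ p q id); exact: continuous_idf. Qed.

Lemma csupp_tr p q (f : 'M[F]_(p, q) -> R) : csupp f -> csupp (fun y => f y^T).
Proof.
exact: (csupp_comp (@continuous_trmx q p) (@continuous_trmx p q) (@trmxK _ q p)).
Qed.

Lemma row_int_right q (f : 'M[F]_(1, q) -> R) g : csupp f -> g \in unitmx ->
  row_int (fun u => f (u *m g)) = (nu (\det g))^-1 * row_int f.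
Proof.
move=> cf ug; have ugT : g^T \in unitmx by rewrite unitmx_tr.
have := scales_unit av haar_row1 nuM nu1 ugT (csupp_tr cf).
rewrite det_tr expr1 => <-; congr col_int; apply/funext => y.
by rewrite trmx_mul trmxK.
Qed.

(** The scaling law is that of the scalar matrix [c%:M], of determinant [c ^+ q]. *)
Lemma haar_row_row_int q : haar_row nu q (@row_int q).
Proof.
split.
- apply: (radon_transport (@continuous_trmx q 1) (@continuous_trmx 1 q) (@trmxK _ q 1) (@trmxK _ 1 q)).
  exact: (radon_col av haar_row1).
- move=> f v cf; rewrite /row_int.
  rewrite -[RHS](col_int_translate av haar_row1 v^T (csupp_tr cf)).
  by congr col_int; apply/funext => y; rewrite [(y + _)^T]raddfD /= trmxK.
- move=> f c cf c0.
  have uc : (c%:M : 'M[F]_q) \in unitmx by rewrite unitmxE det_scalar unitfE expf_neq0.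
  rewrite (_ : nu c ^+ q = nu (\det (c%:M : 'M[F]_q))).
    rewrite -row_int_right//; congr row_int; apply/funext => u.
    by rewrite mul_mx_scalar.
  rewrite det_scalar; elim: q {f cf uc} => [|q IH]; first by rewrite !expr0 nu1.
  by rewrite !exprS IH nuM// expf_neq0.
Qed.

Definition mat_int p q : ('M[F]_(p, q) -> R) -> R := @col_int R F q (@row_int q) p.

Lemma radon_mat p q : radon setT (@mat_int p q).
Proof. exact: (radon_col av (haar_row_row_int q)). Qed.

Lemma mat_int_translate p q (f : 'M[F]_(p, q) -> R) (z : 'M[F]_(p, q)) :
  csupp f -> mat_int (fun y : 'M[F]_(p, q) => f (y + z)) = mat_int f.
Proof. exact: (col_int_translate av (haar_row_row_int q)). Qed.

Lemma mat_int_left p q (f : 'M[F]_(p, q) -> R) g : csupp f -> g \in unitmx ->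
  mat_int (fun y => f (g *m y)) = (nu (\det g) ^+ q)^-1 * mat_int f.
Proof. by move=> cf ug; rewrite -(scales_unit av (haar_row_row_int q) nuM nu1 ug cf). Qed.

(** Right multiplication acts on the [p] rows separately, each contributing one factor
    [(nu (\det g))^-1]. *)
Lemma mat_int_right p q (f : 'M[F]_(p, q) -> R) g : csupp f -> g \in unitmx ->
  mat_int (fun y => f (y *m g)) = (nu (\det g) ^+ p)^-1 * mat_int f.
Proof.
elim: p f => [|p IH] f cf ug.
  by rewrite expr0 invr1 mul1r /mat_int/=; congr f; apply/matrixP => -[].
pose h (u : 'M[F]_(1, q)) := mat_int (fun y : 'M[F]_(p, q) => f (col_mx u y)).
have ch : csupp h.
  exact: (csupp_int2 (@has_bumps_mx R F a av p q) (radon_mat p q) (csupp_col cf)).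
transitivity (row_int (fun u => (nu (\det g) ^+ p)^-1 * h (u *m g))).
  congr row_int; apply/funext => u; rewrite /h -IH//; last exact: csupp_pairr (csupp_col cf).
  congr col_int; apply/funext => y; congr f.
  exact: (@mul_col_mx _ 1 p q q u y g).
have rr : radon setT (@row_int q) by case: (haar_row_row_int q).
rewrite (radonZ rr); last exact: (csupp_mulr av ug ch).
by rewrite row_int_right// exprSr invfM mulrA.
Qed.

End MatInt.

(** * General linear groups and parabolic subgroups *)

Section OpenSupport.
Variable R : realType.

Lemma csupp_on_vanish (T : topologicalType) (U : set T) (f : T -> R) x :
  csupp_on U f -> ~ U x -> f x = 0.
Proof. by move=> [_ [K [_ KU Kf]]] nU; apply: Kf => /KU. Qed.

(** Meant for group translations and inversions. The last hypothesis covers the points outside [U1],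
    at which [h] has only a conventional value. *)
Lemma csupp_on_comp (T1 T2 : topologicalType) (U1 : set T1) (U2 : set T2)
    (h : T1 -> T2) (k : T2 -> T1) (f : T2 -> R) :
  (forall x, U1 x -> {for x, continuous h}) -> (forall x, U1 x -> U2 (h x)) ->
  (forall x, U2 x -> {for x, continuous k}) -> (forall x, U2 x -> U1 (k x)) ->
  (forall x, U1 x -> k (h x) = x) ->
  csupp_on U2 f -> (forall x, ~ U1 x -> f (h x) = 0) ->
  csupp_on U1 (fun x => f (h x)).
Proof.
move=> ch hU ck kU kh cf f0; have [cf1 [K [cK KU Kf]]] := cf.
split=> [x Ux|].
  by apply: (@continuous_comp _ _ _ h f); [exact: ch|exact/cf1/hU].
exists (k @` K); split.
- apply: continuous_compact => //; apply: continuous_in_subspaceT => x.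
  by rewrite inE => /KU; exact: ck.
- by move=> _ [x /KU + <-]; exact: kU.
- move=> x nK; have [Ux|/f0//] := pselect (U1 x).
  by apply: Kf => Khx; apply: nK; exists (h x) => //; exact: kh.
Qed.

Lemma csupp_on_tensor (T1 T2 : topologicalType) (U1 : set T1) (U2 : set T2)
    (g : T1 -> R) (h : T2 -> R) : csupp_on U1 g -> csupp_on U2 h ->
  csupp_on (U1 `*` U2) (fun z => g z.1 * h z.2).
Proof.
move=> [k1 [K1 [cK1 KU1 sK1]]] [k2 [K2 [cK2 KU2 sK2]]].
split=> [[y1 y2] [/= Uy1 Uy2]|].
  apply: (@continuousM _ _ (fun z => g z.1) (fun z => h z.2)).
    by apply: continuous_comp; [exact: cvg_fst|exact: k1].
  by apply: continuous_comp; [exact: cvg_snd|exact: k2].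
exists (K1 `*` K2); split=> //; first exact: compact_setX.
  by move=> [y1 y2] [/= /KU1 ? /KU2 ?].
by move=> [y1 y2] /not_andP[/= /sK1 ->|/= /sK2 ->]; rewrite ?mul0r ?mulr0.
Qed.

Lemma csupp_on_pairr (T1 T2 : topologicalType) (U1 : set T1) (U2 : set T2)
    (f : T1 * T2 -> R) x : csupp_on (U1 `*` U2) f ->
  csupp_on U2 (fun y => f (x, y)).
Proof.
move=> cf; have [cf1 [K [cK KU Kf]]] := cf.
have [Ux|nUx] := pselect (U1 x); last first.
  rewrite (_ : (fun y => _) = fun=> 0); first exact: csupp0.
  by apply/funext => y; apply: (csupp_on_vanish cf) => -[].
split=> [y Uy|].
  apply: (@continuous_comp _ _ _ (fun y => (x, y)) f).
    by apply: continuous_pair; [exact: continuous_cstf|exact: continuous_idf].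
  exact: cf1.
exists (snd @` K); split.
- apply: continuous_compact => //; apply: continuous_subspaceT => z.
  exact: cvg_snd.
- by move=> _ [z /KU[_ ?] <-].
- by move=> y nK; apply: Kf => Kxy; apply: nK; exists (x, y).
Qed.

Lemma csupp_on_pairl (T1 T2 : topologicalType) (U1 : set T1) (U2 : set T2)
    (f : T1 * T2 -> R) y : csupp_on (U1 `*` U2) f ->
  csupp_on U1 (fun x => f (x, y)).
Proof.
move=> cf; have [cf1 [K [cK KU Kf]]] := cf.
have [Uy|nUy] := pselect (U2 y); last first.
  rewrite (_ : (fun x => _) = fun=> 0); first exact: csupp0.
  by apply/funext => x; apply: (csupp_on_vanish cf) => -[].
split=> [x Ux|].
  apply: (@continuous_comp _ _ _ (fun x => (x, y)) f).
    by apply: continuous_pair; [exact: continuous_idf|exact: continuous_cstf].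
  exact: cf1.
exists (fst @` K); split.
- apply: continuous_compact => //; apply: continuous_subspaceT => z.
  exact: cvg_fst.
- by move=> _ [z /KU[? _] <-].
- by move=> x nK; apply: Kf => Kxy; apply: nK; exists (x, y).
Qed.

Lemma radon_weight_swap (T1 T2 : topologicalType) (U1 : set T1) (U2 : set T2)
    (I1 : (T1 -> R) -> R) (I2 : (T2 -> R) -> R) (w1 : T1 -> R) (w2 : T2 -> R)
    (f : T1 * T2 -> R) :
  has_bumps R T1 -> has_bumps R T2 -> hausdorff_space T1 -> hausdorff_space T2 ->
  radon setT I1 -> radon setT I2 ->
  (forall x, U1 x -> {for x, continuous w1}) ->
  (forall x, U2 x -> {for x, continuous w2}) ->
  csupp_on (U1 `*` U2) f ->
  I1 (fun x => I2 (fun y => f (x, y) * w2 y) * w1 x) =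
  I2 (fun y => I1 (fun x => f (x, y) * w1 x) * w2 y).
Proof.
move=> b1 b2 h1 h2 r1 r2 cw1 cw2 cf.
pose g z := f z * (w1 z.1 * w2 z.2).
have cg : csupp g.
  apply: csuppT; first exact: hausdorff_prod.
  apply: (csuppM cf) => -[x y] [/= Ux Uy].
  apply: (@continuousM _ _ (fun z => w1 z.1) (fun z => w2 z.2)).
    by apply: continuous_comp; [exact: cvg_fst|exact: cw1].
  by apply: continuous_comp; [exact: cvg_snd|exact: cw2].
transitivity (I1 (fun x => I2 (fun y => g (x, y)))).
  congr I1; apply/funext => x; rewrite mulrC -(radonZ r2).
    by congr I2; apply/funext => y; rewrite /g /=; ring.
  exact: csuppT h2 (csuppM (csupp_on_pairr x cf) cw2).
rewrite (radon_swap b1 b2 r1 r2 cg).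
congr I2; apply/funext => y; rewrite mulrC -(radonZ r1).
  by congr I1; apply/funext => x; rewrite /g /=; ring.
exact: csuppT h1 (csuppM (csupp_on_pairl y cf) cw1).
Qed.

End OpenSupport.

Section GLHaar.
Variables (R : realType) (F : topFieldType) (a nu : F -> R).
Hypothesis av : absval a.
Variable IF : (F -> R) -> R.
Hypothesis hF : haar_fun nu IF.

Let bmx p q : has_bumps R 'M[F]_(p, q) := @has_bumps_mx R F a av p q.
Let hmx p q : hausdorff_space 'M[F]_(p, q) := @hausdorff_mx R F a av p q.
Let rmx p q : radon setT (@mat_int R F IF p q) := @radon_mat R F a nu av IF hF p q.
Arguments bmx : clear implicits.
Arguments hmx : clear implicits.
Arguments rmx : clear implicits.

Lemma nu_det_neq0 n (g : 'M[F]_n) : g \in unitmx -> nu (\det g) != 0.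
Proof. by rewrite unitmxE unitfE => /(nu_gt0 hF); rewrite lt0r => /andP[]. Qed.

Lemma nu_det_gt0 n (g : 'M[F]_n) : g \in unitmx -> 0 < nu (\det g).
Proof. by rewrite unitmxE unitfE => /(nu_gt0 hF). Qed.

Lemma nu_detM n (g h : 'M[F]_n) : g \in unitmx -> h \in unitmx ->
  nu (\det (g *m h)) = nu (\det g) * nu (\det h).
Proof. by rewrite !unitmxE !unitfE => ug uh; rewrite det_mulmx (nuM av hF). Qed.

Lemma nu_detV n (g : 'M[F]_n) : g \in unitmx ->
  nu (\det (invmx g)) = (nu (\det g))^-1.
Proof. by move=> ug; rewrite det_inv (nuV av hF)// -unitfE -unitmxE. Qed.

Lemma nu_det_continuous (T : topologicalType) n (f : T -> 'M[F]_n) k x :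
  {for x, continuous f} -> f x \in unitmx ->
  {for x, continuous (fun y => nu (\det (f y)) ^+ k)}.
Proof.
move=> cf ux; apply: (nuX_continuous av hF (f := fun y => \det (f y))).
  exact: (continuous_det av cf).
by rewrite -unitfE -unitmxE.
Qed.

(** * The bi-invariant functional on GL(b) *)

Section GL.
Variable b : nat.

Definition GLset : set 'M[F]_b := [set y | y \in unitmx].
(** The density of multiplicative Haar measure. Left and right translation by [g] both have Jacobian
    [nu (\det g) ^+ b] on square matrices, so the same density serves for both. *)
Definition wL (y : 'M[F]_b) : R := (nu (\det y) ^+ b)^-1.
Definition IL (f : 'M[F]_b -> R) : R := @mat_int R F IF b b (fun y => f y * wL y).

Lemma wL_continuous y : GLset y -> {for y, continuous wL}.
Proof.
move=> uy; apply: continuousV; first by rewrite expf_neq0// nu_det_neq0.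
by apply: (nu_det_continuous (f := id)) => //; exact: continuous_idf.
Qed.

Lemma wL_gt0 y : GLset y -> 0 < wL y.
Proof. by move=> uy; rewrite invr_gt0 exprn_gt0// nu_det_gt0. Qed.

Lemma radon_IL : radon GLset IL.
Proof. exact: (radon_weight (hmx b b) (rmx b b) wL_continuous wL_gt0). Qed.

Let csupp_wL f : csupp_on GLset f -> csupp (fun y => f y * wL y).
Proof. by move=> cf; exact: csuppT (hmx b b) (csuppM cf wL_continuous). Qed.

Lemma IL_left f g : csupp_on GLset f -> GLset g -> IL (fun y => f (g *m y)) = IL f.
Proof.
move=> cf ug; have n0 := nu_det_neq0 ug.
rewrite /IL (_ : (fun y => _) =
    fun y => nu (\det g) ^+ b * (f (g *m y) * wL (g *m y))).
  rewrite (radonZ (rmx b b)); last exact: (csupp_mull av ug (csupp_wL cf)).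
  rewrite (mat_int_left av hF (csupp_wL cf) ug).
  by rewrite mulrA mulfV ?mul1r// expf_neq0.
apply/funext => y; have [uy|nuy] := pselect (GLset y).
  rewrite /wL nu_detM// exprMn invfM mulrCA; congr (_ * _).
  by rewrite mulVKf// expf_neq0.
by rewrite (csupp_on_vanish cf) ?mul0r ?mulr0// /GLset/= unitmx_mul => /andP[].
Qed.

Lemma IL_right f g : csupp_on GLset f -> GLset g -> IL (fun y => f (y *m g)) = IL f.
Proof.
move=> cf ug; have n0 := nu_det_neq0 ug.
rewrite /IL (_ : (fun y => _) =
    fun y => nu (\det g) ^+ b * (f (y *m g) * wL (y *m g))).
  rewrite (radonZ (rmx b b)); last exact: (csupp_mulr av ug (csupp_wL cf)).
  rewrite (mat_int_right av hF (csupp_wL cf) ug).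
  by rewrite mulrA mulfV ?mul1r// expf_neq0.
apply/funext => y; have [uy|nuy] := pselect (GLset y).
  rewrite /wL nu_detM// exprMn invfM mulrCA; congr (_ * _).
  by rewrite mulrCA mulfV ?mulr1// expf_neq0.
by rewrite (csupp_on_vanish cf) ?mul0r ?mulr0// /GLset/= unitmx_mul => /andP[].
Qed.

End GL.

(** * The block upper triangular subgroup and its right-invariant functional *)

Section Parabolic.
Variables m l : nat.
Let b := (m + l)%N.
Local Notation TQ := (('M[F]_m * 'M[F]_l) * 'M[F]_(m, l))%type.
Implicit Types (q s : TQ) (f : TQ -> R).

(** The subgroup is parametrized by its two diagonal blocks and its corner, as an open subset of a
    product of matrix spaces. The group law is transported to these coordinates by [mulQ], which
    turns its integral into iterated matrix integrals. *)
Definition qmx q : 'M[F]_(m + l) := block_mx q.1.1 q.2 0 q.1.2.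
Definition Qset : set TQ := [set q | q.1.1 \in unitmx /\ q.1.2 \in unitmx].
Definition mulQ q s : TQ :=
  ((q.1.1 *m s.1.1, q.1.2 *m s.1.2), q.1.1 *m s.2 + q.2 *m s.1.2).
Definition invQ q : TQ :=
  ((invmx q.1.1, invmx q.1.2), - (invmx q.1.1 *m q.2 *m invmx q.1.2)).
Definition oneQ : TQ := ((1%:M, 1%:M), 0).
Definition deltaQ q : R := nu (\det q.1.1) ^+ l / nu (\det q.1.2) ^+ m.
(** The inverse of the Jacobian of right translation found in [MQ_right], hence the density of a
    right Haar measure. *)
Definition wQ q : R := (nu (\det q.1.1) ^+ m * nu (\det q.1.2) ^+ b)^-1.
Definition MQ (f : TQ -> R) : R :=
  mat_int IF (fun x => mat_int IF (fun y => mat_int IF (fun z => f ((x, y), z)))).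
Definition IQ (f : TQ -> R) : R := MQ (fun q => f q * wQ q).

Lemma qmxE q : (qmx q \in unitmx) <-> Qset q.
Proof.
rewrite /qmx unitmxE det_ublock unitrM -!unitmxE.
by split=> [/andP|] [h1 h2]; [split|apply/andP].
Qed.

Lemma qmxM q s : qmx (mulQ q s) = qmx q *m qmx s.
Proof. by rewrite /qmx mulmx_block !mulmx0 !mul0mx !addr0 add0r. Qed.

Lemma mulQA q s t : mulQ q (mulQ s t) = mulQ (mulQ q s) t.
Proof. by rewrite /mulQ /= !mulmxDr !mulmxDl !mulmxA !addrA. Qed.

Lemma mulVQ q : Qset q -> mulQ (invQ q) q = oneQ.
Proof.
move=> [u1 u2]; rewrite /mulQ/= !mulVmx// mulNmx -!mulmxA mulVmx// mulmx1.
by rewrite subrr.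
Qed.

Lemma mulQV q : Qset q -> mulQ q (invQ q) = oneQ.
Proof.
move=> [u1 u2]; rewrite /mulQ/= !mulmxV// mulmxN !mulmxA mulmxV// mul1mx.
by rewrite addrC subrr.
Qed.

Lemma mul1Q q : mulQ oneQ q = q.
Proof. by case: q => [[A D] B]; rewrite /mulQ/= !mul1mx mul0mx addr0. Qed.

Lemma mulQ1 q : mulQ q oneQ = q.
Proof. by case: q => [[A D] B]; rewrite /mulQ/= !mulmx1 mulmx0 add0r. Qed.

Lemma Qset_mul q s : Qset (mulQ q s) <-> Qset q /\ Qset s.
Proof.
rewrite -!qmxE qmxM unitmx_mul; split=> [/andP//|h]; exact/andP.
Qed.

Lemma Qset_inv q : Qset (invQ q) <-> Qset q.
Proof. by rewrite /Qset/= !unitmx_inv. Qed.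

Lemma invQK q : Qset q -> invQ (invQ q) = q.
Proof.
move=> Qq; rewrite -[LHS]mulQ1 -(mulVQ Qq) mulQA mulVQ ?mul1Q//.
exact/Qset_inv.
Qed.

Lemma invQM q s : Qset q -> Qset s -> invQ (mulQ q s) = mulQ (invQ s) (invQ q).
Proof.
move=> Qq Qs; have Qqs : Qset (mulQ q s) by apply/Qset_mul.
have E : mulQ (mulQ (invQ s) (invQ q)) (mulQ q s) = oneQ.
  by rewrite mulQA -(mulQA (invQ s)) mulVQ// mulQ1 mulVQ.
by rewrite -[RHS]mulQ1 -(mulQV Qqs) mulQA E mul1Q.
Qed.

Lemma qmxV q : Qset q -> qmx (invQ q) = invmx (qmx q).
Proof.
move=> Qq; have uq : qmx q \in unitmx by apply/qmxE.
apply: (can_inj (mulmxK uq)); rewrite mulVmx// -qmxM mulVQ//.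
by rewrite /qmx/= -scalar_mx_block.
Qed.

Lemma deltaQM q s : Qset q -> Qset s -> deltaQ (mulQ q s) = deltaQ q * deltaQ s.
Proof.
by move=> [q1 q2] [s1 s2]; rewrite /deltaQ/= !nu_detM// !exprMn invfM mulrACA.
Qed.

Lemma deltaQ_gt0 q : Qset q -> 0 < deltaQ q.
Proof. by move=> [q1 q2]; rewrite divr_gt0// exprn_gt0// nu_det_gt0. Qed.

Lemma deltaQV q : Qset q -> deltaQ (invQ q) = (deltaQ q)^-1.
Proof. by move=> [q1 q2]; rewrite /deltaQ/= !nu_detV// !exprVn invfM invrK. Qed.

Let cA : continuous (fun q : TQ => q.1.1).
Proof. by move=> q; apply: (@continuous_comp _ _ _ fst fst); exact: cvg_fst. Qed.
Let cD : continuous (fun q : TQ => q.1.2).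
Proof.
by move=> q; apply: (@continuous_comp _ _ _ fst snd); [exact: cvg_fst|exact: cvg_snd].
Qed.
Let cB : continuous (fun q : TQ => q.2).
Proof. by move=> q; exact: cvg_snd. Qed.

Lemma qmx_continuous : continuous qmx.
Proof.
move=> q; apply: (@continuous_col_mx F TQ m l (m + l)
  (fun q => row_mx q.1.1 q.2) (fun q => row_mx 0 q.1.2)).
  by apply: (@continuous_row_mx F TQ m m l (fun q => q.1.1) snd); [exact: cA|exact: cB].
apply: (@continuous_row_mx F TQ l m l (fun=> 0) (fun q => q.1.2)).
  exact: continuous_cstf.
exact: cD.
Qed.

Lemma mulQ_continuous : continuous (fun z : TQ * TQ => mulQ z.1 z.2).
Proof.
have h1 (U : topologicalType) (f : TQ -> U) : continuous f ->
    continuous (fun z : TQ * TQ => f z.1).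
  by move=> cf z; apply: (@continuous_comp _ _ _ fst f); [exact: cvg_fst|exact: cf].
have h2 (U : topologicalType) (f : TQ -> U) : continuous f ->
    continuous (fun z : TQ * TQ => f z.2).
  by move=> cf z; apply: (@continuous_comp _ _ _ snd f); [exact: cvg_snd|exact: cf].
move=> z.
apply: (@continuous_pair (TQ * TQ)%type _ _
  (fun z => (z.1.1.1 *m z.2.1.1, z.1.1.2 *m z.2.1.2))
  (fun z => z.1.1.1 *m z.2.2 + z.1.2 *m z.2.1.2) z).
  apply: (@continuous_pair (TQ * TQ)%type _ _
    (fun z => z.1.1.1 *m z.2.1.1) (fun z => z.1.1.2 *m z.2.1.2) z).
- by apply: (continuousMmx av); [exact: (h1 _ _ cA)|exact: (h2 _ _ cA)].
- by apply: (continuousMmx av); [exact: (h1 _ _ cD)|exact: (h2 _ _ cD)].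
- apply: (continuousDmx av).
  + by apply: (continuousMmx av); [exact: (h1 _ _ cA)|exact: (h2 _ _ cB)].
  + by apply: (continuousMmx av); [exact: (h1 _ _ cB)|exact: (h2 _ _ cD)].
Qed.

Lemma invQ_continuous q : Qset q -> {for q, continuous invQ}.
Proof.
move=> [q1 q2].
have c1 : {for q, continuous (fun q : TQ => invmx q.1.1)}.
  by apply: (continuous_invmx av (f := fun q : TQ => q.1.1)) => //; exact: cA.
have c2 : {for q, continuous (fun q : TQ => invmx q.1.2)}.
  by apply: (continuous_invmx av (f := fun q : TQ => q.1.2)) => //; exact: cD.
apply: continuous_pair; first exact: continuous_pair.
apply: (continuousNmx av); apply: (continuousMmx av) => //.
by apply: (continuousMmx av) => //; exact: cB.
Qed.

Lemma deltaQ_continuous q : Qset q -> {for q, continuous deltaQ}.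
Proof.
move=> [q1 q2]; apply: continuousM.
  by apply: (nu_det_continuous (f := fun q : TQ => q.1.1)) => //; exact: cA.
apply: continuousV; first by rewrite expf_neq0// nu_det_neq0.
by apply: (nu_det_continuous (f := fun q : TQ => q.1.2)) => //; exact: cD.
Qed.

Lemma wQ_continuous q : Qset q -> {for q, continuous wQ}.
Proof.
move=> [q1 q2]; apply: continuousV.
  by rewrite mulf_neq0// expf_neq0// nu_det_neq0.
apply: continuousM.
  by apply: (nu_det_continuous (f := fun q : TQ => q.1.1)) => //; exact: cA.
by apply: (nu_det_continuous (f := fun q : TQ => q.1.2)) => //; exact: cD.
Qed.

Lemma wQ_gt0 q : Qset q -> 0 < wQ q.
Proof. by move=> [q1 q2]; rewrite invr_gt0 mulr_gt0// exprn_gt0// nu_det_gt0. Qed.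

Let bAD : has_bumps R ('M[F]_m * 'M[F]_l)%type := has_bumps_prod (bmx m m) (bmx l l).
Let rAD : radon setT (fun f : 'M[F]_m * 'M[F]_l -> R =>
  mat_int IF (fun x => mat_int IF (fun y => f (x, y)))) :=
  radon_prod (bmx l l) (rmx m m) (rmx l l).
Let bQ : has_bumps R TQ := has_bumps_prod bAD (bmx m l).
Let hQ : hausdorff_space TQ :=
  hausdorff_prod (hausdorff_prod (hmx m m) (hmx l l)) (hmx m l).

Lemma radon_MQ : radon setT MQ.
Proof. exact: (radon_prod (bmx m l) rAD (rmx m l)). Qed.

Lemma radon_IQ : radon Qset IQ.
Proof. exact: (radon_weight hQ radon_MQ wQ_continuous wQ_gt0). Qed.

(** Right translation sends the corner [B] to [A *m B0 + B *m D0]: a translation, and a right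
    multiplication worth [m] powers of [nu (\det D0)]. With the [l] powers from the lower diagonal
    block they make [b]. *)
Lemma MQ_right f q : csupp f -> Qset q ->
  MQ (fun s => f (mulQ s q)) =
  (nu (\det q.1.1) ^+ m * nu (\det q.1.2) ^+ b)^-1 * MQ f.
Proof.
case: q => [[A0 D0] B0] cf [/= uA uD].
pose g2 z := mat_int IF (fun B => f (z, B)).
have cg2 : csupp g2 by exact: (csupp_int2 (bmx m l) (rmx m l) cf).
pose g1 A := mat_int IF (fun D => g2 (A, D)).
have cg1 : csupp g1 by exact: (csupp_int2 (bmx l l) (rmx l l) cg2).
have h2 A D : mat_int IF (fun B => f ((A *m A0, D *m D0), A *m B0 + B *m D0)) =
    (nu (\det D0) ^+ m)^-1 * g2 (A *m A0, D *m D0).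
  have cB' : csupp (fun B => f ((A *m A0, D *m D0), B)) by exact: csupp_pairr cf.
  rewrite /g2 -(mat_int_translate av hF (A *m B0) cB').
  rewrite -(mat_int_right av hF (csupp_translate av (A *m B0) cB') uD).
  by congr mat_int; apply/funext => B; rewrite addrC.
rewrite /MQ /mulQ /=.
transitivity (mat_int IF (fun A : 'M[F]_m =>
    (nu (\det D0) ^+ b)^-1 * g1 (A *m A0))).
  congr mat_int; apply/funext => A; rewrite /g1.
  have cD' : csupp (fun D => g2 (A *m A0, D)) by exact: csupp_pairr cg2.
  have := mat_int_right av hF cD' uD.
  rewrite /b exprD invfM -mulrA => <-.
  rewrite -(radonZ (rmx l l)); last exact: (csupp_mulr av uD cD').
  by congr mat_int; apply/funext => D; rewrite h2.
rewrite (radonZ (rmx m m)); last exact: (csupp_mulr av uA cg1).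
rewrite (mat_int_right av hF cg1 uA) invfM mulrA; congr (_ * _).
by rewrite mulrC.
Qed.

(** Here the corner becomes [A0 *m B + B0 *m D], so its contribution is [l] powers of
    [nu (\det A0)]. The difference with the right Jacobian is the source of [deltaQ]. *)
Lemma MQ_left f q : csupp f -> Qset q ->
  MQ (fun s => f (mulQ q s)) =
  (nu (\det q.1.1) ^+ b * nu (\det q.1.2) ^+ l)^-1 * MQ f.
Proof.
case: q => [[A0 D0] B0] cf [/= uA uD].
pose g2 z := mat_int IF (fun B => f (z, B)).
have cg2 : csupp g2 by exact: (csupp_int2 (bmx m l) (rmx m l) cf).
pose g1 A := mat_int IF (fun D => g2 (A, D)).
have cg1 : csupp g1 by exact: (csupp_int2 (bmx l l) (rmx l l) cg2).
have h2 A D : mat_int IF (fun B => f ((A0 *m A, D0 *m D), A0 *m B + B0 *m D)) =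
    (nu (\det A0) ^+ l)^-1 * g2 (A0 *m A, D0 *m D).
  have cB' : csupp (fun B => f ((A0 *m A, D0 *m D), B)) by exact: csupp_pairr cf.
  rewrite /g2 -(mat_int_translate av hF (B0 *m D) cB').
  by rewrite -(mat_int_left av hF (csupp_translate av (B0 *m D) cB') uA).
rewrite /MQ /mulQ /=.
transitivity (mat_int IF (fun A : 'M[F]_m =>
    (nu (\det A0) ^+ l * nu (\det D0) ^+ l)^-1 * g1 (A0 *m A))).
  congr mat_int; apply/funext => A; rewrite /g1.
  have cD' : csupp (fun D => g2 (A0 *m A, D)) by exact: csupp_pairr cg2.
  have := mat_int_left av hF cD' uD.
  rewrite invfM -mulrA => <-.
  rewrite -(radonZ (rmx l l)); last exact: (csupp_mull av uD cD').
  by congr mat_int; apply/funext => D; rewrite h2.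
rewrite (radonZ (rmx m m)); last exact: (csupp_mull av uA cg1).
rewrite (mat_int_left av hF cg1 uA) mulrA; congr (_ * _).
by rewrite /b exprD -invfM; congr (_^-1); ring.
Qed.

Let csupp_wQ f : csupp_on Qset f -> csupp (fun q => f q * wQ q).
Proof. by move=> cf; exact: csuppT hQ (csuppM cf wQ_continuous). Qed.

Lemma csupp_mulQl f q : csupp_on Qset f -> Qset q ->
  csupp_on Qset (fun s => f (mulQ q s)).
Proof.
move=> cf Qq; apply: (csupp_on_comp (k := mulQ (invQ q)) (U2 := Qset)) => //.
- move=> s _; apply: (@continuous_comp _ _ _ (fun s => (q, s)) (fun z => mulQ z.1 z.2)).
    by apply: continuous_pair; [exact: continuous_cstf|exact: continuous_idf].
  exact: mulQ_continuous.
- by move=> s Qs; apply/Qset_mul.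
- move=> s _; apply: (@continuous_comp _ _ _ (fun s => (invQ q, s)) (fun z => mulQ z.1 z.2)).
    by apply: continuous_pair; [exact: continuous_cstf|exact: continuous_idf].
  exact: mulQ_continuous.
- by move=> s Qs; apply/Qset_mul; split=> //; exact/Qset_inv.
- by move=> s Qs; rewrite mulQA mulVQ// mul1Q.
- by move=> s nQ; apply: (csupp_on_vanish cf) => /Qset_mul[].
Qed.

Lemma csupp_mulQr f q : csupp_on Qset f -> Qset q ->
  csupp_on Qset (fun s => f (mulQ s q)).
Proof.
move=> cf Qq; apply: (csupp_on_comp (k := mulQ^~ (invQ q)) (U2 := Qset)) => //.
- move=> s _; apply: (@continuous_comp _ _ _ (fun s => (s, q)) (fun z => mulQ z.1 z.2)).
    by apply: continuous_pair; [exact: continuous_idf|exact: continuous_cstf].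
  exact: mulQ_continuous.
- by move=> s Qs; apply/Qset_mul.
- move=> s _; apply: (@continuous_comp _ _ _ (fun s => (s, invQ q)) (fun z => mulQ z.1 z.2)).
    by apply: continuous_pair; [exact: continuous_idf|exact: continuous_cstf].
  exact: mulQ_continuous.
- by move=> s Qs; apply/Qset_mul; split=> //; exact/Qset_inv.
- by move=> s Qs; rewrite -mulQA mulQV// mulQ1.
- by move=> s nQ; apply: (csupp_on_vanish cf) => /Qset_mul[].
Qed.

Lemma wQM q s : Qset q -> Qset s -> wQ (mulQ q s) = wQ q * wQ s.
Proof.
by move=> [q1 q2] [s1 s2]; rewrite /wQ/= !nu_detM// !exprMn -invfM mulrACA.
Qed.

Lemma IQ_right f q : csupp_on Qset f -> Qset q -> IQ (fun s => f (mulQ s q)) = IQ f.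
Proof.
move=> cf Qq; have w0 := wQ_gt0 Qq.
rewrite /IQ (_ : (fun s => _) =
    fun s => (wQ q)^-1 * (f (mulQ s q) * wQ (mulQ s q))).
  rewrite (radonZ radon_MQ); last first.
    exact: csuppT hQ (csupp_mulQr (csuppM cf wQ_continuous) Qq).
  by rewrite (MQ_right (csupp_wQ cf) Qq) -/(wQ q) mulKf// gt_eqF.
apply/funext => s; have [Qs|nQ] := pselect (Qset s).
  by rewrite wQM// mulrCA; congr (_ * _); rewrite mulrC mulfK// gt_eqF.
by rewrite (csupp_on_vanish cf) ?mul0r ?mulr0// => /Qset_mul[].
Qed.

(** The density compensates the right Jacobian; the quotient of the two Jacobians that remains is
    the modular function. *)
Lemma IQ_left f q : csupp_on Qset f -> Qset q ->
  IQ (fun s => f (mulQ q s)) = (deltaQ q)^-1 * IQ f.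
Proof.
move=> cf Qq; have w0 := wQ_gt0 Qq; have [q1 q2] := Qq.
rewrite /IQ (_ : (fun s => _) =
    fun s => (wQ q)^-1 * (f (mulQ q s) * wQ (mulQ q s))).
  rewrite (radonZ radon_MQ); last first.
    exact: csuppT hQ (csupp_mulQl (csuppM cf wQ_continuous) Qq).
  rewrite (MQ_left (csupp_wQ cf) Qq) mulrA; congr (_ * _).
  rewrite /wQ /deltaQ /b !exprD !invfM !invrK.
  by field; rewrite !expf_neq0 ?nu_det_neq0.
apply/funext => s; have [Qs|nQ] := pselect (Qset s).
  by rewrite wQM// mulrCA; congr (_ * _); rewrite mulKf// gt_eqF.
by rewrite (csupp_on_vanish cf) ?mul0r ?mulr0// => /Qset_mul[].
Qed.

End Parabolic.
End GLHaar.

(** * Minors and the action of a parabolic subgroup *)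

Section Minors.
Variable F : fieldType.

Lemma unit_minor p n (z : 'M[F]_(p, n)) : row_free z ->
  exists f : {ffun 'I_p -> 'I_n}, colsub f z \in unitmx.
Proof.
move=> fz; have fzT : row_full z^T by rewrite /row_full mxrank_tr.
exists (fullrankfun fzT); rewrite -unitmx_tr.
rewrite (_ : _^T = rowsub (fullrankfun fzT) z^T); first exact: fullrowsub_unit.
by apply/matrixP => i j; rewrite !mxE.
Qed.

Lemma dsubmx_free p1 p2 (y : 'M[F]_(p1 + p2)) : y \in unitmx -> row_free (dsubmx y).
Proof.
move=> uy; apply/row_freeP; exists (rsubmx (invmx y)).
rewrite mul_dsub_mx mulmx_rsub mulmxV//.
by apply/matrixP => i j; rewrite !mxE eq_rshift.
Qed.

Lemma colsub_unit_inj p n (z : 'M[F]_(p, n)) (f : 'I_p -> 'I_n) :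
  colsub f z \in unitmx -> injective f.
Proof.
move=> uD i j fij; apply: contrapT => /eqP ij.
move: uD; rewrite -unitmx_tr unitmxE unitfE.
rewrite (@determinant_alternate _ _ (colsub f z)^T i j ij) ?eqxx// => k.
by rewrite !mxE fij.
Qed.

(** The first [m] indices are sent, in order, to the complement of the image of [f]. *)
Lemma perm_of_injection m l (f : 'I_l -> 'I_(m + l)) : injective f ->
  exists s : 'S_(m + l), forall r, s (rshift m r) = f r.
Proof.
move=> fI; pose C := ~: [set f r | r in [set: 'I_l]]%SET.
have cC : #|C| = m.
  by rewrite cardsCs finset.setCK card_imset// cardsT !card_ord addnK.
pose h (x : 'I_(m + l)) : 'I_(m + l) := match fintype.split x with
  | inl u => @enum_val _ (mem C) (cast_ord (esym cC) u)
  | inr r => f r end.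
have hl u : h (lshift l u) = @enum_val _ (mem C) (cast_ord (esym cC) u).
  by rewrite /h (unsplitK (inl u : 'I_m + 'I_l)).
have hr r : h (rshift m r) = f r.
  by rewrite /h (unsplitK (inr r : 'I_m + 'I_l)).
have hC u : h (lshift l u) \in C by rewrite hl enum_valP.
have hI : injective h.
  move=> x y; rewrite -(splitK x) -(splitK y).
  case: (fintype.split x) => u; case: (fintype.split y) => v /=.
  - by rewrite !hl => /enum_val_inj /cast_ord_inj ->.
  - rewrite [h (rshift _ _)]hr => E; have := hC u; rewrite E /C !inE.
    by rewrite imset_f.
  - rewrite [h (rshift _ _)]hr => E; have := hC v; rewrite -E /C !inE.
    by rewrite imset_f.
  - by rewrite !hr => /fI ->.
by exists (perm hI) => r; rewrite permE hr.
Qed.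

Lemma det_replace_col n (E : 'M[F]_n) (r : 'I_n) :
  (forall i j, j != r -> E i j = (i == j)%:R) -> \det E = E r r.
Proof.
move=> hE; rewrite (expand_det_row E r) (bigD1 r)//= big1 ?addr0.
  rewrite /cofactor addnn -signr_odd odd_double expr0 mul1r.
  rewrite (_ : row' r (col' r E) = 1%:M) ?det1 ?mulr1//.
  apply/matrixP => i j; rewrite !mxE hE; last by rewrite eq_sym neq_lift.
  by rewrite (inj_eq lift_inj).
by move=> j jr; rewrite hE// eq_sym (negbTE jr) mul0r.
Qed.

(** Cramer's rule. After multiplication by the inverse of the chosen minor, the columns selected by
    [f] form the identity; replacing its column [r] by column [c] gives a matrix whose determinant
    is the desired entry. *)
Lemma cramer_minor p n (z : 'M[F]_(p, n)) (f : 'I_p -> 'I_n) r c :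
  colsub f z \in unitmx -> (invmx (colsub f z) *m z) r c =
  \det (colsub (fun i => if i == r then c else f i) z) / \det (colsub f z).
Proof.
set D := colsub f z => uD.
pose g i := if i == r then c else f i.
have E1 : colsub g z = D *m colsub g (invmx D *m z).
  by rewrite mulmx_colsub mulKVmx.
rewrite -/g E1 det_mulmx [X in X / _]mulrC mulfK; last by rewrite -unitfE -unitmxE.
rewrite (@det_replace_col _ _ r); first by rewrite [RHS]mxE /g eqxx.
move=> i j jr; rewrite mxE /g (negbTE jr).
have : colsub f (invmx D *m z) = 1%:M by rewrite -mulmx_colsub mulVmx.
by move=> /matrixP/(_ i j); rewrite !mxE.
Qed.

End Minors.

Section Cover.
Variables (R : realType) (F : topFieldType) (a : F -> R).
Hypothesis av : absval a.
Variables m l : nat.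

(* Pivoting on a maximal minor of the lower rows: by Cramer's rule, the entries
   of the reduced matrix have absolute value at most 1. *)
Lemma parabolic_cover (y : 'M[F]_(m + l)) : y \in unitmx ->
  exists q, [/\ @Qset F m l q, forall i j, a ((qmx q *m y) i j) <= 1
    & a (\det (qmx q *m y)) = 1].
Proof.
move=> uy; set z := dsubmx y.
have [f0 uf0] := unit_minor (dsubmx_free uy).
(* The columns chosen give the maximal minor of largest absolute value in the lower rows, so that
   every quotient in Cramer's rule is at most 1. *)
case: (@arg_maxP _ R _ f0 xpredT (fun f : {ffun 'I_l -> 'I_(m + l)} =>
  a (\det (colsub f z))) isT) => f _ fmax.
have det0 : \det (colsub f z) != 0.
  rewrite -(av_gt0 av) (lt_le_trans _ (fmax f0 isT))// (av_gt0 av).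
  by rewrite -unitfE -unitmxE.
have uD : colsub f z \in unitmx by rewrite unitmxE unitfE.
set D := colsub f z in uD det0.
have [s sf] := perm_of_injection (colsub_unit_inj uD).
pose z' := invmx D *m z.
have z'1 r c : a (z' r c) <= 1.
  rewrite /z' cramer_minor// (avM av) (avV av) ler_pdivrMr ?(av_gt0 av)// mul1r.
  have := fmax [ffun i => if i == r then c else f i] isT.
  congr (a (\det _) <= _); apply/matrixP => i j.
  by rewrite !mxE ffunE.
(* Upper rows completing [z'] to a square matrix: unit vectors at the columns not selected by [f].
   After the permutation [s] of the columns, [y'] is lower unitriangular, hence of determinant 1 up
   to sign. *)
pose t : 'M[F]_(m, m + l) := \matrix_(r, c) (c == s (lshift l r))%:R.
pose y' := col_mx t z'.
have Ey' : colsub s y' = block_mx 1%:M 0 (colsub (s \o lshift l) z') 1%:M.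
  apply/matrixP => i j; rewrite mxE.
  rewrite -(splitK i) -(splitK j); case: (fintype.split i) => i'; case: (fintype.split j) => j' /=.
  - by rewrite col_mxEu block_mxEul !mxE (inj_eq perm_inj) eq_lshift eq_sym.
  - by rewrite col_mxEu block_mxEur !mxE (inj_eq perm_inj) eq_rlshift.
  - by rewrite col_mxEd block_mxEdl !mxE.
  - rewrite col_mxEd block_mxEdr sf.
    have : colsub f z' = 1%:M by rewrite /z' -mulmx_colsub mulVmx.
    by move=> /matrixP/(_ i' j'); rewrite mxE.
have dy' : a (\det y') = 1.
  have : a (\det (colsub s y')) = 1 by rewrite Ey' det_lblock !det1 mulr1 (av1 av).
  rewrite -col_permEsub col_permE det_mulmx (avM av) det_perm.
  rewrite (avX av) (avN av) (av1 av) expr1n mulr1//.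
have uy' : y' \in unitmx by rewrite unitmxE unitfE -(av_gt0 av) dy'.
(* The lower rows of [y'] are combinations of the lower rows of [y] alone, so the lower left block
   of this quotient vanishes and it belongs to the parabolic subgroup. *)
pose w := y' *m invmx y.
have wdl : dlsubmx w = 0.
  rewrite /dlsubmx -[w]/(col_mx t z' *m invmx y) mul_col_mx col_mxKd /z' -mulmxA /z.
  rewrite mul_dsub_mx mulmxV// -mulmx_lsub [lsubmx _](_ : _ = 0) ?mulmx0//.
  by apply/matrixP => i j; rewrite !mxE eq_rlshift.
pose q : ('M[F]_m * 'M[F]_l) * 'M[F]_(m, l) := ((ulsubmx w, drsubmx w), ursubmx w).
have Eq : qmx q = w by rewrite /qmx/= -wdl submxK.
have Eqy : qmx q *m y = y' by rewrite Eq /w mulmxKV.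
exists q; rewrite Eqy; split=> //.
  by apply/qmxE; rewrite Eq /w unitmx_mul uy' unitmx_inv.
move=> i j; rewrite mxE; case: (fintype.split i) => k; last exact: z'1.
by rewrite mxE; case: eqP => _; rewrite ?(av1 av)// (av0 av) ler01.
Qed.

End Cover.

(** * Weil integration on GL(m + l) *)

Section Weil.
Variables (R : realType) (F : topFieldType) (a nu : F -> R).
Hypothesis av : absval a.
Variable IF : (F -> R) -> R.
Hypothesis hF : haar_fun nu IF.
Variables m l : nat.
Local Notation b := (m + l)%N.
Local Notation TQ := (('M[F]_m * 'M[F]_l) * 'M[F]_(m, l))%type.
Local Notation IQ := (@IQ R F nu IF m l).
Local Notation IL := (@IL R F nu IF (m + l)).
Local Notation Qs := (@Qset F m l).
Local Notation GL := (@GLset F (m + l)).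
Local Notation deltaQ := (@deltaQ R F nu m l).

Let bmx p q : has_bumps R 'M[F]_(p, q) := @has_bumps_mx R F a av p q.
Let hmx p q : hausdorff_space 'M[F]_(p, q) := @hausdorff_mx R F a av p q.
Arguments bmx : clear implicits.
Arguments hmx : clear implicits.
Let bQ : has_bumps R TQ := has_bumps_prod (has_bumps_prod (bmx m m) (bmx l l)) (bmx m l).
Let hQ : hausdorff_space TQ :=
  hausdorff_prod (hausdorff_prod (hmx m m) (hmx l l)) (hmx m l).
Let rIQ : radon Qs IQ := @radon_IQ R F a nu av IF hF m l.
Let rIL : radon GL IL := @radon_IL R F a nu av IF hF (m + l).

Lemma IQ_IL_swap (f : TQ * 'M[F]_(m + l) -> R) : csupp_on (Qs `*` GL) f ->
  IQ (fun q => IL (fun y => f (q, y))) = IL (fun y => IQ (fun q => f (q, y))).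
Proof.
exact: (radon_weight_swap bQ (bmx _ _) hQ (hmx _ _) (radon_MQ av hF m l)
  (@radon_mat R F a nu av IF hF _ _) (wQ_continuous av hF (l:=l))
  (wL_continuous av hF (b:=m+l))).
Qed.

Lemma IQ_IQ_swap (f : TQ * TQ -> R) : csupp_on (Qs `*` Qs) f ->
  IQ (fun q => IQ (fun s => f (q, s))) = IQ (fun s => IQ (fun q => f (q, s))).
Proof.
exact: (radon_weight_swap bQ bQ hQ hQ (radon_MQ av hF m l) (radon_MQ av hF m l)
  (wQ_continuous av hF (l:=l)) (wQ_continuous av hF (l:=l))).
Qed.

Let mulQ_cont (T : topologicalType) (f g : T -> TQ) x :
  {for x, continuous f} -> {for x, continuous g} ->
  {for x, continuous (fun y => mulQ (f y) (g y))}.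
Proof.
move=> cf cg; apply: (@continuous_comp _ _ _ (fun y => (f y, g y)) (fun z => mulQ z.1 z.2)).
  exact: continuous_pair.
exact: (mulQ_continuous av).
Qed.

Let invQ_cont (T : topologicalType) (f : T -> TQ) x :
  {for x, continuous f} -> Qs (f x) -> {for x, continuous (fun y => invQ (f y))}.
Proof.
move=> cf Qx; apply: (@continuous_comp _ _ _ f (@invQ F m l)) => //.
exact: (invQ_continuous av).
Qed.

Lemma csupp_invQ (f : TQ -> R) : csupp_on Qs f -> csupp_on Qs (fun q => f (invQ q)).
Proof.
move=> cf; apply: (csupp_on_comp (k := @invQ F m l) (U2 := Qs)) => //.
- by move=> q Qq; exact: (invQ_continuous av).
- by move=> q Qq; exact/Qset_inv.
- by move=> q Qq; exact: (invQ_continuous av).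
- by move=> q Qq; exact/Qset_inv.
- exact: invQK.
- by move=> q nQ; apply: (csupp_on_vanish cf) => /Qset_inv.
Qed.

Let csupp_delta (f : TQ -> R) : csupp_on Qs f -> csupp_on Qs (fun q => f q * (deltaQ q)^-1).
Proof.
move=> cf; apply: (csuppM cf) => q Qq; apply: continuousV.
  by rewrite gt_eqF// (deltaQ_gt0 hF).
exact: (deltaQ_continuous av hF).
Qed.

(* Compute the double integral of eta(s q) psi(q^-1) / deltaQ(q) in two ways: by
   right invariance in s, and, after exchanging the integrals, by the two left
   translations that bring s q to q and q^-1 s to s. *)
Lemma IQ_inv (psi eta : TQ -> R) : csupp_on Qs psi -> csupp_on Qs eta -> IQ eta != 0 ->
  IQ (fun q => psi (invQ q) * (deltaQ q)^-1) = IQ psi.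
Proof.
move=> cp ce e0; apply: (mulIf e0).
pose f q := psi (invQ q) * (deltaQ q)^-1.
have cf : csupp_on Qs f by apply: csupp_delta; exact: csupp_invQ.
pose F3 (z : TQ * TQ) := eta (mulQ z.1 z.2) * f z.2.
have cF3 : csupp_on (Qs `*` Qs) F3.
  apply: (csupp_on_comp (U2 := Qs `*` Qs) (h := fun z => (mulQ z.1 z.2, z.2))
    (k := fun z => (mulQ z.1 (invQ z.2), z.2)) (f := fun z => eta z.1 * f z.2)).
  - move=> z _; apply: continuous_pair; last exact: cvg_snd.
    by apply: mulQ_cont; [exact: cvg_fst|exact: cvg_snd].
  - by move=> z [/= z1 z2]; split=> //=; exact/Qset_mul.
  - move=> z [/= z1 z2]; apply: continuous_pair; last exact: cvg_snd.
    by apply: mulQ_cont; [exact: cvg_fst|apply: invQ_cont => //; exact: cvg_snd].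
  - by move=> z [/= z1 z2]; split=> //=; apply/Qset_mul; split=> //; exact/Qset_inv.
  - by move=> [s q] [/= z1 z2]; rewrite -mulQA mulQV// mulQ1.
  - exact: csupp_on_tensor.
  - move=> [s q] /= nQ; have [Qq|nQq] := pselect (Qs q); last first.
      by rewrite (csupp_on_vanish cf) ?mulr0.
    by rewrite (csupp_on_vanish ce) ?mul0r// => /Qset_mul[? ?]; apply: nQ.
(* For a fixed first variable [s], this is [F3] after left translation of the second variable by
   [invQ s]: the factor from [IQ_left] cancels the one produced by [deltaQ] in the integrand. *)
pose F5 (z : TQ * TQ) := psi (mulQ (invQ z.2) z.1) * (eta z.2 * (deltaQ z.2)^-1).
have cF5 : csupp_on (Qs `*` Qs) F5.
  apply: (csupp_on_comp (U2 := Qs `*` Qs) (h := fun z => (mulQ (invQ z.2) z.1, z.2))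
    (k := fun z => (mulQ z.2 z.1, z.2)) (f := fun z => psi z.1 * (eta z.2 * (deltaQ z.2)^-1))).
  - move=> z [/= z1 z2]; apply: continuous_pair; last exact: cvg_snd.
    by apply: mulQ_cont; [apply: invQ_cont => //; exact: cvg_snd|exact: cvg_fst].
  - by move=> z [/= z1 z2]; split=> //=; apply/Qset_mul; split=> //; exact/Qset_inv.
  - move=> z _; apply: continuous_pair; last exact: cvg_snd.
    by apply: mulQ_cont; [exact: cvg_snd|exact: cvg_fst].
  - by move=> z [/= z1 z2]; split=> //=; exact/Qset_mul.
  - by move=> [s q] [/= z1 z2]; rewrite mulQA mulQV// mul1Q.
  - exact: (csupp_on_tensor cp (csupp_delta ce)).
  - move=> [s q] /= nQ; have [Qq|nQq] := pselect (Qs q); last first.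
      by rewrite (csupp_on_vanish ce) ?mul0r ?mulr0.
    by rewrite (csupp_on_vanish cp) ?mul0r// => /Qset_mul[? ?]; apply: nQ.
rewrite -/f.
transitivity (IQ (fun q => IQ (fun s => F3 (s, q)))).
  rewrite mulrC -(radonZ rIQ)//; congr IQ; apply/funext => q.
  have [Qq|nQq] := pselect (Qs q); last first.
    rewrite (csupp_on_vanish cf)// mulr0 -[LHS](radon0 rIQ); congr IQ.
    by apply/funext => s; rewrite /F3 /= (csupp_on_vanish cf) ?mulr0.
  rewrite -(IQ_right av hF ce Qq) mulrC -(radonZ rIQ); last exact: (csupp_mulQr av ce Qq).
  by congr IQ; apply/funext => s; rewrite mulrC.
rewrite -IQ_IQ_swap//.
transitivity (IQ (fun s => IQ (fun q => F5 (s, q)))).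
  congr IQ; apply/funext => s.
  have [Qsn|nQs] := pselect (Qs s); last first.
    by congr IQ; apply/funext => q; rewrite (csupp_on_vanish cF3) ?(csupp_on_vanish cF5)// => -[].
  have Qs' : Qs (invQ s) by exact/Qset_inv.
  have d0 := deltaQ_gt0 hF Qsn.
  have := IQ_left av hF (csupp_on_pairr s cF3) Qs'.
  rewrite (deltaQV av hF Qsn) invrK => E.
  apply: (@mulfI _ (deltaQ s)); first by rewrite gt_eqF.
  rewrite -E -(radonZ rIQ); last exact: (csupp_on_pairr s cF5).
  congr IQ; apply/funext => q; rewrite /F3 /F5 /f /=.
  rewrite mulQA mulQV// mul1Q.
  have [Qq|nQq] := pselect (Qs q); last first.
    by rewrite (csupp_on_vanish ce) ?mul0r ?mulr0.
  rewrite invQM// invQK// (deltaQM av hF)// (deltaQV av hF)// invfM invrK.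
  by field; rewrite gt_eqF// (deltaQ_gt0 hF).
rewrite IQ_IQ_swap// -[RHS](radonZ rIQ)//; congr IQ; apply/funext => q.
have [Qq|nQq] := pselect (Qs q); last first.
  rewrite (csupp_on_vanish ce)// mulr0 -[RHS](radon0 rIQ); congr IQ.
  by apply/funext => s; rewrite /F5 /= (csupp_on_vanish ce) ?mul0r ?mulr0.
have Qq' : Qs (invQ q) by exact/Qset_inv.
have d0 := deltaQ_gt0 hF Qq.
have cps := csupp_mulQl av cp Qq'.
transitivity (eta q * (deltaQ q)^-1 * IQ (fun s => psi (mulQ (invQ q) s))).
  by rewrite -(radonZ rIQ)//; congr IQ; apply/funext => s; rewrite /F5 /= mulrC.
rewrite (IQ_left av hF cp Qq') (deltaQV av hF Qq) invrK.
by rewrite -mulrA mulKf ?gt_eqF// mulrC.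
Qed.

(** The coordinates of the subgroup are read off the blocks of the matrix by a continuous map, so
    the preimage is a closed subset of a compact set. *)
Lemma compact_qmx_preimage (C : set 'M[F]_(m + l)) : compact C -> C `<=` GL ->
  compact [set q : TQ | C (qmx q)] /\ [set q : TQ | C (qmx q)] `<=` Qs.
Proof.
move=> cC CG; split; last by move=> q /CG uq; exact/qmxE.
pose parts (z : 'M[F]_(m + l)) : TQ := ((ulsubmx z, drsubmx z), ursubmx z).
apply: (@subclosed_compact _ _ (parts @` C)).
- apply: preimage_closed => [q _|]; first exact: qmx_continuous.
  exact: compact_closed (hmx _ _) cC.
- apply: continuous_compact => //; apply: continuous_subspaceT => z.
  apply: continuous_pair; first apply: continuous_pair.
  + by apply: continuous_mx => i j; apply: eq_continuous => [y|]; [by rewrite !mxE|exact: entry_continuous].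
  + by apply: continuous_mx => i j; apply: eq_continuous => [y|]; [by rewrite !mxE|exact: entry_continuous].
  + by apply: continuous_mx => i j; apply: eq_continuous => [y|]; [by rewrite !mxE|exact: entry_continuous].
- move=> [[A D] B] Cq; exists (qmx ((A, D), B)) => //.
  by rewrite /parts /qmx/= block_mxKul block_mxKdr block_mxKur.
Qed.

(** Properness of the action: if [y] lies in [K'] and [qmx q *m y] in [K], then [qmx q] lies in this
    compact set of quotients. It bounds the supports in [csupp_act] and [csupp_orbit]. *)
Lemma compact_div (K K' : set 'M[F]_(m + l)) : compact K -> compact K' ->
  K `<=` GL -> K' `<=` GL ->
  let C := (fun z => z.1 *m invmx z.2) @` (K `*` K') in compact C /\ C `<=` GL.
Proof.
move=> cK cK' KG KG' C; split.
  apply: continuous_compact; last exact: compact_setX.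
  apply: continuous_in_subspaceT => z; rewrite inE => -[/= _ /KG' u2].
  apply: (continuousMmx av); first exact: cvg_fst.
  by apply: (continuous_invmx av) => //; exact: cvg_snd.
move=> _ [[x y] [/= /KG ux /KG' uy] <-].
by rewrite /GLset /= unitmx_mul unitmx_inv; apply/andP.
Qed.

Let act_cont (T : topologicalType) (f : T -> TQ) (g : T -> 'M[F]_(m + l)) x :
  {for x, continuous f} -> {for x, continuous g} ->
  {for x, continuous (fun y => qmx (f y) *m g y)}.
Proof.
move=> cf cg; apply: (continuousMmx av) => //.
by apply: (@continuous_comp _ _ _ f (@qmx F m l)) => //; exact: qmx_continuous.
Qed.

Let act_GL q y : Qs q -> GL y -> GL (qmx q *m y).
Proof. by move=> /qmxE uq uy; rewrite /GLset/= unitmx_mul uq. Qed.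

Lemma csupp_act (f g : 'M[F]_(m + l) -> R) : csupp_on GL f -> csupp_on GL g ->
  csupp_on (Qs `*` GL) (fun z : TQ * 'M[F]_(m + l) => f z.2 * g (qmx z.1 *m z.2)).
Proof.
move=> [cf [K [cK KG Kf]]] [cg [K' [cK' KG' Kg]]]; split=> [[q y] [/= Qq uy]|].
  apply: continuousM.
    by apply: (@continuous_comp _ _ _ snd f); [exact: cvg_snd|exact: cf].
  apply: (@continuous_comp _ _ _ (fun z => qmx z.1 *m z.2) g).
    by apply: act_cont; [exact: cvg_fst|exact: cvg_snd].
  by apply: cg; exact: act_GL.
have [cC CG] := compact_div cK' cK KG' KG.
have [cP PQ] := compact_qmx_preimage cC CG.
exists ([set q | ((fun z => z.1 *m invmx z.2) @` (K' `*` K)) (qmx q)] `*` K); split.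
- exact: compact_setX.
- by move=> [q y] [/= /PQ ? /KG].
- move=> [q y] nK /=; have [Ky|/Kf ->] := pselect (K y); last by rewrite mul0r.
  rewrite Kg ?mulr0// => Kz; apply: nK; split=> //=.
  by exists (qmx q *m y, y) => //=; rewrite mulmxK//; exact: KG.
Qed.

Lemma csupp_orbit (g : 'M[F]_(m + l) -> R) y : csupp_on GL g -> GL y ->
  csupp_on Qs (fun q => g (qmx q *m y)).
Proof.
move=> [cg [K [cK KG Kg]]] uy; split=> [q Qq|].
  apply: (@continuous_comp _ _ _ (fun q => qmx q *m y) g).
    by apply: act_cont; [exact: continuous_idf|exact: continuous_cstf].
  by apply: cg; exact: act_GL.
have cy : compact [set y] by exact: compact_set1.
have [|cC CG] := compact_div cK cy KG; first by move=> _ ->.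
have [cP PQ] := compact_qmx_preimage cC CG.
exists [set q | ((fun z => z.1 *m invmx z.2) @` (K `*` [set y])) (qmx q)].
split=> // q nK; apply: Kg => Kz; apply: nK.
by exists (qmx q *m y, y) => //=; rewrite mulmxK.
Qed.

(* The functional phi |-> IL (phi chi) only depends on chi through its integrals
   over the orbits of the parabolic subgroup; translating chi does not change
   them, whence the invariance in [invariant_density]. *)
Lemma weil_uniqueness (phi chi chi' : 'M[F]_(m + l) -> R) (eta : TQ -> R) :
  (forall y, GL y -> {for y, continuous phi}) ->
  (forall q y, Qs q -> GL y -> phi (qmx q *m y) = deltaQ q * phi y) ->
  csupp_on GL chi -> csupp_on GL chi' ->
  (forall y, GL y -> IQ (fun q => chi (qmx q *m y)) = 1) ->
  (forall y, GL y -> IQ (fun q => chi' (qmx q *m y)) = 1) ->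
  csupp_on Qs eta -> IQ eta != 0 ->
  IL (fun y => phi y * chi y) = IL (fun y => phi y * chi' y).
Proof.
move=> cphi phiQ cchi cchi' chi1 chi'1 ce e0.
have cpc : csupp_on GL (fun y => phi y * chi y).
  rewrite (_ : (fun y => _) = fun y => chi y * phi y); first exact: csuppM.
  by apply/funext => y; rewrite mulrC.
have cpc' : csupp_on GL (fun y => phi y * chi' y).
  rewrite (_ : (fun y => _) = fun y => chi' y * phi y); first exact: csuppM.
  by apply/funext => y; rewrite mulrC.
pose F6 (z : TQ * 'M[F]_(m + l)) := phi z.2 * chi z.2 * chi' (qmx z.1 *m z.2).
have cF6 : csupp_on (Qs `*` GL) F6 by exact: (csupp_act cpc cchi').
(* This is [F6] after left translation of [y] by the inverse of [q]. The law for [phi] gives the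
   factor [(deltaQ q)^-1], and [chi'] is freed of [q] in exchange for [chi]. *)
pose F7 (z : TQ * 'M[F]_(m + l)) :=
  phi z.2 * chi' z.2 * chi (qmx (invQ z.1) *m z.2) * (deltaQ z.1)^-1.
have cF7 : csupp_on (Qs `*` GL) F7.
  apply: (csuppM (f := fun z : TQ * 'M[F]_(m + l) =>
    phi z.2 * chi' z.2 * chi (qmx (invQ z.1) *m z.2))
    (g := fun z : TQ * 'M[F]_(m + l) => (deltaQ z.1)^-1)); last first.
    move=> [q y] [/= Qq uy]; apply: continuousV.
      by rewrite gt_eqF// (deltaQ_gt0 hF).
    by apply: (@continuous_comp _ _ _ fst deltaQ); [exact: cvg_fst|exact: (deltaQ_continuous av hF)].
  apply: (csupp_on_comp (U2 := Qs `*` GL) (h := fun z => (invQ z.1, z.2))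
    (k := fun z => (invQ z.1, z.2))
    (f := fun z => phi z.2 * chi' z.2 * chi (qmx z.1 *m z.2))).
  - move=> z [/= z1 z2]; apply: continuous_pair; last exact: cvg_snd.
    by apply: invQ_cont => //; exact: cvg_fst.
  - by move=> z [/= z1 z2]; split=> //=; exact/Qset_inv.
  - move=> z [/= z1 z2]; apply: continuous_pair; last exact: cvg_snd.
    by apply: invQ_cont => //; exact: cvg_fst.
  - by move=> z [/= z1 z2]; split=> //=; exact/Qset_inv.
  - by move=> [q y] [/= z1 z2]; rewrite invQK.
  - exact: (csupp_act cpc' cchi).
  - move=> [q y] /= nQ; have [uy|nuy] := pselect (GL y); last first.
      by rewrite (csupp_on_vanish cchi') ?mulr0 ?mul0r.
    rewrite (csupp_on_vanish cchi) ?mulr0// /GLset /= unitmx_mul => /andP[/qmxE + _].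
    by move=> /Qset_inv Qq; apply: nQ.
transitivity (IL (fun y => IQ (fun q => F6 (q, y)))).
  congr IL; apply/funext => y; have [uy|nuy] := pselect (GL y); last first.
    rewrite (csupp_on_vanish cpc)// -[LHS](radon0 rIQ); congr IQ.
    by apply/funext => q; rewrite (csupp_on_vanish cF6)// => -[].
  rewrite -[LHS]mulr1 -(chi'1 _ uy) -(radonZ rIQ)//.
  exact: csupp_orbit.
rewrite -IQ_IL_swap//.
transitivity (IQ (fun q => IL (fun y => F7 (q, y)))).
  congr IQ; apply/funext => q; have [Qq|nQq] := pselect (Qs q); last first.
    by congr IL; apply/funext => y; rewrite (csupp_on_vanish cF6) ?(csupp_on_vanish cF7)// => -[].
  have Qq' : Qs (invQ q) by exact/Qset_inv.
  have uq' : GL (qmx (invQ q)) by exact/qmxE.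
  rewrite -(IL_left av hF (csupp_on_pairr q cF6) uq'); congr IL; apply/funext => y.
  have [uy|nuy] := pselect (GL y); last first.
    rewrite (csupp_on_vanish cF7); last by move=> [].
    rewrite (csupp_on_vanish cF6)//= => -[_]; rewrite /GLset/= unitmx_mul.
    by move=> /andP[].
  rewrite /F6 /F7 /= phiQ// (deltaQV av hF Qq) qmxV//.
  rewrite mulKVmx; last exact/qmxE.
  by ring.
rewrite IQ_IL_swap//; congr IL; apply/funext => y.
have [uy|nuy] := pselect (GL y); last first.
  rewrite (csupp_on_vanish cpc')// -[RHS](radon0 rIQ); congr IQ.
  by apply/funext => q; rewrite (csupp_on_vanish cF7)// => -[].
(* The integral over [q] now runs over inverses with the factor [(deltaQ q)^-1]; by [IQ_inv] it is
   the orbit integral of [chi], that is 1. *)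
have co := csupp_orbit cchi uy.
have := IQ_inv co ce e0; rewrite chi1// => E.
rewrite -[RHS]mulr1 -E -(radonZ rIQ); last exact/csupp_delta/(csupp_invQ co).
by congr IQ; apply/funext => q; rewrite /F7 /= -mulrA.
Qed.

End Weil.

(** * A density normalized along the orbits *)

Section Density.
Variables (R : realType) (F : topFieldType) (a nu : F -> R).
Hypothesis av : absval a.
Variable IF : (F -> R) -> R.
Hypothesis hF : haar_fun nu IF.
Variables m l : nat.
Local Notation b := (m + l)%N.
Local Notation TQ := (('M[F]_m * 'M[F]_l) * 'M[F]_(m, l))%type.
Local Notation IQ := (@IQ R F nu IF m l).
Local Notation IL := (@IL R F nu IF (m + l)).
Local Notation Qs := (@Qset F m l).
Local Notation GL := (@GLset F (m + l)).
Local Notation deltaQ := (@deltaQ R F nu m l).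
Local Notation norm := (@mxnorm R F a _ _).

(* Positive on the representatives of [parabolic_cover], hence somewhere on every
   orbit of the parabolic subgroup. *)
Definition bump0 (y : 'M[F]_(m + l)) : R :=
  Order.max 0 ((b * b).+1%:R - mxnorm a y) * Order.max 0 (a (\det y) - 2^-1).

Lemma bump0_ge0 y : 0 <= bump0 y.
Proof. by rewrite mulr_ge0// le_max lexx. Qed.

Let cnorm : continuous (fun y : 'M[F]_(m + l) => mxnorm a y).
Proof. by move=> y; apply: (continuous_mxnorm av (f := id)); exact: continuous_idf. Qed.

Let cdet : continuous (fun y : 'M[F]_(m + l) => a (\det y)).
Proof.
move=> y; apply: (continuous_av av (f := fun y : 'M[F]_(m + l) => \det y)).
by apply: (continuous_det av (f := id)); exact: continuous_idf.
Qed.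

Lemma csupp_bump0 : csupp_on GL bump0.
Proof.
split=> [y _|].
  apply: continuousM.
    apply: (@continuous_max R _ (fun=> 0) (fun y : 'M[F]_(m + l) => (b * b).+1%:R - mxnorm a y)).
      exact: continuous_cstf.
    by apply: continuousB; [exact: continuous_cstf|exact: cnorm].
  apply: (@continuous_max R _ (fun=> 0) (fun y : 'M[F]_(m + l) => a (\det y) - 2^-1)).
    exact: continuous_cstf.
  by apply: continuousB; [exact: cdet|exact: continuous_cstf].
exists ([set y | mxnorm a y <= (b * b).+1%:R] `&` [set y | 2^-1 <= a (\det y)]); split.
- apply: (compact_closed_box av (r := (b * b).+1%:R)); last by move=> y [].
  by apply: closedI; [exact: closed_mxle|exact: closed_mxge].
- move=> y [_ /= dy]; rewrite /GLset/= unitmxE unitfE -(av_gt0 av).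
  by rewrite (lt_le_trans _ dy)// invr_gt0.
- move=> y /not_andP[/negP|/negP]; rewrite -ltNge => /ltW h.
    by rewrite /bump0 max_l ?mul0r// subr_le0.
  by rewrite /bump0 [X in _ * X]max_l ?mulr0// subr_le0.
Qed.

(** The thresholds in [bump0] are set for this: the norm is at most [b * b], below [(b * b).+1], and
    1 exceeds one half. *)
Lemma bump0_gt0 (y : 'M[F]_(m + l)) : (forall i j, a (y i j) <= 1) -> a (\det y) = 1 -> 0 < bump0 y.
Proof.
move=> y1 dy; rewrite mulr_gt0// lt_max; apply/orP; right; rewrite subr_gt0.
  apply: (@le_lt_trans _ _ (b * b)%:R); last by rewrite ltr_nat.
  rewrite /mxnorm (@le_trans _ _ (\sum_(i < b) \sum_(j < b) 1))//.
    by apply: ler_sum => i _; apply: ler_sum => j _.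
  by rewrite !sumr_const !card_ord -mulrnA.
by rewrite dy invf_lt1// ltr1n.
Qed.

Lemma bump0_1 : 0 < bump0 1%:M.
Proof.
apply: bump0_gt0; last by rewrite det1 (av1 av).
by move=> i j; rewrite mxE; case: eqP => _; rewrite ?(av1 av) ?(av0 av).
Qed.

Definition orbit_int (y : 'M[F]_(m + l)) : R := IQ (fun q => bump0 (qmx q *m y)).

Let rIQ : radon Qs IQ := @radon_IQ R F a nu av IF hF m l.

Lemma orbit_int_gt0 y : GL y -> 0 < orbit_int y.
Proof.
move=> uy; have [q [Qq q1 dq]] := parabolic_cover av uy.
apply: (radon_gt0 (x := q) rIQ (csupp_orbit av csupp_bump0 uy)).
  by move=> s; exact: bump0_ge0.
exact: bump0_gt0.
Qed.

(** Right invariance of [IQ], since moving the base point along its orbit is a right translation of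
    the group variable. The quotient of [bump0] by its orbit integral therefore has orbit integrals
    1. *)
Lemma orbit_int_left q y : Qs q -> GL y -> orbit_int (qmx q *m y) = orbit_int y.
Proof.
move=> Qq uy; rewrite /orbit_int -(IQ_right av hF (csupp_orbit av csupp_bump0 uy) Qq).
by congr IQ; apply/funext => s; rewrite qmxM mulmxA.
Qed.

Lemma orbit_int_continuous y : GL y -> {for y, continuous orbit_int}.
Proof.
move=> uy; have oGL : open GL by exact: (open_unitmx av).
have [e e0 eGL] := nbhs_mxnorm av (open_nbhs_nbhs (conj oGL uy)).
(* A compact neighbourhood of [y] inside GL. For [z] in it, the integrands are supported in one
   compact set of parabolic elements, as continuity of an integral with parameter demands. *)
pose K0 := [set z : 'M[F]_(m + l) | mxnorm a (z - y) <= e / 2].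
have K0G : K0 `<=` GL.
  by move=> z zy; apply: eGL; rewrite (le_lt_trans zy)// ltr_pdivrMr// ltr_pMr// ltr1n.
have cn : continuous (fun z : 'M[F]_(m + l) => mxnorm a (z - y)).
  move=> z; apply: (continuous_mxnorm av (f := fun z : 'M[F]_(m + l) => z - y)).
  by apply: (continuousDmx av (f := id) (g := fun=> - y)); [exact: continuous_idf|exact: continuous_cstf].
have cK0 : compact K0.
  apply: (compact_closed_box av (r := e / 2 + mxnorm a y)); first exact: closed_mxle.
  move=> z zy; apply: le_trans (lerD zy (lexx (mxnorm a y))).
  rewrite /mxnorm -big_split/=; apply: ler_sum => i _.
  rewrite -big_split/=; apply: ler_sum => j _.
  by rewrite (le_trans _ (avD av _ _))// !mxE subrK.
have nK0 : \forall z \near y, K0 z.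
  have e2 : 0 < e / 2 by rewrite divr_gt0.
  have /cvgrPdist_lt/(_ _ e2) := cn y.
  apply: filterS => z; rewrite subrr.
  have -> : mxnorm a (0 : 'M[F]_(m + l)) = 0.
    by rewrite /mxnorm big1// => i _; rewrite big1// => j _; rewrite mxE (av0 av).
  by rewrite sub0r normrN => /ltW; apply: le_trans; exact: ler_norm.
have [cb [K [cK KG Kb]]] := csupp_bump0.
have [cC CG] := compact_div av cK cK0 KG K0G.
have [cP PQ] := compact_qmx_preimage av cC CG.
have bmx p q : has_bumps R 'M[F]_(p, q) by exact: (has_bumps_mx av).
have hmx p q : hausdorff_space 'M[F]_(p, q) by exact: (hausdorff_mx av).
have bQ : has_bumps R TQ by exact: (has_bumps_prod (has_bumps_prod (bmx m m) (bmx l l)) (bmx m l)).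
have hQ : hausdorff_space TQ by exact: (hausdorff_prod (hausdorff_prod (hmx m m) (hmx l l)) (hmx m l)).
have cont z q : GL z -> Qs q -> {for (z, q), continuous
    (fun p : 'M[F]_(m + l) * TQ => bump0 (qmx p.2 *m p.1) * wQ nu p.2)}.
  move=> uz Qq; apply: continuousM; last first.
    apply: (@continuous_comp _ _ _ snd (@wQ R F nu m l)); first exact: cvg_snd.
    exact: (wQ_continuous av hF).
  apply: (@continuous_comp _ _ _ (fun p : 'M[F]_(m + l) * TQ => qmx p.2 *m p.1) bump0).
    apply: (continuousMmx av); last exact: cvg_fst.
    by apply: (@continuous_comp _ _ _ snd (@qmx F m l)); [exact: cvg_snd|exact: qmx_continuous].
  by apply: cb; rewrite /GLset/= unitmx_mul; apply/andP; split=> //; exact/qmxE.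
rewrite [orbit_int](_ : _ = fun z : 'M[F]_(m + l) =>
  @MQ R F IF m l (fun q : TQ => bump0 (qmx q *m z) * wQ nu q))//.
apply: (@radon_continuous R 'M[F]_(m + l) TQ (fun z q => bump0 (qmx q *m z) * wQ nu q) y (@MQ R F IF m l) _
  bQ (radon_MQ av hF m l) cP).
- apply: filterS nK0 => z /K0G uz.
  apply: csuppT hQ (csuppM (csupp_orbit av csupp_bump0 uz) _).
  exact: (wQ_continuous av hF).
- apply: filterS nK0 => z K0z q nC; rewrite Kb ?mul0r// => Kz; apply: nC.
  by exists (qmx q *m z, z) => //=; rewrite mulmxK//; exact: K0G.
- by move=> q /PQ; exact: cont.
Qed.

(** The density is [bump0] divided by its orbit integrals. Translating the argument of [phi] by [g]
    amounts to translating the density by the inverse of [g], which leaves all orbit integrals equal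
    to 1; [weil_uniqueness] then identifies the two averages. *)
Lemma invariant_density : exists w : 'M[F]_(m + l) -> R,
  [/\ csupp_on GL w, forall y, 0 <= w y, 0 < w 1%:M &
    forall phi : 'M[F]_(m + l) -> R, (forall y, GL y -> {for y, continuous phi}) ->
      (forall q y, Qs q -> GL y -> phi (qmx q *m y) = deltaQ q * phi y) ->
      forall g, GL g -> IL (fun y => phi (y *m g) * w y) = IL (fun y => phi y * w y)].
Proof.
pose w y := bump0 y * (orbit_int y)^-1.
have u1 : GL 1%:M by exact: unitmx1.
have cw : csupp_on GL w.
  apply: (csuppM csupp_bump0) => y uy; apply: continuousV.
    by rewrite gt_eqF// orbit_int_gt0.
  exact: orbit_int_continuous.
have w1 y : GL y -> IQ (fun q => w (qmx q *m y)) = 1.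
  move=> uy; have o0 := orbit_int_gt0 uy.
  rewrite -[RHS](mulVf (x := orbit_int y)) ?gt_eqF//.
  rewrite {2}/orbit_int -(radonZ rIQ); last exact: (csupp_orbit av csupp_bump0).
  congr IQ; apply/funext => q; rewrite /w.
  have [Qq|nQq] := pselect (Qs q); first by rewrite orbit_int_left// mulrC.
  rewrite (csupp_on_vanish csupp_bump0) ?mul0r ?mulr0//.
  by rewrite /GLset/= unitmx_mul => /andP[/qmxE].
exists w; split=> //.
- move=> y; have [uy|nuy] := pselect (GL y); last by rewrite (csupp_on_vanish cw).
  by apply: divr_ge0; [exact: bump0_ge0|exact/ltW/orbit_int_gt0].
- by apply: divr_gt0; [exact: bump0_1|exact: orbit_int_gt0].
move=> phi cphi phiQ g ug.
have ug' : GL (invmx g) by rewrite /GLset/= unitmx_inv.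
pose w' y := w (y *m invmx g).
have cw' : csupp_on GL w'.
  apply: (csupp_on_comp (U2 := GL) (k := fun y => y *m g) (h := fun y => y *m invmx g)) => //.
  - move=> y _; apply: (continuousMmx av (f := id) (g := fun=> invmx g)).
      exact: continuous_idf.
    exact: continuous_cstf.
  - by move=> y uy; rewrite /GLset/= unitmx_mul; apply/andP.
  - move=> y _; apply: (continuousMmx av (f := id) (g := fun=> g)).
      exact: continuous_idf.
    exact: continuous_cstf.
  - by move=> y uy; rewrite /GLset/= unitmx_mul; apply/andP.
  - by move=> y _; rewrite mulmxKV.
  - by move=> y nuy; apply: (csupp_on_vanish cw); rewrite /GLset/= unitmx_mul => /andP[].
have cF : csupp_on GL (fun y => phi y * w' y).
  rewrite (_ : (fun y => _) = fun y => w' y * phi y); first exact: csuppM.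
  by apply/funext => y; rewrite mulrC.
transitivity (IL (fun y => phi y * w' y)).
  rewrite -(IL_right av hF cF ug); congr IL; apply/funext => y.
  by rewrite /w' mulmxK.
(* The auxiliary function of nonzero integral is [bump0] along the orbit of the identity. *)
apply: (weil_uniqueness av hF (eta := fun q => bump0 (qmx q *m 1%:M))) => //.
- move=> y uy; rewrite -(w1 (y *m invmx g)); last first.
    by rewrite /GLset/= unitmx_mul; apply/andP.
  by congr IQ; apply/funext => q; rewrite /w' mulmxA.
- exact: (csupp_orbit av csupp_bump0).
- by rewrite gt_eqF// orbit_int_gt0.
Qed.

End Density.

(** * The averaging operators *)

Lemma powR_continuous (R : realType) (r x : R) : 0 < x -> {for x, continuous (@powR R ^~ r)}.
Proof.
move=> x0; apply: differentiable_continuous; apply/derivable1_diffP.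
by apply: derivable_powR; rewrite in_itv/= x0.
Qed.

Section Average.
Variables (R : realType) (F : topFieldType) (a nu : F -> R).
Hypothesis av : absval a.
Variable IF : (F -> R) -> R.
Hypothesis hF : haar_fun nu IF.
Variables (b n : nat).
Variable iota : 'M[F]_b -> 'M[F]_n.
Hypothesis iota_continuous : continuous iota.
Hypothesis iota_unit : forall y, (iota y \in unitmx) = (y \in unitmx).
Local Notation IL := (@IL R F nu IF b).
Local Notation GL := (@GLset F b).

Definition avg (w : 'M[F]_b -> R) (g : 'M[F]_n -> R) (x : 'M[F]_n) : R :=
  IL (fun y => g (iota y *m x) * w y).

Definition GLfun (g : 'M[F]_n -> R) : Prop :=
  (forall x, x \in unitmx -> {for x, continuous g}) /\
  (forall x, x \notin unitmx -> g x = 0).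

Lemma GLfun_orbit g x y : GLfun g -> x \in unitmx -> GL y ->
  {for y, continuous (fun y => g (iota y *m x))}.
Proof.
move=> [cg _] ux uy; apply: (@continuous_comp _ _ _ (fun y => iota y *m x) g).
  apply: (continuousMmx av); first exact: iota_continuous.
  exact: continuous_cstf.
by apply: cg; rewrite unitmx_mul iota_unit; apply/andP.
Qed.

Lemma csupp_avg w g x : csupp_on GL w -> GLfun g ->
  csupp_on GL (fun y => g (iota y *m x) * w y).
Proof.
move=> cw gg; have [ux|nux] := boolP (x \in unitmx).
  rewrite (_ : (fun y => _) = fun y => w y * g (iota y *m x)).
    by apply: (csuppM cw) => y uy; exact: GLfun_orbit.
  by apply/funext => y; rewrite mulrC.
rewrite (_ : (fun y => _) = fun=> 0); first exact: csupp0.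
apply/funext => y; rewrite gg.2 ?mul0r//; apply: contra nux.
by rewrite unitmx_mul => /andP[].
Qed.

Lemma avg_lin w c g h x : csupp_on GL w -> GLfun g -> GLfun h ->
  avg w (fun z => c * g z + h z) x = c * avg w g x + avg w h x.
Proof.
move=> cw gg gh; rewrite /avg.
rewrite -(radon_lin (radon_IL av hF b) c (csupp_avg x cw gg) (csupp_avg x cw gh)).
by congr IL; apply/funext => y; rewrite mulrDl mulrA.
Qed.

Lemma avg_out w g x : GLfun g -> x \notin unitmx -> avg w g x = 0.
Proof.
move=> gg nux; rewrite /avg -[RHS](radon0 (radon_IL av hF b)); congr IL.
apply/funext => y; rewrite gg.2 ?mul0r//; apply: contra nux.
by rewrite unitmx_mul => /andP[].
Qed.

Lemma avg_right w g x h : avg w (fun z => g (z *m h)) x = avg w g (x *m h).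
Proof. by rewrite /avg; congr IL; apply/funext => y; rewrite mulmxA. Qed.

Lemma avg_gt0 w g x : csupp_on GL w -> (forall y, 0 <= w y) -> 0 < w 1%:M ->
  GLfun g -> (forall z, z \in unitmx -> 0 < g z) -> x \in unitmx -> 0 < avg w g x.
Proof.
move=> cw w0 w1 gg g0 ux; apply: (radon_gt0 (x := 1%:M) (radon_IL av hF b)).
- exact: csupp_avg.
- move=> y; apply: mulr_ge0 => //; have [uz|nuz] := boolP (iota y *m x \in unitmx).
    exact/ltW/g0.
  by rewrite gg.2.
- apply: mulr_gt0 => //; apply: g0.
  by rewrite unitmx_mul iota_unit unitmx1.
Qed.

End Average.

Section Intertwine.
Variables (R : realType) (F : topFieldType) (a nu : F -> R).
Hypothesis av : absval a.
Variable IF : (F -> R) -> R.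
Hypothesis hF : haar_fun nu IF.
Variables (m l n : nat).
Local Notation b := (m + l)%N.
Variable iota : 'M[F]_(m + l) -> 'M[F]_n.
Hypothesis iota_continuous : continuous iota.
Hypothesis iota_unit : forall y, (iota y \in unitmx) = (y \in unitmx).
Hypothesis iotaM : forall y z, iota (y *m z) = iota y *m iota z.
Variables (s t e : R).
Hypotheses (hs : s - e = l%:R) (ht : t - e = - m%:R).
Local Notation IL := (@IL R F nu IF (m + l)).
Local Notation GL := (@GLset F (m + l)).
Local Notation Qs := (@Qset F m l).
Local Notation deltaQ := (@deltaQ R F nu m l).

Variable w0 : 'M[F]_(m + l) -> R.
Hypothesis cw0 : csupp_on GL w0.
Hypothesis w0_inv : forall phi : 'M[F]_(m + l) -> R,
  (forall y, GL y -> {for y, continuous phi}) ->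
  (forall q y, Qs q -> GL y -> phi (qmx q *m y) = deltaQ q * phi y) ->
  forall g, GL g -> IL (fun y => phi (y *m g) * w0 y) = IL (fun y => phi y * w0 y).

(** The factor [nu(det y)^(-e)] of the integrand is moved into the density, which makes the operator
    a plain average with a fixed compactly supported weight. *)
Definition twist (y : 'M[F]_(m + l)) : R := w0 y * nu (\det y) `^ (- e).

Lemma nu_det_powR_continuous (T : topologicalType) p (f : T -> 'M[F]_p) r x :
  {for x, continuous f} -> f x \in unitmx ->
  {for x, continuous (fun y => nu (\det (f y)) `^ r)}.
Proof.
move=> cf ux; apply: (@continuous_comp _ _ _ (fun y => nu (\det (f y))) (@powR R ^~ r)).
  exact: (nu_det_continuous av hF (k := 1)).
by apply: powR_continuous; exact: (nu_det_gt0 hF).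
Qed.

Lemma csupp_twist : csupp_on GL twist.
Proof.
apply: (csuppM cw0) => y uy.
by apply: (nu_det_powR_continuous (f := id)) => //; exact: continuous_idf.
Qed.

(** With the power of the determinant put back, the integrand [phi] transforms by [deltaQ]: this is
    where [s - e = l] and [t - e = - m] are used. Right translation by [h] preserves its average,
    and the determinant factor taken out of the translate becomes [nu(det h)^e]. *)
Lemma avg_block g x h : GLfun g -> x \in unitmx -> GL h ->
  (forall q z, Qs q -> z \in unitmx -> g (iota (qmx q) *m z) =
     nu (\det q.1.1) `^ s * nu (\det q.1.2) `^ t * g z) ->
  avg nu IF iota twist g (iota h *m x) =
  nu (\det h) `^ e * avg nu IF iota twist g x.
Proof.
move=> gg ux uh gQ.
pose phi y := g (iota y *m x) * nu (\det y) `^ (- e).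
have phic y : GL y -> {for y, continuous phi}.
  move=> uy; apply: continuousM; first exact: (GLfun_orbit av iota_continuous iota_unit).
  by apply: (nu_det_powR_continuous (f := id)) => //; exact: continuous_idf.
have phiQ q y : Qs q -> GL y -> phi (qmx q *m y) = deltaQ q * phi y.
  move=> Qq uy; have [q1 q2] := Qq; have uq : qmx q \in unitmx by exact/qmxE.
  rewrite /phi iotaM -mulmxA gQ//; last by rewrite unitmx_mul iota_unit; apply/andP.
  rewrite (nu_detM av hF)// /qmx det_ublock -/(qmx q).
  rewrite (nuM av hF) -?unitfE -?unitmxE//.
  have d1 := nu_det_gt0 hF q1; have d2 := nu_det_gt0 hF q2; have dy := nu_det_gt0 hF uy.
  rewrite !powRM ?mulr_ge0 ?(ltW d1) ?(ltW d2) ?(ltW dy)//.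
  have E1 : nu (\det q.1.1) `^ s * nu (\det q.1.1) `^ (- e) = nu (\det q.1.1) ^+ l.
    by rewrite -powRD ?(gt_eqF d1) ?implybT// hs powR_mulrn// ltW.
  have E2 : nu (\det q.1.2) `^ t * nu (\det q.1.2) `^ (- e) = (nu (\det q.1.2) ^+ m)^-1.
    by rewrite -powRD ?(gt_eqF d2) ?implybT// ht powRN powR_mulrn// ltW.
  rewrite /deltaQ -E1 -E2; ring.
have E := w0_inv phic phiQ uh.
rewrite /avg.
transitivity (nu (\det h) `^ e * IL (fun y => phi (y *m h) * w0 y)).
  have rIL := radon_IL av hF (m + l).
  have cphi : csupp_on GL (fun y => phi (y *m h) * w0 y).
    rewrite (_ : (fun y => _) = fun y => w0 y * phi (y *m h)); last first.
      by apply/funext => y; rewrite mulrC.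
    apply: (csuppM cw0) => y uy.
    apply: (@continuous_comp _ _ _ (fun y => y *m h) phi).
      by apply: (continuousMmx av (f := id) (g := fun=> h)); [exact: continuous_idf|exact: continuous_cstf].
    by apply: phic; rewrite /GLset/= unitmx_mul; apply/andP.
  rewrite -(radonZ rIL)//; congr IL; apply/funext => y.
  have [uy|nuy] := pselect (GL y); last first.
    by rewrite (csupp_on_vanish csupp_twist) ?(csupp_on_vanish cw0)// !mulr0.
  rewrite /phi /twist iotaM mulmxA (nu_detM av hF)//.
  have dh := nu_det_gt0 hF uh; have dy := nu_det_gt0 hF uy.
  rewrite powRM ?ltW// [nu (\det h) `^ (- e)]powRN.
  have p0 : nu (\det h) `^ e != 0 by rewrite gt_eqF// powR_gt0.
  by field.
rewrite E; congr (_ * _); congr IL; apply/funext => y.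
by rewrite /phi /twist; ring.
Qed.

End Intertwine.

(** * Diagonal block embeddings and the transformation law of the averages *)

Section Embeddings.
Variables (R : realType) (F : topFieldType) (a nu : F -> R).
Hypothesis av : absval a.
Variable IF : (F -> R) -> R.
Hypothesis hF : haar_fun nu IF.

Definition iota_dr c b (y : 'M[F]_b) : 'M[F]_(c + b) := block_mx 1%:M 0 0 y.
Definition iota_ul b c (y : 'M[F]_b) : 'M[F]_(b + c) := block_mx y 0 0 1%:M.

Lemma iota_dr_unit c b (y : 'M[F]_b) : (iota_dr c y \in unitmx) = (y \in unitmx).
Proof. by rewrite !unitmxE det_ublock det1 mul1r. Qed.

Lemma iota_ul_unit b c (y : 'M[F]_b) : (iota_ul c y \in unitmx) = (y \in unitmx).
Proof. by rewrite !unitmxE det_ublock det1 mulr1. Qed.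

Lemma iota_drM c b (y z : 'M[F]_b) : iota_dr c (y *m z) = iota_dr c y *m iota_dr c z.
Proof. by rewrite /iota_dr mulmx_block !mulmx0 !mul0mx mulmx1 !addr0 add0r. Qed.

Lemma iota_ulM b c (y z : 'M[F]_b) : iota_ul c (y *m z) = iota_ul c y *m iota_ul c z.
Proof. by rewrite /iota_ul mulmx_block !mulmx0 !mul0mx mulmx1 !addr0 add0r. Qed.

Lemma iota_dr_continuous c b : continuous (@iota_dr c b).
Proof.
move=> y; apply: (@continuous_col_mx F _ c b (c + b)
  (fun y => row_mx 1%:M 0) (fun y => row_mx 0 y)); first exact: continuous_cstf.
by apply: (@continuous_row_mx F _ b c b (fun=> 0) id); [exact: continuous_cstf|exact: continuous_idf].
Qed.

Lemma iota_ul_continuous b c : continuous (@iota_ul b c).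
Proof.
move=> y; apply: (@continuous_col_mx F _ b c (b + c)
  (fun y => row_mx y 0) (fun y => row_mx 0 1%:M)); last exact: continuous_cstf.
by apply: (@continuous_row_mx F _ b b c id (fun=> 0)); [exact: continuous_idf|exact: continuous_cstf].
Qed.

(** The characters and the square root of the modular function are merged into two real exponents.
    The factor is real, so the law is stated for real functions and applied to real and imaginary
    parts separately. *)
Definition ind_real n p1 p2 (e : (p1 + p2)%N = n) (s t : R) (g : 'M[F]_n -> R) : Prop :=
  forall (x1 : 'M[F]_p1) (x2 : 'M[F]_(p1, p2)) (x3 : 'M[F]_p2) (x : 'M[F]_n),
    x1 \in unitmx -> x3 \in unitmx -> x \in unitmx ->
    g (castmx (e, e) (block_mx x1 x2 0 x3) *m x) =
    nu (\det x1) `^ s * nu (\det x3) `^ t * g x.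

(** Cutting both sides into blocks of sizes [c], [m] and [l] shows where the parabolic subgroups for
    [c + m], [l] and for [c], [m + l] meet. *)
Lemma cast_block_lower c m l (A11 : 'M[F]_c) (A12 : 'M[F]_(c, m)) (A13 : 'M[F]_(c, l))
    (A22 : 'M[F]_m) (A23 : 'M[F]_(m, l)) (A33 : 'M[F]_l) :
  castmx (esym (addnA c m l), esym (addnA c m l))
    (block_mx (block_mx A11 A12 0 A22) (col_mx A13 A23) 0 A33) =
  block_mx A11 (row_mx A12 A13) 0 (block_mx A22 A23 0 A33).
Proof.
have /= := @block_mxA F c m l c m l A11 A12 A13 0 A22 A23 0 0 A33.
by rewrite row_mx0 col_mx0 => ->.
Qed.

Lemma cast_block_upper c m l (A11 : 'M[F]_m) (A12 : 'M[F]_(m, l)) (A13 : 'M[F]_(m, c))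
    (A22 : 'M[F]_l) (A23 : 'M[F]_(l, c)) (A33 : 'M[F]_c) :
  castmx (addnA m l c, addnA m l c)
    (block_mx A11 (row_mx A12 A13) 0 (block_mx A22 A23 0 A33)) =
  block_mx (block_mx A11 A12 0 A22) (col_mx A13 A23) 0 A33.
Proof. by rewrite -cast_block_lower castmx_comp castmx_id. Qed.

Section TwoTransforms.
Variables (c m l : nat) (s t e : R).
Hypotheses (hs : s - e = l%:R) (ht : t - e = - m%:R).
Variable w0 : 'M[F]_(m + l) -> R.
Hypothesis cw0 : csupp_on (@GLset F (m + l)) w0.
Hypothesis w0_inv : forall phi : 'M[F]_(m + l) -> R,
  (forall y, GLset y -> {for y, continuous phi}) ->
  (forall (q : ('M[F]_m * 'M[F]_l) * 'M[F]_(m, l)) y, Qset q -> GLset y ->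
     phi (qmx q *m y) = deltaQ nu q * phi y) ->
  forall g, GLset g ->
    IL nu IF (fun y => phi (y *m g) * w0 y) = IL nu IF (fun y => phi y * w0 y).

Let IL_GL f h : (forall y : 'M[F]_(m + l), GLset y -> f y = h y) ->
  IL nu IF (fun y => f y * twist nu e w0 y) = IL nu IF (fun y => h y * twist nu e w0 y).
Proof.
move=> fh; congr IL; apply/funext => y; have [uy|nuy] := pselect (GLset y).
  by rewrite fh.
by rewrite (csupp_on_vanish (csupp_twist av hF e cw0) nuy) !mulr0.
Qed.

(** An element of the target subgroup is handled in two halves: [A'] and [B'] are moved to the left
    of [iota_dr c y], where the law of [g] applies, and [D'] stays inside the embedded group, where
    [avg_block] gives the exponent [e]. *)
Lemma avg_lower (e1 : ((c + m) + l)%N = (c + (m + l))%N) g :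
  GLfun g -> ind_real e1 s t g ->
  ind_real erefl s e (avg nu IF (@iota_dr c (m + l)) (twist nu e w0) g).
Proof.
have -> : e1 = esym (addnA c m l) by exact: eq_irrelevance.
move=> gg ig A' B' D' x uA uD ux; rewrite castmx_id.
have H1 (q : ('M[F]_m * 'M[F]_l) * 'M[F]_(m, l)) z : Qset q -> z \in unitmx ->
    g (iota_dr c (qmx q) *m z) = nu (\det q.1.1) `^ s * nu (\det q.1.2) `^ t * g z.
  move=> [q1 q2] uz.
  have := ig (block_mx 1%:M 0 0 q.1.1) (col_mx 0 q.2) q.1.2 z.
  rewrite det_ublock det1 mul1r => <- //; last first.
    by rewrite unitmxE det_ublock det1 mul1r -unitmxE.
  by rewrite cast_block_lower row_mx0.
have H2 y : GLset y -> g (iota_dr c y *m (block_mx A' B' 0 D' *m x)) =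
    nu (\det A') `^ s * g (iota_dr c y *m (iota_dr c D' *m x)).
  (* The corner after the commutation; it depends on [y] but does not affect the factor, which only
     involves diagonal blocks. *)
  move=> uy; pose X := B' *m invmx (y *m D').
  have uyD : y *m D' \in unitmx by rewrite unitmx_mul; apply/andP.
  have -> : iota_dr c y *m (block_mx A' B' 0 D' *m x) =
      block_mx A' X 0 1%:M *m (iota_dr c (y *m D') *m x).
    rewrite !mulmxA /iota_dr !mulmx_block !mulmx0 !mul0mx !mulmx1 !mul1mx !addr0 !add0r.
    by rewrite /X mulmxKV.
  have := ig (block_mx A' (lsubmx X) 0 1%:M) (col_mx (rsubmx X) 0) 1%:M
    (iota_dr c (y *m D') *m x).
  rewrite det_ublock !det1 mulr1 (nu1 av hF) powR1 mulr1.
  rewrite iota_drM -!mulmxA => <-; first last.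
  - by rewrite !unitmx_mul !iota_dr_unit; apply/and3P.
  - exact: unitmx1.
  - by rewrite unitmxE det_ublock det1 mulr1 -unitmxE.
  by rewrite cast_block_lower hsubmxK -scalar_mx_block.
rewrite /avg (IL_GL H2).
transitivity (nu (\det A') `^ s *
    avg nu IF (@iota_dr c (m + l)) (twist nu e w0) g (iota_dr c D' *m x)).
  rewrite /avg -(radonZ (radon_IL av hF (m + l))).
    by congr IL; apply/funext => y; rewrite mulrA.
  exact: (csupp_avg av (@iota_dr_continuous c _) (@iota_dr_unit c _) _ (csupp_twist av hF e cw0)).
rewrite (avg_block av hF (@iota_dr_continuous c _) (@iota_dr_unit c _)
  (@iota_drM c _) hs ht cw0 w0_inv gg ux uD H1).
by rewrite mulrA.
Qed.

(** The mirror image of [avg_lower]: [D'] and the corner move to the left, and [A'] is absorbed by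
    the embedded group. *)
Lemma avg_upper (e1 : (m + (l + c))%N = ((m + l) + c)%N) g :
  GLfun g -> ind_real e1 s t g ->
  ind_real erefl e t (avg nu IF (@iota_ul (m + l) c) (twist nu e w0) g).
Proof.
have -> : e1 = addnA m l c by exact: eq_irrelevance.
move=> gg ig A' B' D' x uA uD ux; rewrite castmx_id.
have H1 (q : ('M[F]_m * 'M[F]_l) * 'M[F]_(m, l)) z : Qset q -> z \in unitmx ->
    g (iota_ul c (qmx q) *m z) = nu (\det q.1.1) `^ s * nu (\det q.1.2) `^ t * g z.
  move=> [q1 q2] uz.
  have := ig q.1.1 (row_mx q.2 0) (block_mx q.1.2 0 0 1%:M) z.
  rewrite det_ublock det1 mulr1 => <- //; last first.
    by rewrite unitmxE det_ublock det1 mulr1 -unitmxE.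
  by rewrite cast_block_upper col_mx0.
have H2 y : GLset y -> g (iota_ul c y *m (block_mx A' B' 0 D' *m x)) =
    nu (\det D') `^ t * g (iota_ul c y *m (iota_ul c A' *m x)).
  move=> uy; pose Y := y *m B'.
  have uyA : y *m A' \in unitmx by rewrite unitmx_mul; apply/andP.
  have -> : iota_ul c y *m (block_mx A' B' 0 D' *m x) =
      block_mx 1%:M Y 0 D' *m (iota_ul c (y *m A') *m x).
    by rewrite !mulmxA /iota_ul !mulmx_block !mulmx0 !mul0mx !mulmx1 !mul1mx !addr0 !add0r.
  have := ig 1%:M (row_mx 0 (usubmx Y)) (block_mx 1%:M (dsubmx Y) 0 D')
    (iota_ul c (y *m A') *m x).
  rewrite det_ublock !det1 mul1r (nu1 av hF) powR1 mul1r.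
  rewrite iota_ulM -!mulmxA => <-; first last.
  - by rewrite !unitmx_mul !iota_ul_unit; apply/and3P.
  - by rewrite unitmxE det_ublock det1 mul1r -unitmxE.
  - exact: unitmx1.
  by rewrite cast_block_upper vsubmxK -scalar_mx_block.
rewrite /avg (IL_GL H2).
transitivity (nu (\det D') `^ t *
    avg nu IF (@iota_ul (m + l) c) (twist nu e w0) g (iota_ul c A' *m x)).
  rewrite /avg -(radonZ (radon_IL av hF (m + l))).
    by congr IL; apply/funext => y; rewrite mulrA.
  exact: (csupp_avg av (@iota_ul_continuous _ c) (@iota_ul_unit _ c) _ (csupp_twist av hF e cw0)).
rewrite (avg_block av hF (@iota_ul_continuous _ c) (@iota_ul_unit _ c)
  (@iota_ulM _ c) hs ht cw0 w0_inv gg ux uA H1).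
by rewrite mulrCA mulrA.
Qed.

End TwoTransforms.
End Embeddings.

(** * From Haar measures to Haar functionals *)

Section HaarFunctional.
Variables (R : realType) (F : topFieldType) (a nu : F -> R).
Hypothesis av : absval a.
Local Notation BF := (@g_sigma_algebraType (borel F) (@open F)).
Variable mu : {measure set BF -> \bar R}.
Hypothesis hmu : is_haar (mu : set F -> \bar R).
Hypothesis hnu : forall z : F, z != 0 -> 0 < nu z /\
  forall A : set F, <<s @open F>> A ->
    mu ( *%R z @` A) = ((nu z)%:E * mu A)%E.

Lemma hausdorff_field : hausdorff_space F.
Proof.
move=> x y cl; apply: contrapT => /eqP xy.
have e0 : 0 < a (x - y) / 2 by rewrite divr_gt0// (av_gt0 av) subr_eq0.
have nb (z : F) : nbhs z [set t | a (t - z) < a (x - y) / 2].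
  by apply/(av_nbhs av); exists (a (x - y) / 2).
have [z [/= zx zy]] := cl _ _ (nb x) (nb y).
have : a (x - y) < a (x - y).
  rewrite [ltRHS]splitr -{1}(subrK z x) -addrA.
  by rewrite (le_lt_trans (avD av _ _))// ltrD// -(avN av) opprB.
by rewrite ltxx.
Qed.

Lemma open_measurable_field (A : set F) : open A -> measurable (A : set BF).
Proof. exact: sub_sigma_algebra. Qed.

Lemma compact_measurable_field (A : set F) : compact A -> measurable (A : set BF).
Proof.
move=> cA; rewrite -[A]setCK; apply: (@measurableC _ BF).
by apply: open_measurable_field; apply: closed_openC; exact: compact_closed hausdorff_field cA.
Qed.

Lemma continuous_measurable_field (f : F -> R) : continuous f ->
  measurable_fun setT (f : BF -> R).
Proof.
move=> cf; apply: (measurability _ (measurable_realfun.RGenOInfty.measurableE R)) => _ [_ [x ->] <-].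
rewrite setTI; apply: open_measurable_field.
by apply: (@open_comp _ _ f) => [y _|]; [exact: cf|exact: interval_open].
Qed.

Lemma csupp_integrable f : csupp f -> mu.-integrable setT (EFin \o (f : BF -> R)).
Proof.
move=> [cf [K [cK _ Kf]]]; have [_ mK _] := hmu.
have mKK := compact_measurable_field cK.
have iK : mu.-integrable K (EFin \o (f : BF -> R)).
  apply: (@measurable_bounded_integrable _ BF R mu (f : BF -> R) K mKK).
  - exact: mK.
  - apply: (@measurable_funS _ _ _ _ setT) => //; apply: continuous_measurable_field.
    by move=> x; exact: cf.
  - have : compact (f @` K).
      by apply: continuous_compact => //; apply: continuous_subspaceT => x; exact: cf.
    move=> /compact_bounded[M [Mr hM]]; exists M; split=> // x Mx y Ky.
    by apply: (hM _ Mx); exists y.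
rewrite (_ : EFin \o (f : BF -> R) = (EFin \o (f : BF -> R)) \_ K).
  exact: (proj1 (integrable_mkcond _ mKK) iK).
apply/funext => x; rewrite patchE; case: ifPn => //.
by rewrite notin_setE => /Kf /= ->.
Qed.

Definition haar_int (f : F -> R) : R := Rintegral mu setT (f : BF -> R).

Lemma haar_int_ge0 f : (forall x, 0 <= f x) -> 0 <= haar_int f.
Proof. by move=> f0; apply: Rintegral_ge0 => x _. Qed.

Lemma haar_int_lin c f g : csupp f -> csupp g ->
  haar_int (fun x => c * f x + g x) = c * haar_int f + haar_int g.
Proof.
move=> cf cg; rewrite /haar_int RintegralD//.
- by rewrite RintegralZl//; exact: csupp_integrable.
- exact: (csupp_integrable (csuppZ c cf)).
- exact: csupp_integrable.
Qed.

Lemma measurable_addl s : measurable_fun setT (fun t : BF => (t : F) + s : BF).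
Proof.
apply: (@measurability _ _ BF BF _ _ (@open F)) => // _ [B oB <-].
rewrite setTI; apply: open_measurable_field; apply: open_comp => // x _.
by apply: (continuousDF av (f := id) (g := fun=> s)); [exact: continuous_idf|exact: continuous_cstf].
Qed.

Lemma measurable_mull s : measurable_fun setT (fun t : BF => s * (t : F) : BF).
Proof.
apply: (@measurability _ _ BF BF _ _ (@open F)) => // _ [B oB <-].
rewrite setTI; apply: open_measurable_field; apply: open_comp => // x _.
by apply: (continuousMF av (f := fun=> s) (g := id)); [exact: continuous_cstf|exact: continuous_idf].
Qed.

Lemma csupp_measurable f : csupp f ->
  measurable_fun setT (EFin \o (f : BF -> R)).
Proof.
move=> [cf _]; apply/measurable_EFinP; apply: continuous_measurable_field => x.
exact: cf.
Qed.

(** A change of variables by push-forward of the measure, done for nonnegative functions; the signed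
    case follows from positive and negative parts. *)
Lemma haar_int_translate_ge0 f s : csupp f -> (forall x, 0 <= f x) ->
  haar_int (fun t => f (t + s)) = haar_int f.
Proof.
move=> cf f0; have [_ _ inv] := hmu; rewrite /haar_int /Rintegral; congr fine.
have := @ge0_integral_pushforward _ _ BF BF R _ (measurable_addl s) mu setT
  (EFin \o (f : BF -> R)) measurableT (csupp_measurable cf).
move=> E.
apply: etrans; first by apply/esym/E => y _; rewrite lee_fin.
apply: eq_measure_integral => [|mf A mA _]; first exact: measurable_addl.
rewrite /pushforward; transitivity (mu (+%R (- s) @` (A : set F))); last exact: inv.
congr (mu _).
rewrite eqEsubset; split=> [t /= At|_ [t At <-]] /=.
  by exists (t + s) => //; rewrite addrCA addNr addr0.
by rewrite addrAC addNr add0r.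
Qed.

Lemma haar_int_scale_ge0 f c : csupp f -> (forall x, 0 <= f x) -> c != 0 ->
  haar_int f = nu c * haar_int (fun t => f (c * t)).
Proof.
move=> cf f0 c0; have [nc nuc] := hnu c0.
pose g t := f (c * t).
have cg : csupp g.
  apply: (@csupp_comp R F F (fun t => c * t) (fun t => c^-1 * t)) => // y.
  - by apply: (continuousMF av (f := fun=> c) (g := id)); [exact: continuous_cstf|exact: continuous_idf].
  - by apply: (continuousMF av (f := fun=> c^-1) (g := id)); [exact: continuous_cstf|exact: continuous_idf].
  - by rewrite mulKf.
have g0 x : 0 <= g x by exact: f0.
have := @ge0_integral_pushforward _ _ BF BF R _ (measurable_mull c^-1) mu setT
  (EFin \o (g : BF -> R)) measurableT (csupp_measurable cg).
move=> E.
have E1 : (\int[mu]_x (f x)%:E = (nu c)%:E * \int[mu]_x (g x)%:E)%E.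
  rewrite -(@ge0_integral_mscale _ _ _ mu setT measurableT (NngNum (ltW nc))
    (EFin \o (g : BF -> R)))//; [|exact: csupp_measurable|by move=> x _; rewrite lee_fin].
  transitivity (\int[mu]_x (EFin \o (g : BF -> R) \o (fun t : BF => (c^-1 * (t : F))%R : BF)) x)%E.
    by apply: eq_integral => x _ /=; rewrite /g mulVKf.
  rewrite -E; last by move=> y _; rewrite lee_fin.
  apply: eq_measure_integral => [|mf A mA _]; first exact: measurable_mull.
  rewrite /pushforward /mscale/=.
  transitivity (mu ( *%R c @` (A : set F))); last exact: nuc.
  congr (mu _).
  rewrite eqEsubset; split=> [t /= At|_ [t At <-]] /=.
    by exists (c^-1 * t) => //; rewrite mulVKf.
  by rewrite mulKf.
rewrite /haar_int /Rintegral E1 fineM//.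
exact: (integrable_fin_num _ (csupp_integrable cg)).
Qed.

Let pos (f : F -> R) x := Order.max 0 (f x).
Let neg (f : F -> R) x := Order.max 0 (- f x).

Let csupp_pos f : csupp f -> csupp (pos f).
Proof.
move=> [cf [K [cK KU Kf]]]; split=> [x _|].
  by apply: (@continuous_max R _ (fun=> 0) f); [exact: continuous_cstf|exact: cf].
by exists K; split=> // x /Kf fx; rewrite /pos fx max_l.
Qed.

Let csupp_neg f : csupp f -> csupp (neg f).
Proof.
move=> cf; have := csupp_pos (csuppZ (-1) cf); congr csupp_on.
by apply/funext => x; rewrite /pos /neg mulN1r.
Qed.

(** Written in the shape [c * f + g] of [haar_int_lin], with [c = -1]. *)
Let posneg f : f = fun x => - 1 * neg f x + pos f x.
Proof.
apply/funext => x; rewrite /pos /neg mulN1r; have [f0|f0] := orP (le_total (f x) 0).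
  by rewrite [Order.max 0 (- f x)]max_r ?oppr_ge0// [Order.max 0 (f x)]max_l// opprK addr0.
by rewrite [Order.max 0 (- f x)]max_l ?oppr_le0// [Order.max 0 (f x)]max_r// oppr0 add0r.
Qed.

Lemma haar_int_translate f s : csupp f ->
  haar_int (fun t => f (t + s)) = haar_int f.
Proof.
move=> cf; rewrite {2}(posneg f) haar_int_lin; [|exact: csupp_neg|exact: csupp_pos].
rewrite -(haar_int_translate_ge0 s (csupp_neg cf)); last by move=> x; rewrite /neg le_max lexx.
rewrite -(haar_int_translate_ge0 s (csupp_pos cf)); last by move=> x; rewrite /pos le_max lexx.
have ct (h : F -> R) : csupp h -> csupp (fun t => h (t + s)).
  apply: (@csupp_comp R F F (fun t => t + s) (fun t => t - s)) => y.
  - by apply: (continuousDF av (f := id) (g := fun=> s)); [exact: continuous_idf|exact: continuous_cstf].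
  - by apply: (continuousDF av (f := id) (g := fun=> - s)); [exact: continuous_idf|exact: continuous_cstf].
  - by rewrite addrK.
rewrite -haar_int_lin; [|exact/ct/csupp_neg|exact/ct/csupp_pos].
by congr haar_int; apply/funext => t; rewrite {1}(posneg f).
Qed.

Lemma haar_int_scale f c : csupp f -> c != 0 ->
  haar_int (fun t => f (c * t)) = (nu c)^-1 * haar_int f.
Proof.
move=> cf c0; have [nc _] := hnu c0.
rewrite {2}(posneg f) haar_int_lin; [|exact: csupp_neg|exact: csupp_pos].
rewrite (haar_int_scale_ge0 (csupp_neg cf) _ c0); last by move=> x; rewrite /neg le_max lexx.
rewrite (haar_int_scale_ge0 (csupp_pos cf) _ c0); last by move=> x; rewrite /pos le_max lexx.
rewrite mulrCA -mulrDr mulKf ?gt_eqF//.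
have ct (h : F -> R) : csupp h -> csupp (fun t => h (c * t)).
  apply: (@csupp_comp R F F (fun t => c * t) (fun t => c^-1 * t)) => y.
  - by apply: (continuousMF av (f := fun=> c) (g := id)); [exact: continuous_cstf|exact: continuous_idf].
  - by apply: (continuousMF av (f := fun=> c^-1) (g := id)); [exact: continuous_cstf|exact: continuous_idf].
  - by rewrite mulKf.
rewrite -haar_int_lin; [|exact/ct/csupp_neg|exact/ct/csupp_pos].
by congr haar_int; apply/funext => t; rewrite {1}(posneg f).
Qed.

(* A null open set would have null translates, finitely many of which cover any
   given compact ball. *)
Lemma haar_open_gt0 (A : set F) : open A -> A !=set0 -> (0 < mu A)%E.
Proof.
move=> oA [x0 Ax0]; have [mT mK inv] := hmu.
rewrite lt0e measure_ge0 andbT; apply: contraNneq mT => A0.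
have mA := open_measurable_field oA.
have [e e0 eA] : exists2 e : R, 0 < e & [set y | a (y - x0) < e] `<=` A.
  by apply/(av_nbhs av); exact: open_nbhs_nbhs.
(* Balls of integer radius exhaust the field; if they are all null, so is the whole space, against
   the first clause of [is_haar]. *)
pose Bn (n : nat) : set F := [set y | a y <= n%:R].
have Bn0 n : mu (Bn n) = 0%E.
  have cB : compact (Bn n) by exact: (av_compact av).
  pose P (s : seq F) (y : F) := exists2 z, z \in s & a (y - z) < e.
  pose G : set_system (seq F) := [set X | exists s : seq F, forall s' : seq F,
    (forall x, x \in s -> x \in s') -> X s'].
  have FG : Filter G.
    split; first by exists [::].
    - move=> X Y [s sX] [t tY]; exists (s ++ t) => u su; split.
        by apply: sX => x xs; apply: su; rewrite mem_cat xs.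
      by apply: tY => x xs; apply: su; rewrite mem_cat xs orbT.
    - by move=> X Y XY [s sX]; exists s => t st; exact/XY/sX.
  have /compact_near_coveringP/(_ _ G P FG) := cB.
  case.
    move=> x _; exists ([set z | a (z - x) < e], [set s : seq F | x \in s]); last first.
      by move=> [z s] /= [zx xs]; exists x.
    split=> /=; first by apply/(av_nbhs av); exists e.
    by exists [:: x] => s; apply; rewrite inE.
  move=> s /(_ s (fun _ => id)) cov.
  have tr0 (z : F) : mu (+%R z @` A) = 0%E by rewrite inv.
  have mtr (z : F) : measurable (+%R z @` A : set BF).
    rewrite (_ : _ @` _ = (fun t : F => t + - z) @^-1` A).
      apply: open_measurable_field; apply: open_comp => // x _.
      by apply: (continuousDF av (f := id) (g := fun=> - z)); [exact: continuous_idf|exact: continuous_cstf].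
    rewrite eqEsubset; split=> [_ [t At <-]|t At] /=; first by rewrite addrAC subrr add0r.
    by exists (t - z) => //; rewrite addrC subrK.
  have : (mu (Bn n) <= mu (\big[setU/set0]_(z <- s) (+%R (z - x0) @` A)))%E.
    apply: le_measure; rewrite ?inE; first exact: compact_measurable_field.
      by apply: bigsetU_measurable => z _; exact: mtr.
    move=> y /cov[z zs yz]; rewrite -bigcup_seq; exists z => //=.
    exists (y - z + x0); last by ring.
    by apply: eA; rewrite /= addrK.
  move=> /le_trans h; apply/eqP; rewrite eq_le measure_ge0 andbT; apply: h.
  elim: s {cov} => [|z s IH]; first by rewrite big_nil measure0.
  have m2 : measurable (\big[setU/set0]_(z <- s) (+%R (z - x0) @` A) : set BF).
    by apply: bigsetU_measurable => y _; exact: mtr.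
  rewrite big_cons; apply: (le_trans (measureU2 mu (mtr (z - x0)) m2)).
  by rewrite [X in (X + _)%E](_ : _ = 0%E) ?add0e//; exact: tr0.
apply/eqP; rewrite (_ : setT = \bigcup_n (Bn n)).
  apply/eqP; rewrite eq_le measure_ge0 andbT.
  apply: (le_trans (measure_sigma_subadditive _ _ _ (fun x h => h))).
  - by move=> n; apply: compact_measurable_field; exact: (av_compact av).
  - by apply: bigcupT_measurable => n; apply: compact_measurable_field; exact: (av_compact av).
  - by rewrite eseries0// => n _ _; exact: Bn0.
rewrite eqEsubset; split=> // x _; have [n xn] : exists n : nat, a x < n%:R.
  by exists (Num.truncn (a x)).+1; exact: truncnS_gt.
by exists n => //=; exact: ltW.
Qed.

(** The function exceeds half of one of its positive values on a nonempty open set, which has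
    positive measure. *)
Lemma haar_int_gt0 f : csupp f -> (forall x, 0 <= f x) -> (exists x, 0 < f x) ->
  0 < haar_int f.
Proof.
move=> cf f0 [x0 fx0].
pose A : set F := [set x | f x0 / 2 < f x].
have oA : open A.
  apply: (@open_comp _ _ f [set r | f x0 / 2 < r]); last exact: open_gt.
  by move=> x _; exact: cf.1.
have A0 : A !=set0 by exists x0; rewrite /A/= ltr_pdivrMr// ltr_pMr// ltr1n.
have mA := open_measurable_field oA.
have muA := haar_open_gt0 oA A0.
have fx2 : 0 < f x0 / 2 by rewrite divr_gt0.
have fin := integrable_fin_num measurableT (csupp_integrable cf).
rewrite /haar_int /Rintegral fine_gt0// ltey_eq fin andbT.
apply: (@lt_le_trans _ _ ((f x0 / 2)%:E * mu A)%E).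
  by rewrite mule_gt0// lte_fin.
rewrite -(integral_cst mu mA) integral_mkcond.
apply: ge0_le_integral => //.
- by move=> x _; rewrite patchE; case: ifP => // _; rewrite lee_fin ltW.
- by apply/(measurable_restrictT _ mA); exact: measurable_cst.
- exact: csupp_measurable.
- move=> x _; rewrite patchE; case: ifPn => [|_]; last by rewrite lee_fin.
  by rewrite inE => /ltW; rewrite lee_fin.
Qed.

Lemma haar_fun_int : haar_fun nu haar_int.
Proof.
split.
- split=> [c f g cf cg|]; first exact: haar_int_lin.
  by split=> f cf f0; [exact: haar_int_ge0|exact: haar_int_gt0].
- by move=> f s; exact: haar_int_translate.
- by move=> f c cf c0; split; [have [] := hnu c0|exact: haar_int_scale].
Qed.

End HaarFunctional.

Lemma is_modulus_haar_fun (R : realType) (F : topFieldType) (a nu : F -> R) :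
  absval a -> is_modulus nu -> exists IF, haar_fun nu IF.
Proof.
by move=> av [mu hmu hnu]; exists (haar_int mu); exact: (haar_fun_int av hmu hnu).
Qed.

(** * Local fields *)

Local Open Scope complex_scope.

Section Instances.
Variable R : realType.

Definition real_av (x : realTopField R) : R := `|(x : R)|.

Lemma absval_real : absval real_av.
Proof.
split.
- by move=> x; split; [exact: normr_ge0|split=> [/eqP|->]; rewrite /real_av ?normr0// normr_eq0 => /eqP].
- by move=> x y; exact: normrM.
- by move=> x y; exact: ler_normD.
- move=> x A; split.
    move=> /(@nbhs_ballP R R (x : R) A)[e /= e0 eA]; exists e => // y /= yx.
    by apply: eA; rewrite /ball/= distrC.
  move=> [e e0 eA]; apply/(@nbhs_ballP R R (x : R) A); exists e => //= y.
  by rewrite /ball/= => yx; apply: eA; rewrite /= /real_av distrC.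
- move=> r; rewrite (_ : mkset _ = `[(- r : R), r]%classic); first exact: segment_compact.
  by rewrite eqEsubset; split=> x; rewrite /= /real_av in_itv/= ler_norml.
Qed.

(** The norm on [R[i]] takes its values in [R[i]]; its real part is the usual modulus as a real
    number. *)
Definition complex_av (z : complexTopField R) : R := complex.Re `|(z : R[i])|.

Lemma complex_avE (z : complexTopField R) : (complex_av z)%:C = `|(z : R[i])|.
Proof. by rewrite /complex_av RRe_real// ger0_real. Qed.

Lemma complex_nbhs (x : complexTopField R) A :
  nbhs x A <-> exists2 e : R, 0 < e & [set y | complex_av (y - x) < e] `<=` A.
Proof.
split.
  move=> /(@nbhs_ballP _ (R[i] : numFieldType) x A)[e /= e0 eA].
  have eR : (complex.Re e)%:C = e by rewrite RRe_real// gtr0_real.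
  have e0' : 0 < complex.Re e by rewrite -ltcR eR.
  exists (complex.Re e) => // y /= yx; apply: eA.
  by rewrite /ball/= distrC -[`|_|]complex_avE -eR ltcR.
move=> [e e0 eA]; apply/(@nbhs_ballP _ (R[i] : numFieldType) x A); exists e%:C => /=.
  by rewrite ltcR.
move=> y; rewrite /ball/= distrC -[`|_|](complex_avE (y - x)) ltcR; exact: eA.
Qed.

Lemma complex_av_Re (z : complexTopField R) : `|complex.Re (z : R[i])| <= complex_av z.
Proof. by rewrite -lecR complex_avE; exact: normc_ge_Re. Qed.

Lemma complex_av_def (z : complexTopField R) :
  complex_av z = Num.sqrt (complex.Re (z : R[i]) ^+ 2 + complex.Im (z : R[i]) ^+ 2).
Proof. by rewrite /complex_av normc_def. Qed.

Lemma complex_av_Im (z : complexTopField R) : `|complex.Im (z : R[i])| <= complex_av z.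
Proof. by rewrite complex_av_def -sqrtr_sqr ler_wsqrtr// lerDr sqr_ge0. Qed.

Lemma complex_av_le (x y : R) : complex_av (x +i* y) <= `|x| + `|y|.
Proof.
rewrite complex_av_def/= -[leRHS]ger0_norm ?addr_ge0// -sqrtr_sqr ler_wsqrtr//.
rewrite -(real_normK (num_real x)) -(real_normK (num_real y)) sqrrD -addrA lerD2l lerDr.
by rewrite mulrn_wge0// mulr_ge0.
Qed.

Lemma complex_mk_continuous :
  continuous (fun z : R * R => z.1 +i* z.2 : complexTopField R).
Proof.
move=> [x y] A /complex_nbhs[e e0 eA].
have e2 : 0 < e / 2 by rewrite divr_gt0.
exists (ball x (e / 2), ball y (e / 2)).
  by split; exact: nbhsx_ballx.
move=> [x' y'] [/= xx yy]; apply: eA => /=.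
rewrite (_ : _ - _ = (x' - x) +i* (y' - y))//.
rewrite (le_lt_trans (complex_av_le _ _))// [ltRHS]splitr ltrD//.
  by rewrite distrC.
by rewrite distrC.
Qed.

Lemma complex_Re_continuous : continuous (fun z : complexTopField R => complex.Re (z : R[i])).
Proof.
move=> z A /(@nbhs_ballP R R)[e /= e0 eA]; apply/complex_nbhs; exists e => // y /= yz.
apply: eA; rewrite /ball/= distrC -raddfB; exact: le_lt_trans (complex_av_Re _) yz.
Qed.

Lemma complex_Im_continuous : continuous (fun z : complexTopField R => complex.Im (z : R[i])).
Proof.
move=> z A /(@nbhs_ballP R R)[e /= e0 eA]; apply/complex_nbhs; exists e => // y /= yz.
apply: eA; rewrite /ball/= distrC -raddfB; exact: le_lt_trans (complex_av_Im _) yz.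
Qed.

Lemma absval_complex : absval complex_av.
Proof.
split.
- move=> x; split; first by rewrite -lecR complex_avE normr_ge0.
  split=> [x0|->]; last by rewrite /complex_av normr0.
  by apply/eqP; rewrite -normr_eq0 -complex_avE x0.
- by move=> x y; apply/(@complexI R); rewrite rmorphM /= !complex_avE normrM.
- by move=> x y; rewrite -lecR rmorphD /= !complex_avE ler_normD.
- exact: complex_nbhs.
- move=> r.
  pose f (z : R * R) : complexTopField R := z.1 +i* z.2.
  have cf : continuous f by exact: complex_mk_continuous.
  have cK : compact (f @` (`[- r, r]%classic `*` `[- r, r]%classic)).
    apply: continuous_compact; first exact: continuous_subspaceT.
    by apply: compact_setX; exact: segment_compact.
  apply: subclosed_compact cK _.
    rewrite closedE => z hz; rewrite /= leNgt; apply/negP => rz; apply: hz.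
    apply/complex_nbhs; exists (complex_av z - r); first by rewrite subr_gt0.
    move=> y /= yz yr; move: yz; rewrite ltNge => /negP; apply.
    rewrite lerBlDr (le_trans _ (lerD (lexx _) yr))//.
    rewrite -lecR rmorphD/= !complex_avE distrC (le_trans _ (ler_normD _ _))//.
    by rewrite subrK.
  move=> z /= zr; exists (complex.Re (z : R[i]), complex.Im (z : R[i])); last first.
    by rewrite /f/=; case: (z).
  split; rewrite /= in_itv/= -ler_norml (le_trans _ zr)//.
    exact: complex_av_Re.
  exact: complex_av_Im.
Qed.

(** Local compactness provides one compact neighbourhood of 0, hence small compact balls;
    multiplication by a power of an element of absolute value greater than 1 carries a small ball
    onto any given one. *)
Lemma absval_nonarch (F : topFieldType) : nonarch_local_field R F ->
  exists2 a : F -> R, absval a & forall x y, a (x + y) <= Num.max (a x) (a y).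
Proof.
move=> [lc [a [[a0 a00 aM aU] [[c c0 c1] anb]]]]; exists a => //.
have aD x y : a (x + y) <= a x + a y.
  by rewrite (le_trans (aU x y))// ge_max lerDl a0 lerDr a0.
have a1 : a 1 = 1.
  have := aM 1 1; rewrite mulr1 => E; apply: (@mulfI _ (a 1)).
    by apply/eqP => /a00/eqP; rewrite oner_eq0.
  by rewrite -E mulr1.
have aV x : x != 0 -> a x^-1 = (a x)^-1.
  move=> x0; apply: (@mulfI _ (a x)); first by apply/eqP => /a00/eqP; exact/negP.
  rewrite -aM !mulfV//; apply/eqP => /a00/eqP; exact/negP.
have agt x : x != 0 -> 0 < a x.
  by move=> x0; rewrite lt_neqAle a0 andbT eq_sym; apply/eqP => /a00/eqP; exact/negP.
have [t t0 t1] : exists2 t : F, t != 0 & 1 < a t.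
  move: c1; rewrite neq_lt => /orP[c1|c1]; last by exists c.
  by exists c^-1; rewrite ?invr_eq0// aV// invf_gt1// agt.
(* Ultrametric closedness: if [a z] exceeds [r], a point of the ball cannot be within [a z] of [z]
   when [z] is nonzero. *)
have cl r : closed [set x : F | a x <= r].
  rewrite closedE => z hz; rewrite /= leNgt; apply/negP => rz; apply: hz.
  have [az|z0] := eqVneq z 0.
    apply/anb; exists 1 => // y _ /= yr; move: rz; rewrite az (_ : a 0 = 0).
      by rewrite ltNge => /negP; apply; exact: le_trans (a0 y) yr.
    exact/a00.
  apply/anb; exists (a z); first exact: agt.
  move=> y /= yz yr; have : a z <= Num.max (a y) (a (y - z)).
    rewrite -{1}[z](subKr y) (le_trans (aU _ _))// (_ : a (- (y - z)) = a (y - z))//.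
    have aN1 : a (-1) = 1.
      apply/eqP; rewrite -sqrp_eq1//; apply/eqP.
      by rewrite expr2 -aM mulrNN mulr1.
    by rewrite -mulN1r aM aN1 mul1r.
  by rewrite le_max => /orP[zy|]; [move: rz; rewrite ltNge (le_trans zy)|rewrite leNgt yz].
have [U [U0 cU]] : exists U : set F, nbhs (0 : F) U /\ compact U.
  have /= := lc 0 I; rewrite withinET => -[U U0 [cU _]]; exists U; split=> //.
have [e e0 eU] : exists2 e : R, 0 < e & [set y | a (y - 0) < e] `<=` U by move/(anb (0 : F) U): U0.
split=> //.
move=> r.
have [n nr] : exists n : nat, r < e * a t ^+ n.
  (* Bernoulli's inequality, to see that the powers of [a t] are unbounded. *)
  have B k : 1 + k%:R * (a t - 1) <= a t ^+ k.
    elim: k => [|k IH]; first by rewrite mul0r addr0 expr0.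
    have k0 : 0 <= k%:R :> R by rewrite ler0n.
    rewrite exprS -natr1; apply: (@le_trans _ _ (a t * (1 + k%:R * (a t - 1)))).
      by have := mulr_ge0 k0 (sqr_ge0 (a t - 1)); rewrite expr2; nra.
    by rewrite ler_wpM2l.
  have [k rk] : exists k : nat, r / e / (a t - 1) < k%:R.
    by exists (Num.bound `|r / e / (a t - 1)|); apply: le_lt_trans (ler_norm _) (archi_boundP (normr_ge0 _)).
  exists k; rewrite mulrC -ltr_pdivrMr//; apply: lt_le_trans (B k).
  by rewrite ltr_wpDl// -ltr_pdivrMr// subr_gt0.
pose f (x : F) := t ^+ n * x.
have aX k : a (t ^+ k) = a t ^+ k.
  by elim: k => [|k IH]; rewrite ?expr0// !exprS aM IH.
have tn0 : 0 < a t ^+ n by rewrite exprn_gt0// agt.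
have cf : continuous f.
  move=> x A /anb[d d0 dA]; apply/anb; exists (d / a t ^+ n); first by rewrite divr_gt0.
  move=> y /= yx; apply: dA; rewrite /= /f -mulrBr aM aX mulrC.
  by rewrite -ltr_pdivlMr.
have -> : [set x : F | a x <= r] = f @` [set x | a x <= r / a t ^+ n].
  rewrite eqEsubset; split=> [x /= xr|_ [x /= xr <-]].
    exists (x / t ^+ n); last by rewrite /f mulrCA mulfV ?mulr1// expf_neq0.
    by rewrite /= aM aV ?expf_neq0// aX ler_pdivrMr// divfK// gt_eqF.
  by rewrite /f /= aM aX mulrC -ler_pdivlMr.
apply: continuous_compact; first exact: continuous_subspaceT.
apply: (subclosed_compact (cl _) cU) => x /= xr; apply: eU => /=.
by rewrite subr0 (le_lt_trans xr)// ltr_pdivrMr.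
Qed.

End Instances.

(* Subtracting x phi(1) leaves an additive function of period 1, which is bounded
   and hence zero. *)
Lemma additive_linear (R : realType) (phi : R -> R) : continuous phi ->
  (forall x y, phi (x + y) = phi x + phi y) -> forall x, phi x = x * phi 1.
Proof.
move=> cphi phiD.
pose h x := phi x - x * phi 1.
have hD x y : h (x + y) = h x + h y by rewrite /h phiD; ring.
have h1 : h 1 = 0 by rewrite /h mul1r subrr.
have h0 : h 0 = 0 by apply: (addrI (h 0)); rewrite -hD !addr0.
have hN x : h (- x) = - h x by apply/eqP; rewrite -addr_eq0 -hD addNr h0.
have hn x (k : nat) : h (x *+ k) = h x *+ k.
  by elim: k => [|k IH]; rewrite ?mulr0n// !mulrS hD IH.
have hz (z : int) : h z%:~R = 0.
  have hk k : h k%:R = 0 by rewrite hn h1 mul0rn.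
  by case: z => k; rewrite ?NegzE ?mulrNz ?hN -?pmulrn hk ?oppr0.
have ch : continuous h.
  move=> x; apply: (@continuousB R R R phi (fun x => x * phi 1)); first exact: cphi.
  by apply: (@continuousM R R id (fun=> phi 1)); [exact: continuous_idf|exact: continuous_cstf].
have [c _ hc] : exists2 c, c \in `[0, 1]%R & forall t, t \in `[0, 1]%R -> `|h t| <= `|h c|.
  apply: (@EVT_max R (fun t => `|h t|) 0 1 ler01).
  apply: continuous_subspaceT => x; apply: (@continuous_comp _ _ _ h (fun y => `|y|)).
    exact: ch.
  exact: norm_continuous.
have hb x : `|h x| <= `|h c|.
  (* Periodicity reduces every argument to its fractional part, in the interval on which the maximum
     was taken. *)
  have -> : h x = h (x - (Num.floor x)%:~R) by rewrite hD hN hz oppr0 addr0.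
  apply: hc; rewrite in_itv/= subr_ge0 floor_le_tmp/=.
  by rewrite lerBlDl ltW// -intrD1 floorD1_gt.
move=> x; apply/eqP; rewrite -subr_eq0 -/(h x); apply/eqP/normr0_eq0.
apply: contrapT => /eqP nh; have hx : 0 < `|h x| by rewrite lt_neqAle eq_sym nh normr_ge0.
(* By additivity a large multiple of [x] would violate the bound. *)
have := hb (x *+ (Num.bound (`|h c| / `|h x|))).
rewrite hn normrMn leNgt -mulr_natr mulrC => /negP; apply.
by rewrite -ltr_pdivrMr//; apply: archi_boundP; rewrite divr_ge0.
Qed.

(** * The modulus as a function of the absolute value *)

Section Modulus.
Variables (R : realType) (F : topFieldType) (a nu : F -> R).
Hypothesis av : absval a.
Variable IF : (F -> R) -> R.
Hypothesis hF : haar_fun nu IF.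

(** Dilation by [c] leaves [tent] unchanged, and its integral is not zero. *)
Lemma nu_av1 c : a c = 1 -> nu c = 1.
Proof.
move=> ac; have c0 : c != 0 by rewrite -(av_eq0 av) ac oner_eq0.
case: hF => _ _ /(_ _ c (csupp_tent av) c0)[nc E].
apply: invr_inj; rewrite invr1; apply: (@mulIf _ (IF (tent a))).
  by rewrite gt_eqF// (IF_tent_gt0 av hF).
rewrite -E mul1r; congr IF; apply/funext => t.
by rewrite /tent (avM av) ac mul1r.
Qed.

Lemma nu_av x y : x != 0 -> a x = a y -> nu x = nu y.
Proof.
move=> x0 axy; have y0 : y != 0 by rewrite -(av_eq0 av) -axy (av_eq0 av).
rewrite -[x](divfK y0) (nuM av hF)//; last by rewrite mulf_neq0// invr_eq0.
by rewrite (@nu_av1 (x / y)) ?mul1r// (avM av) (avV av) axy mulfV// (av_eq0 av).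
Qed.

(** [emb] is a multiplicative section of the absolute value over the positive reals. In the
    logarithmic coordinate [u], [ln (nu (emb (expR u)))] is continuous and additive, hence linear;
    its slope is [kappa]. Other elements reduce to these by [nu_av]. *)
Lemma nu_power (emb : R -> F) :
  (forall t, {for t, continuous emb}) -> {morph emb : x y / x * y} ->
  (forall t, 0 < t -> a (emb t) = t) ->
  exists kappa, forall x, x != 0 -> nu x = a x `^ kappa.
Proof.
move=> cemb embM aemb.
have embE x : emb (expR x) != 0.
  by rewrite -(av_eq0 av) aemb ?expR_gt0// gt_eqF// expR_gt0.
pose phi u := ln (nu (emb (expR u))).
have cphi : continuous phi.
  move=> u; apply: (@continuous_comp _ _ _ (fun u => nu (emb (expR u))) (@ln R)).
    apply: (@continuous_comp _ _ _ (fun u => emb (expR u)) nu).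
      apply: (@continuous_comp _ _ _ (@expR R) emb); first exact: continuous_expR.
      exact: cemb.
    exact: (nu_continuous av hF).
  by apply: continuous_ln; exact: (nu_gt0 hF).
have phiD x y : phi (x + y) = phi x + phi y.
  by rewrite /phi expRD embM (nuM av hF)// lnM// posrE; exact: (nu_gt0 hF).
exists (phi 1) => x x0.
have ax : 0 < a x by rewrite (av_gt0 av).
rewrite (@nu_av x (emb (a x))) ?aemb//.
have ex : expR (ln (a x)) = a x by rewrite lnK// posrE.
have nx : 0 < nu (emb (a x)) by rewrite -{1}ex; apply: (nu_gt0 hF); exact: embE.
by rewrite -{2}ex -expRM -(additive_linear cphi phiD) /phi ex lnK.
Qed.

End Modulus.

(** * Differentiation under the integral sign *)

Section Calculus.
Variables (R : realType) (V : normedModType R).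
Implicit Types (f g : V -> R) (p q u v : V) (t : R).

Lemma is_derive_cvg f p v l :
  h^-1 * (f (h *: v + p) - f p) @[h --> 0^'] --> l -> is_derive p v f l.
Proof.
move=> fl; apply: DeriveDef; first by apply/cvg_ex; exists l.
exact: cvg_lim fl.
Qed.

Lemma derive_cvg f p v : derivable f p v ->
  h^-1 * (f (h *: v + p) - f p) @[h --> 0^'] --> 'D_v f p.
Proof. by []. Qed.

Lemma is_derive_lineE f p v t l :
  is_derive t 1 (fun s : R => f (s *: v + p)) l <-> is_derive (t *: v + p) v f l.
Proof.
have E : (fun h : R => h^-1 *: (((fun s : R => f (s *: v + p)) \o shift t) (h *: 1) - f (t *: v + p)))
    = fun h => h^-1 *: ((f \o shift (t *: v + p)) (h *: v) - f (t *: v + p)).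
  by apply/funext => h /=; rewrite [h%:A]mulr1 scalerDl addrA.
have E1 : derivable (fun s : R => f (s *: v + p)) t (1 : R) = derivable f (t *: v + p) v.
  by rewrite /derivable E.
have E2 : 'D_1 (fun s : R => f (s *: v + p)) t = 'D_v f (t *: v + p) by rewrite /derive E.
split=> -[D E3]; apply: DeriveDef.
- exact: (eq_ind _ id D _ E1).
- exact: (etrans (esym E2) E3).
- exact: (eq_ind _ id D _ (esym E1)).
- exact: (etrans E2 E3).
Qed.

Lemma is_derive_line f p v t : derivable f (t *: v + p) v ->
  is_derive t 1 (fun s : R => f (s *: v + p)) ('D_v f (t *: v + p)).
Proof. by move=> df; apply/is_derive_lineE; exact: DeriveDef. Qed.

Lemma MVT_line f p v t :
  (forall s, `|s| <= `|t| -> derivable f (s *: v + p) v) ->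
  exists2 s, `|s| <= `|t| & f (t *: v + p) - f p = t * 'D_v f (s *: v + p).
Proof.
move=> df.
have cf (s0 s1 : R) : (forall s, s \in `[s0, s1] -> `|s| <= `|t|) ->
    {within `[s0, s1], continuous (fun s => f (s *: v + p))}.
  move=> h; apply: derivable_within_continuous => s /h/df /is_derive_line[].
  by [].
have [t0|t0] := leP 0 t.
  have h s : s \in `[0, t] -> `|s| <= `|t|.
    by rewrite in_itv/= => /andP[s0 st]; rewrite !ger0_norm.
  have [|c ct E] := MVT_segment t0 _ (cf _ _ h) (df := fun s => 'D_v f (s *: v + p)).
    by move=> s st; apply/is_derive_line/df/h; exact: subset_itv_oo_cc.
  exists c; first exact: h.
  by move: E; rewrite scale0r add0r subr0 mulrC.
have h s : s \in `[t, 0] -> `|s| <= `|t|.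
  by rewrite in_itv/= => /andP[s0 st]; rewrite !ler0_norm ?lerN2// ltW.
have [|c ct E] := MVT_segment (ltW t0) _ (cf _ _ h) (df := fun s => 'D_v f (s *: v + p)).
  by move=> s st; apply/is_derive_line/df/h; exact: subset_itv_oo_cc.
exists c; first exact: h.
by apply: oppr_inj; rewrite opprB -mulNr; move: E; rewrite scale0r add0r sub0r mulrC.
Qed.

Lemma continuous_line u v p : continuous (fun z : R * R => z.1 *: v + (z.2 *: u + p)).
Proof.
move=> z; apply: cvgD; first by apply: cvgZr_tmp; exact: cvg_fst.
by apply: cvgD; [apply: cvgZr_tmp; exact: cvg_snd|exact: cvg_cst].
Qed.

(** Directional derivatives are additive in the direction once the one along [v] exists nearby and
    is continuous at [p]. The increment is split at [h *: u + p]: the mean value theorem treats the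
    piece along [v], the definition the piece along [u]. *)
Lemma is_deriveD_dir f p u v c l :
  (\forall q \near p, derivable f q v) -> {for p, continuous ('D_v f)} ->
  is_derive p u f l ->
  is_derive p (c *: v + u) f (c * 'D_v f p + l).
Proof.
move=> dv cv [du <-]; apply: is_derive_cvg.
have line0 : (0 : R) *: v + ((0 : R) *: u + p) = p by rewrite !scale0r !add0r.
rewrite [X in X @ _ --> _](_ : _ = fun h => h^-1 * (f ((h * c) *: v + (h *: u + p)) - f (h *: u + p)) +
   h^-1 * (f (h *: u + p) - f p)); last first.
  by apply/funext => h; rewrite -mulrDr addrA subrK scalerDr scalerA addrA.
apply: cvgD; last exact: derive_cvg.
apply/cvgrPdist_le => e e0.
have c1 : 0 < `|c| + 1 by rewrite ltr_wpDl.
have e' : 0 < e / (`|c| + 1) by rewrite divr_gt0.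
have : \forall q \near p, derivable f q v /\ `|'D_v f p - 'D_v f q| <= e / (`|c| + 1).
  by move/cvgrPdist_le: cv => /(_ _ e') cv; near=> q; split; near: q.
rewrite -{1}line0 => /(continuous_line (x := (0, 0)))[[A B] /= [A0 B0] AB].
have [d /= d0 dA] : exists2 d : R, 0 < d & forall x, `|x| < d -> A x /\ B x.
  have /(@nbhs_ballP R R)[d /= d0 dAB] : nbhs (0 : R) (A `&` B) by exact: filterI.
  by exists d => // x xd; apply: dAB; rewrite /ball/= sub0r normrN.
have dc : 0 < d / (`|c| + 1) by rewrite divr_gt0.
exists (d / (`|c| + 1)) => //= h; rewrite ?/ball_ ?/ball /= ?sub0r normrN => hd h0.
have hd1 : `|h * c| < d.
  rewrite normrM; apply: le_lt_trans (_ : `|h| * (`|c| + 1) < d); first by rewrite ler_wpM2l// lerDl.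
  by rewrite -ltr_pdivlMr.
have hd2 : `|h| < d.
  by apply: lt_le_trans hd _; rewrite ler_pdivrMr// ler_peMr ?(ltW d0)// lerDr.
have good s : `|s| <= `|h * c| -> derivable f (s *: v + (h *: u + p)) v /\
    `|'D_v f p - 'D_v f (s *: v + (h *: u + p))| <= e / (`|c| + 1).
  move=> sh; apply: (AB (s, h)); split=> /=.
    by have [] := dA s (le_lt_trans sh hd1).
  by have [] := dA h hd2.
have [s sh ->] := @MVT_line f (h *: u + p) v (h * c) (fun s sh => (good s sh).1).
rewrite -mulrA mulKf// -mulrBr normrM.
apply: (@le_trans _ _ ((`|c| + 1) * (e / (`|c| + 1)))).
  by apply: ler_pM => //; [rewrite lerDl|exact: (good s sh).2].
by rewrite mulrC divfK// gt_eqF.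
Unshelve. all: by end_near. Qed.

(** Stated with directional derivatives only, to match [smooth_on]; linearity in the direction is
    then obtained from [is_deriveD_dir], without a total derivative. *)
Definition C1_on (U : set V) f := forall x, U x ->
  {for x, continuous f} /\
  forall v, derivable f x v /\ {for x, continuous ('D_v f)}.

Lemma is_derive_comb (U : set V) f p (I : Type) (s : seq I) (c : I -> R) (v : I -> V) :
  open U -> C1_on U f -> U p ->
  is_derive p (\sum_(i <- s) c i *: v i) f (\sum_(i <- s) c i * 'D_(v i) f p).
Proof.
move=> oU Cf Up; elim: s => [|i s IH]; first by rewrite !big_nil; exact: is_derive0.
rewrite !big_cons; apply: (is_deriveD_dir (c i) _ _ IH).
  by apply: filterS (open_nbhs_nbhs (conj oU Up)) => q Uq; exact: ((Cf q Uq).2 _).1.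
exact: ((Cf p Up).2 _).2.
Qed.

Lemma smooth_C1 (U : set V) f w : smooth_on U f -> C1_on U (iter_derive w f).
Proof.
move=> sf x Ux; split; first exact: (sf w x Ux).1.
by move=> v; split; [exact: (sf w x Ux).2|exact: (sf (v :: w) x Ux).1].
Qed.

End Calculus.

(** * Averages over a compact family of linear maps *)

Section Transform.
Variables (R : realType) (V : normedModType R) (U : set V) (oU : open U).
Variables (Y : topologicalType) (hY : hausdorff_space Y) (bY : has_bumps R Y).
Variables (J : (Y -> R) -> R) (rJ : radon setT J).
Variables (S : set Y) (K : set Y) (cK : compact K) (KS : K `<=` S).
Variables (I : finType) (c : I -> Y -> R) (E : I -> V -> V).
Hypothesis c_continuous : forall i, continuous (c i).
Hypothesis E_continuous : forall i, continuous (E i).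
Hypothesis E_line : forall i h v x, E i (h *: v + x) = h *: E i v + E i x.

(* The action of y is a finite combination of fixed linear maps, so that a
   derivative of an average is a sum of averages, with weights c i y * w y, of
   derivatives. *)
Definition lact (y : Y) (x : V) : V := \sum_i c i y *: E i x.
Hypothesis lactU : forall y x, S y -> U x -> U (lact y x).

(** The compact set [K] is fixed, so that the weights [c i y * w y] arising from repeated
    derivatives all share one support. *)
Definition weight (w : Y -> R) : Prop :=
  (forall y, S y -> {for y, continuous w}) /\ (forall y, ~ K y -> w y = 0).

Definition trans (w : Y -> R) (h : V -> R) (x : V) : R := J (fun y => h (lact y x) * w y).

Lemma weightM i w : weight w -> weight (fun y => c i y * w y).
Proof.
move=> [cw w0]; split=> y; last by move=> /w0 ->; rewrite mulr0.
by move=> Sy; apply: continuousM; [exact: c_continuous|exact: cw].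
Qed.

Lemma weight_csupp w (h : Y -> R) : weight w -> (forall y, S y -> {for y, continuous h}) ->
  csupp_on setT (fun y => h y * w y).
Proof.
move=> [cw w0] ch; apply: (csuppT (U := S) hY); split.
  by move=> y Sy; apply: continuousM; [exact: ch|exact: cw].
by exists K; split=> // y /w0 ->; rewrite mulr0.
Qed.

Lemma lact_continuous : continuous (fun z : V * Y => lact z.2 z.1).
Proof.
move=> z; rewrite /lact; elim: (index_enum I) => [|i s IH].
  by apply: eq_continuous => [y|]; [by rewrite big_nil|exact: cvg_cst].
apply: eq_continuous => [y|]; first by rewrite big_cons.
apply: cvgD; last exact: IH.
apply: cvgZ.
  apply: (@continuous_comp _ _ _ (fun z : V * Y => z.2) (c i)); first exact: cvg_snd.
  exact: c_continuous.
apply: (@continuous_comp _ _ _ (fun z : V * Y => z.1) (E i)); first exact: cvg_fst.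
exact: E_continuous.
Qed.

Lemma lact_continuous2 (T : topologicalType) (f : T -> V) (g : T -> Y) t :
  {for t, continuous f} -> {for t, continuous g} ->
  {for t, continuous (fun t => lact (g t) (f t))}.
Proof.
move=> cf cg.
apply: (@continuous_comp _ _ _ (fun t => (f t, g t)) (fun z : V * Y => lact z.2 z.1)).
  exact: continuous_pair.
exact: lact_continuous.
Qed.

Lemma lact_line y h v x : lact y (h *: v + x) = h *: lact y v + lact y x.
Proof.
rewrite /lact scaler_sumr -big_split/=; apply: eq_bigr => i _.
by rewrite E_line scalerDr !scalerA mulrC.
Qed.

Definition C0_on (h : V -> R) := forall x, U x -> {for x, continuous h}.

Lemma trans_csupp w h x : weight w -> C0_on h -> U x ->
  csupp_on setT (fun y => h (lact y x) * w y).
Proof.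
move=> ww ch Ux; apply: (weight_csupp ww) => y Sy.
apply: (@continuous_comp _ _ _ (fun y => lact y x) h).
  by apply: (@lact_continuous2 _ (fun=> x) id); [exact: continuous_cstf|exact: continuous_idf].
exact/ch/lactU.
Qed.

Lemma trans_continuous_at w h (T : topologicalType) (f : T -> V) t y :
  weight w -> C0_on h -> {for t, continuous f} -> U (f t) -> S y ->
  {for (t, y), continuous (fun z : T * Y => h (lact z.2 (f z.1)) * w z.2)}.
Proof.
move=> ww ch cf Uf Sy; apply: continuousM.
  apply: (@continuous_comp _ _ _ (fun z : T * Y => lact z.2 (f z.1)) h); last exact/ch/lactU.
  apply: (@lact_continuous2 _ (fun z : T * Y => f z.1) snd); last exact: cvg_snd.
  by apply: (@continuous_comp _ _ _ fst f); [exact: cvg_fst|exact: cf].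
by apply: (@continuous_comp _ _ _ snd w); [exact: cvg_snd|exact: ww.1].
Qed.

Lemma trans_continuous w h : weight w -> C0_on h -> C0_on (trans w h).
Proof.
move=> ww ch x Ux.
have nU := open_nbhs_nbhs (conj oU Ux).
apply: (@radon_continuous _ _ _ (fun x y => h (lact y x) * w y) x J K) => //.
- by apply: filterS nU => x' Ux'; exact: trans_csupp.
- by near=> x' => y /ww.2 ->; rewrite mulr0.
- move=> y Ky; apply: (@trans_continuous_at w h V id x y ww ch _ Ux (KS Ky)).
  exact: continuous_idf.
Unshelve. all: by end_near. Qed.

(** Differentiation under the integral: the difference quotients have a common compact support and
    converge uniformly there, by the mean value theorem and the uniform continuity of the derivative
    along [K]. *)
Lemma trans_is_derive w h x v : weight w -> C1_on U h -> U x ->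
  is_derive x v (trans w h) (\sum_i trans (fun y => c i y * w y) ('D_(E i v) h) x).
Proof.
move=> ww Ch Ux.
have C0h : C0_on h by move=> p Up; exact: (Ch p Up).1.
have C0D u : C0_on ('D_u h) by move=> p Up; exact: ((Ch p Up).2 u).2.
(* The integrand of the expected derivative at [s *: v + x]; at [s = 0] its integral is the claimed
   value. *)
pose psi (s : R) y := \sum_i ('D_(E i v) h (lact y (s *: v + x)) * (c i y * w y)).
have cline t0 : {for t0, continuous (fun s : R => s *: v + x)}.
  by apply: cvgD; [apply: cvgZr_tmp; exact: cvg_id|exact: cvg_cst].
have line0 : (0 : R) *: v + x = x by rewrite scale0r add0r.
have Uline : \forall s \near (0 : R), U (s *: v + x).
  by apply: (cline 0); rewrite line0; exact: open_nbhs_nbhs.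
have [d /= d0 dU] : exists2 d : R, 0 < d & forall s, `|s| < d -> U (s *: v + x).
  have /(@nbhs_ballP R R)[d /= d0 dAB] := Uline.
  by exists d => // s sd; apply: dAB; rewrite /ball/= sub0r normrN.
have psiE s y : U (s *: v + x) -> S y ->
    is_derive (lact y (s *: v + x)) (lact y v) h
      (\sum_i c i y * 'D_(E i v) h (lact y (s *: v + x))).
  by move=> Us Sy; apply: (is_derive_comb _ _ _ oU Ch); exact: lactU.
have psiw s y : U (s *: v + x) -> S y ->
    psi s y = 'D_(lact y v) h (lact y (s *: v + x)) * w y.
  move=> Us Sy; rewrite (@derive_val _ _ _ _ _ _ _ (psiE s y Us Sy)) mulr_suml.
  by apply: eq_bigr => i _; ring.
apply: is_derive_cvg.
have -> : \sum_i trans (fun y => c i y * w y) ('D_(E i v) h) x = J (psi 0).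
  rewrite /psi line0 (radon_sum rJ)// => i.
  by exact: (trans_csupp (weightM i ww) (C0D _) Ux).
pose q (s : R) y := s^-1 * (h (lact y (s *: v + x)) * w y - h (lact y x) * w y).
apply: (@cvg_trans _ (J (q s) @[s --> 0^'])).
  apply: near_eq_cvg; exists d => // s; rewrite /ball_ /= sub0r normrN => sd _.
  have Us := dU _ sd.
  rewrite /q (radonZ rJ); last by apply: csuppB; exact: trans_csupp.
  by rewrite (radonB rJ)//; exact: trans_csupp.
have cpsi s : U (s *: v + x) -> csupp_on setT (psi s).
  move=> Us; apply: csupp_sum => i; exact: (trans_csupp (weightM i ww) (C0D _) Us).
apply: (@radon_cvg _ _ bY _ _ q (psi 0) J K) => //.
- by apply: cpsi; rewrite line0.
- by move=> y nK; rewrite /psi big1// => i _; rewrite ww.2// !mulr0.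
- exists d => // s; rewrite /ball_ /= sub0r normrN => sd _.
  by apply/csuppZ/csuppB; apply: trans_csupp => //; exact: dU.
- near=> s => y nK; by rewrite /q !ww.2// !mulr0 subrr mulr0.
move=> e e0.
have pc y : K y -> {for (0, y), continuous (fun z : R * Y => psi z.1 z.2)}.
  move=> Ky; apply: continuous_sumR => i.
  apply: (@trans_continuous_at (fun y => c i y * w y) _ R (fun s => s *: v + x) 0 y (weightM i ww) (C0D _) (cline 0)) => //.
  - by rewrite line0.
  - exact: KS.
have /(@nbhs_ballP R R)[d' /= d'0 dp] := near_uniform cK pc e0.
exists (Num.min d d'); first by rewrite /= lt_min d0 d'0.
move=> s; rewrite /ball_ /= sub0r normrN lt_min => /andP[sd sd'] s0 y Ky.
have Sy := KS Ky.
(* The action is linear, so moving [x] along [v] moves [lact y x] along [lact y v]; the quotient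
   becomes [psi t y] for some intermediate [t]. *)
have [t|t ts Et] := @MVT_line _ _ h (lact y x) (lact y v) s.
  move=> ts; rewrite -lact_line; apply: ((Ch _ _).2 _).1; apply: lactU => //.
  by apply: dU; exact: le_lt_trans sd.
rewrite /q -mulrBl lact_line Et mulrA mulKf// -lact_line -psiw//; last first.
  by apply: dU; exact: le_lt_trans sd.
apply: dp => //; rewrite /ball/= sub0r normrN; exact: le_lt_trans sd'.
Unshelve. all: by end_near. Qed.

Lemma is_derive_bigsum (L : Type) (s : seq L) (f : L -> V -> R) (df : L -> R) x v :
  (forall k, is_derive x v (f k) (df k)) ->
  is_derive x v (fun x => \sum_(k <- s) f k x) (\sum_(k <- s) df k).
Proof.
move=> fd; elim: s => [|k s IH].
  rewrite big_nil (_ : (fun _ => _) = cst 0); first exact: is_derive_cst.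
  by apply/funext => y; rewrite big_nil.
rewrite big_cons (_ : (fun _ => _) = f k + fun x => \sum_(k <- s) f k x).
  exact: is_deriveD.
by apply/funext => y; rewrite big_cons.
Qed.

(** The weights and directions do not depend on [h]: this order of quantifiers makes the estimates
    of [trans_seminorm] uniform. *)
Lemma iter_trans u w : weight w ->
  exists (L : finType) (ws : L -> Y -> R) (us : L -> seq V),
    (forall k, weight (ws k)) /\
    forall h, smooth_on U h -> forall x, U x ->
      iter_derive u (trans w h) x = \sum_k trans (ws k) (iter_derive (us k) h) x.
Proof.
move=> ww; elim: u => [|v u [L [ws [us [wws IH]]]]].
  exists unit, (fun=> w), (fun=> [::]); split=> // h sh x Ux.
  by rewrite (big_pred1 tt) // => -[].
exists (L * I)%type, (fun k y => c k.2 y * ws k.1 y), (fun k => E k.2 v :: us k.1).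
split=> [k|h sh x Ux]; first exact: weightM.
rewrite [LHS]/= (@near_eq_derive _ _ _ _
    (fun x => \sum_k trans (ws k) (iter_derive (us k) h) x)).
  have D : is_derive x v (fun x => \sum_k trans (ws k) (iter_derive (us k) h) x)
      (\sum_k \sum_i trans (fun y => c i y * ws k y) ('D_(E i v) (iter_derive (us k) h)) x).
    by apply: is_derive_bigsum => k; apply: trans_is_derive => //; exact: smooth_C1.
  rewrite (@derive_val _ _ _ _ _ _ _ D) pair_bigA/=.
  by apply: eq_bigr => -[].
by apply: filterS (open_nbhs_nbhs (conj oU Ux)) => y; exact: IH.
Qed.

Lemma trans_smooth w h : weight w -> smooth_on U h -> smooth_on U (trans w h).
Proof.
move=> ww sh u x Ux; have [L [ws [us [wws D]]]] := iter_trans u ww.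
have nD : \forall x' \near x, iter_derive u (trans w h) x' =
    \sum_k trans (ws k) (iter_derive (us k) h) x'.
  by apply: filterS (open_nbhs_nbhs (conj oU Ux)) => y; exact: D.
split.
  apply: (near_continuous nD); apply: continuous_sumR => k.
  by apply: trans_continuous => // p Up; exact: (sh _ _ _).1.
move=> v; apply: (@near_eq_derivable _ _ _
  (fun x' => \sum_k trans (ws k) (iter_derive (us k) h) x')).
  by near=> y; apply/esym; near: y.
have [] : is_derive x v (fun x => \sum_k trans (ws k) (iter_derive (us k) h) x)
      (\sum_k \sum_i trans (fun y => c i y * ws k y) ('D_(E i v) (iter_derive (us k) h)) x).
  by apply: is_derive_bigsum => k; apply: trans_is_derive => //; exact: smooth_C1.
by [].
Unshelve. all: by end_near. Qed.

Lemma trans_bound w : weight w -> exists2 C, 0 <= C & forall f g x e, C0_on f -> C0_on g ->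
  U x -> (forall y, K y -> `|f (lact y x) - g (lact y x)| <= e) ->
  `|trans w f x - trans w g x| <= C * e.
Proof.
move=> ww; have cw : csupp_on setT (fun y => `|w y|).
  rewrite (_ : (fun y => _) = fun y => 1 * `|w y|); last by apply/funext => y; rewrite mul1r.
  apply: weight_csupp; last by move=> y _; exact: continuous_cstf.
  split=> [y Sy|y nK]; last by rewrite ww.2// normr0.
  by apply: (@continuous_comp _ _ _ w (fun z => `|z|)); [exact: ww.1|exact: norm_continuous].
exists (J (fun y => `|w y|)); first by apply: (radon_ge0 rJ).
move=> f g x e cf cg Ux fg; rewrite mulrC -(radonZ rJ)// -(radonB rJ); first last.
- exact: trans_csupp.
- exact: trans_csupp.
apply: (radon_norm_le rJ); first by apply: csuppB; exact: trans_csupp.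
  exact: csuppZ.
move=> y; rewrite -mulrBl normrM; have [Ky|nK] := pselect (K y).
  by apply: ler_wpM2r => //; exact: fg.
by rewrite ww.2// normr0 !mulr0.
Qed.

(** [K'] is the set swept from [Kx] by the parameters in [K], [s'] collects the words of directions
    given by [iter_trans], and [C] sums the bounds of all the averages involved. *)
Lemma trans_seminorm w Kx (s : seq (seq V)) : weight w -> compact Kx -> Kx `<=` U ->
  exists K', [/\ compact K', K' `<=` U & exists (s' : seq (seq V)) (C : R), 0 <= C /\
    forall f g e, 0 <= e -> smooth_on U f -> smooth_on U g ->
      (forall u x, u \in s' -> K' x -> `|iter_derive u f x - iter_derive u g x| <= e) ->
      forall u x, u \in s -> Kx x ->
        `|iter_derive u (trans w f) x - iter_derive u (trans w g) x| <= C * e].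
Proof.
move=> ww cKx KxU.
pose K' := (fun z : V * Y => lact z.2 z.1) @` (Kx `*` K).
exists K'; split.
- apply: continuous_compact; last exact: compact_setX.
  by apply: continuous_subspaceT => z; exact: lact_continuous.
- by move=> _ [[x y] [/= Kxx Ky] <-]; apply: lactU; [exact: KS|exact: KxU].
elim: s => [|u s [s' [C [C0 IH]]]]; first by exists [::], 0.
have [L [ws [us [wws D]]]] := iter_trans u ww.
have /choice[D' hD'] : forall k, exists C, 0 <= C /\ forall f g x e, C0_on f -> C0_on g ->
    U x -> (forall y, K y -> `|f (lact y x) - g (lact y x)| <= e) ->
    `|trans (ws k) f x - trans (ws k) g x| <= C * e.
  by move=> k; have [C1 C10 h] := trans_bound (wws k); exists C1.
have S0 : 0 <= \sum_k D' k by apply: sumr_ge0 => k _; exact: (hD' k).1.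
exists ([seq us k | k <- index_enum L] ++ s'), (\sum_k D' k + C); split; first exact: addr_ge0.
move=> f g e e0 sf sg fg u' x; rewrite in_cons => /orP[/eqP ->|u's] Kxx.
  have Ux := KxU _ Kxx.
  rewrite !D// -sumrB (le_trans (ler_norm_sum _ _ _))//.
  rewrite (@le_trans _ _ ((\sum_k D' k) * e))//; last by rewrite ler_wpM2r// lerDl.
  rewrite mulr_suml; apply: ler_sum => k _; apply: (hD' k).2 => //.
  - by move=> p Up; exact: (sf _ _ _).1.
  - by move=> p Up; exact: (sg _ _ _).1.
  move=> y Ky; apply: fg; last by exists (x, y).
  by rewrite mem_cat map_f// mem_index_enum.
apply: (@le_trans _ _ (C * e)); last by rewrite ler_wpM2r// lerDr.
by apply: IH => // u0 x0 u0s; apply: fg; rewrite mem_cat u0s orbT.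
Qed.

End Transform.

(** * Extension to complex-valued functions through real and imaginary parts *)

Section ComplexTransform.
Variables (R : realType) (V : normedModType R) (U : set V) (oU : open U).
Variable T : (V -> R) -> V -> R.
Hypothesis T_smooth : forall h, smooth_on U h -> smooth_on U (T h).
Hypothesis T_seminorm : forall (Kx : set V) (s : seq (seq V)), compact Kx -> Kx `<=` U ->
  exists K', [/\ compact K', K' `<=` U & exists (s' : seq (seq V)) (C : R), 0 <= C /\
    forall f g e, 0 <= e -> smooth_on U f -> smooth_on U g ->
      (forall u x, u \in s' -> K' x -> `|iter_derive u f x - iter_derive u g x| <= e) ->
      forall u x, u \in s -> Kx x ->
        `|iter_derive u (T f) x - iter_derive u (T g) x| <= C * e].

Definition reim (f : V -> R[i]) (x : V) : R[i] :=
  T (fun y => complex.Re (f y)) x +i* T (fun y => complex.Im (f y)) x.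

Lemma reim_smooth f : csmooth_on U f -> csmooth_on U (reim f).
Proof. by move=> [rf jf]; split; apply: T_smooth. Qed.

Lemma lt_normc_Re (z : R[i]) e : `|z| < e%:C -> `|complex.Re z| <= e.
Proof. by move=> ze; rewrite -lecR; apply: le_trans (normc_ge_Re z) (ltW ze). Qed.

Lemma lt_normc_Im (z : R[i]) e : `|z| < e%:C -> `|complex.Im z| <= e.
Proof.
rewrite normc_def ltcR => /ltW ze; apply: le_trans ze.
by rewrite -sqrtr_sqr ler_wsqrtr// lerDr sqr_ge0.
Qed.

Lemma normc_lt (x y e : R) : `|x| + `|y| < e -> `|x +i* y| < e%:C.
Proof.
move=> h; rewrite normc_def ltcR/=; apply: le_lt_trans h.
rewrite -[leRHS]ger0_norm ?addr_ge0// -sqrtr_sqr ler_wsqrtr//.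
rewrite -(real_normK (num_real x)) -(real_normK (num_real y)) sqrrD -addrA lerD2l lerDr.
by rewrite mulrn_wge0// mulr_ge0.
Qed.

Lemma reim_continuous f A : csmooth_on U f -> smooth_nbhs U (reim f) A ->
  smooth_nbhs U f [set g | csmooth_on U g -> A (reim g)].
Proof.
move=> sf [Kx [s [e [cKx KxU e0 sA]]]].
have [K' [cK' K'U [s' [C [C0 h]]]]] := T_seminorm s cKx KxU.
(* Real and imaginary parts each cost [C]; the extra 1 keeps the divisor positive and the final
   inequality strict. *)
have C1 : 0 < 2 * C + 1 by rewrite ltr_wpDl// mulr_ge0.
have e'0 : 0 < e / (2 * C + 1) by rewrite divr_gt0.
exists K', s', (e / (2 * C + 1)); split=> // g hg sg; apply: sA => u x us Kxx.
have hR : `|iter_derive u (T (fun y => complex.Re (g y))) x -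
    iter_derive u (T (fun y => complex.Re (f y))) x| <= C * (e / (2 * C + 1)).
  apply: h us Kxx; [exact: ltW|exact: sg.1|exact: sf.1|].
  by move=> u' x' us' Kx'; have /lt_normc_Re := hg u' x' us' Kx'.
have hI : `|iter_derive u (T (fun y => complex.Im (g y))) x -
    iter_derive u (T (fun y => complex.Im (f y))) x| <= C * (e / (2 * C + 1)).
  apply: h us Kxx; [exact: ltW|exact: sg.2|exact: sf.2|].
  by move=> u' x' us' Kx'; have /lt_normc_Im := hg u' x' us' Kx'.
apply: normc_lt; apply: le_lt_trans (lerD hR hI) _.
rewrite -mulrDr -[ltRHS](divfK (x := 2 * C + 1)) ?gt_eqF//.
rewrite [ltRHS]mulrC -subr_gt0 (_ : _ - _ = e / (2 * C + 1))//; ring.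
Qed.

End ComplexTransform.

(** * Smoothness of the averages *)

Section Affine.
Variables (F : topFieldType) (b n : nat).

(** In this form, left multiplication by [iota y] is a combination of fixed linear maps with
    coefficients 1 and the entries of [y], as the differentiation of averages requires. *)
Definition affine_embedding (iota : 'M[F]_b -> 'M[F]_n) :=
  exists (N0 : 'M[F]_n) (A : 'M[F]_(n, b)) (B : 'M[F]_(b, n)),
    forall y, iota y = N0 + A *m y *m B.

Lemma affine_sum (N0 : 'M[F]_n) (A : 'M[F]_(n, b)) (B : 'M[F]_(b, n)) y :
  N0 + A *m y *m B = N0 + \sum_(k : 'I_b * 'I_b) y k.1 k.2 *: (A *m delta_mx k.1 k.2 *m B).
Proof.
congr (_ + _); rewrite {1}[y]matrix_sum_delta pair_bigA/= mulmx_sumr mulmx_suml.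
by apply: eq_bigr => k _; rewrite -scalemxAr -scalemxAl.
Qed.

End Affine.

Section Average.
Variables (R : realType) (F : topFieldType) (a nu : F -> R).
Hypothesis av : absval a.
Variable IF : (F -> R) -> R.
Hypothesis hF : haar_fun nu IF.
Variables (b n : nat) (iota : 'M[F]_b -> 'M[F]_n).

Definition avgC (w : 'M[F]_b -> R) (f : 'M[F]_n -> R[i]) (x : 'M[F]_n) : R[i] :=
  avg nu IF iota w (fun z => complex.Re (f z)) x +i* avg nu IF iota w (fun z => complex.Im (f z)) x.

Hypothesis iota_continuous : continuous iota.
Hypothesis iota_unit : forall y, (iota y \in unitmx) = (y \in unitmx).

Lemma weight_wL w : csupp_on (@GLset F b) w -> exists K, [/\ compact K, K `<=` @GLset F b &
  weight (@GLset F b) K (fun y => w y * wL nu y)].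
Proof.
move=> [cw [K [cK KG Kw]]]; exists K; split=> //; split=> y.
  by move=> uy; apply: continuousM; [exact: cw|exact: (wL_continuous av hF)].
by move=> /Kw ->; rewrite mul0r.
Qed.

Lemma avg_mat_int w g x : avg nu IF iota w g x =
  @mat_int R F IF b b (fun y => g (iota y *m x) * (w y * wL nu y)).
Proof. by congr mat_int; apply/funext => y; rewrite mulrA. Qed.

(** Local constancy at each [iota y *m x] becomes uniform in [y] by compactness of the support of
    [w], so the integrand is unchanged near [x]. *)
Lemma avg_locally_constant w (g : 'M[F]_n -> R) x : csupp_on (@GLset F b) w ->
  (forall x, x \in unitmx -> \forall y \near x, g y = g x) -> x \in unitmx ->
  \forall x' \near x, avg nu IF iota w g x' = avg nu IF iota w g x.
Proof.
move=> [cw [K [cK KG Kw]]] cg ux.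
have : \forall x' \near x, forall y, K y -> g (iota y *m x') = g (iota y *m x).
  have /compact_near_coveringP/(_ _ (nbhs x)) := cK.
  move=> /(_ (fun x' y => g (iota y *m x') = g (iota y *m x))); apply=> y Ky.
  have uyx : iota y *m x \in unitmx.
    by rewrite unitmx_mul iota_unit; apply/andP; split=> //; exact: KG.
  have cm : {for (y, x), continuous (fun z : 'M[F]_b * 'M[F]_n => iota z.1 *m z.2)}.
    apply: (continuousMmx av); last exact: cvg_snd.
    by apply: (@continuous_comp _ _ _ fst iota); [exact: cvg_fst|exact: iota_continuous].
  have [[P Q] /= [Py Qx] PQ] := cm _ (cg _ uyx).
  exists (P, Q) => //= -[y' x'] [/= Py' Qx'].
  rewrite (PQ (y', x'))// (PQ (y', x))//; split=> //; exact: nbhs_singleton Qx.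
apply: filterS => x' E; rewrite /avg; congr IL; apply/funext => y.
by have [/E ->//|/Kw ->] := pselect (K y); rewrite !mulr0.
Qed.

End Average.

Section RealCase.
Variables (R : realType) (nu : realTopField R -> R).
Let F := realTopField R.
Variable IF : (F -> R) -> R.
Hypothesis hF : haar_fun nu IF.
Variables (b n : nat) (iota : 'M[F]_b -> 'M[F]_n).
Hypothesis iota_affine : affine_embedding iota.
Hypothesis iota_unit : forall y, (iota y \in unitmx) = (y \in unitmx).

Let V := [the normedModType R of 'M[R]_n].

Lemma real_open : open (@real_GL R n : set V).
Proof.
rewrite openE => x ux.
have h : nbhs (x : 'M[F]_n) [set y : 'M[F]_n | y \in unitmx].
  exact: (open_nbhs_nbhs (conj (@open_unitmx R F _ (absval_real R) n) ux)).
exact h.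
Qed.

Let I := (unit + 'I_b * 'I_b)%type.
(** The coefficient 1 belongs to the constant term of the affine embedding, the entries to the
    elementary matrices. *)
Definition real_coef (k : I) (y : 'M[F]_b) : R := if k is inr ij then y ij.1 ij.2 else 1.

Lemma real_coef_continuous k : continuous (real_coef k).
Proof.
by case: k => [u|[i j]] y; [exact: (@continuous_cstf _ R 1 y)|exact: (@entry_continuous F b b i j y)].
Qed.

Lemma mulmxl_continuous (M : 'M[R]_n) : continuous (fun x : V => M *m x : V).
Proof.
move=> x; apply: (@continuousMmx _ _ _ (absval_real R) 'M[F]_n n n n (fun=> M) id).
  exact: continuous_cstf.
exact: continuous_idf.
Qed.

Lemma avgC_real w : csupp_on (@GLset F b) w ->
  (forall f, csmooth_on (@real_GL R n) f -> csmooth_on (@real_GL R n) (avgC nu IF iota w f)) /\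
  (forall f A, csmooth_on (@real_GL R n) f -> smooth_nbhs (@real_GL R n) (avgC nu IF iota w f) A ->
     smooth_nbhs (@real_GL R n) f [set g | csmooth_on (@real_GL R n) g -> A (avgC nu IF iota w g)]).
Proof.
move=> cw; have [K [cK KG wK]] := weight_wL (absval_real R) hF cw.
have [N0 [P [Q iotaE]]] := iota_affine.
pose E (k : I) (x : V) : V := (if k is inr ij then P *m delta_mx ij.1 ij.2 *m Q else N0) *m x.
have E_line k h v x : E k (h *: v + x) = h *: E k v + E k x.
  by rewrite /E mulmxDr scalemxAr.
have lactE y x : lact real_coef E y x = iota y *m x.
  rewrite /lact big_sumType/= (big_pred1 tt); last by case.
  rewrite scale1r iotaE affine_sum mulmxDl mulmx_suml; congr (_ + _).
  by apply: eq_bigr => ij _; rewrite -scalemxAl.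
have T_E : trans (@mat_int R F IF b b) real_coef E (fun y => w y * wL nu y) =
    avg nu IF iota w.
  apply/funext => g; apply/funext => x; rewrite avg_mat_int /trans; congr mat_int.
  by apply/funext => y; rewrite lactE.
have lactU y x : GLset y -> real_GL x -> real_GL (lact real_coef E y x).
  by move=> uy ux; rewrite lactE /real_GL/= unitmx_mul iota_unit; apply/andP.
have cE k : continuous (E k) by case: k => [u|ij]; exact: mulmxl_continuous.
have rJ := radon_mat (absval_real R) hF b b.
have bY := @has_bumps_mx R F _ (absval_real R) b b.
have hY := @hausdorff_mx R F _ (absval_real R) b b.
have S h := @trans_smooth R V _ real_open _ hY bY _ rJ _ K cK KG I _ E real_coef_continuous cE E_line lactU _ h wK.
have S2 Kx s := @trans_seminorm R V _ real_open _ hY bY _ rJ _ K cK KG I _ E real_coef_continuous cE E_line lactU _ Kx s wK.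
rewrite T_E in S S2.
split; first exact: (reim_smooth S).
exact: (reim_continuous S2).
Qed.

End RealCase.

Section ComplexCase.
Variables (R : realType) (nu : complexTopField R -> R).
Let F := complexTopField R.
Variable IF : (F -> R) -> R.
Hypothesis hF : haar_fun nu IF.
Variables (b n : nat) (iota : 'M[F]_b -> 'M[F]_n).
Hypothesis iota_affine : affine_embedding iota.
Hypothesis iota_unit : forall y, (iota y \in unitmx) = (y \in unitmx).

Let V := [the normedModType R of ('M[R]_n * 'M[R]_n)%type].

Definition real_mx (X : 'M[F]_n) : 'M[R]_n * 'M[R]_n :=
  (\matrix_(i, j) complex.Re (X i j : R[i]), \matrix_(i, j) complex.Im (X i j : R[i])).

Lemma real_mxK : cancel real_mx (@complex_mx R n).
Proof. by move=> X; apply/matrixP => i j; rewrite !mxE /=; case: (X i j). Qed.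

Lemma complex_mxK : cancel (@complex_mx R n) real_mx.
Proof. by move=> [x y]; congr pair; apply/matrixP => i j; rewrite !mxE. Qed.

Lemma complex_mx_continuous : continuous (fun p : V => complex_mx p : 'M[F]_n).
Proof.
move=> p; apply: continuous_mx => i j; apply: eq_continuous => [q|]; first by rewrite mxE.
apply: (@continuous_comp _ _ _ (fun q : V => (q.1 i j, q.2 i j))
  (fun z => z.1 +i* z.2 : complexTopField R)); last exact: complex_mk_continuous.
apply: continuous_pair.
  apply: (@continuous_comp _ _ _ (fun q : V => q.1) (fun x : 'M[R]_n => x i j)).
    exact: cvg_fst.
  exact: coord_continuous.
apply: (@continuous_comp _ _ _ (fun q : V => q.2) (fun x : 'M[R]_n => x i j)).
  exact: cvg_snd.
exact: coord_continuous.
Qed.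

Lemma real_mx_continuous : continuous (real_mx : 'M[F]_n -> V).
Proof.
move=> X; apply: continuous_pair.
  apply: (@continuous_mx R) => i j; apply: eq_continuous => [q|]; first by rewrite mxE.
  apply: (@continuous_comp _ _ _ (fun q : 'M[F]_n => q i j) (fun z : F => complex.Re (z : R[i]))).
    exact: entry_continuous.
  exact: complex_Re_continuous.
apply: (@continuous_mx R) => i j; apply: eq_continuous => [q|]; first by rewrite mxE.
apply: (@continuous_comp _ _ _ (fun q : 'M[F]_n => q i j) (fun z : F => complex.Im (z : R[i]))).
  exact: entry_continuous.
exact: complex_Im_continuous.
Qed.

Lemma complex_open : open (@complex_GL R n : set V).
Proof.
rewrite openE => p up.
have h : nbhs (complex_mx p : 'M[F]_n) [set y : 'M[F]_n | y \in unitmx].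
  exact: (open_nbhs_nbhs (conj (@open_unitmx R F _ (absval_complex R) n) up)).
exact: complex_mx_continuous h.
Qed.

Lemma complex_mx_line (h : R) (v x : V) :
  complex_mx (h *: v + x) = (h%:C *: (complex_mx v : 'M[R[i]]_n) + complex_mx x).
Proof. by apply/matrixP => i j; rewrite !mxE /=; apply/eqP; rewrite eq_complex/= !mul0r subr0 addr0 !eqxx. Qed.

Lemma real_mx_line (h : R) (X Y : 'M[R[i]]_n) :
  real_mx (h%:C *: X + Y) = h *: (real_mx X : V) + (real_mx Y : V).
Proof. by apply: (can_inj complex_mxK); rewrite complex_mx_line !real_mxK. Qed.

Let I := (unit + ('I_b * 'I_b + 'I_b * 'I_b))%type.
(** Coefficients must be real for the calculus on the underlying real space: each complex entry
    yields two of them, the imaginary part being paired with ['i] times the same matrix. *)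
Definition complex_coef (k : I) (y : 'M[F]_b) : R :=
  match k with
  | inl _ => 1
  | inr (inl ij) => complex.Re (y ij.1 ij.2 : R[i])
  | inr (inr ij) => complex.Im (y ij.1 ij.2 : R[i])
  end.

Lemma complex_coef_continuous k : continuous (complex_coef k).
Proof.
case: k => [u|[[i j]|[i j]]] y; first exact: (@continuous_cstf _ R 1 y).
  apply: (@continuous_comp _ _ _ (fun q : 'M[F]_b => q i j) (fun z : F => complex.Re (z : R[i]))).
    exact: entry_continuous.
  exact: complex_Re_continuous.
apply: (@continuous_comp _ _ _ (fun q : 'M[F]_b => q i j) (fun z : F => complex.Im (z : R[i]))).
  exact: entry_continuous.
exact: complex_Im_continuous.
Qed.

Lemma avgC_complex w : csupp_on (@GLset F b) w ->
  let cm := @complex_mx R n in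
  (forall f, csmooth_on (@complex_GL R n) (f \o cm) -> csmooth_on (@complex_GL R n) (avgC nu IF iota w f \o cm)) /\
  (forall f A, csmooth_on (@complex_GL R n) (f \o cm) -> smooth_nbhs (@complex_GL R n) (avgC nu IF iota w f \o cm) A ->
     exists2 B, smooth_nbhs (@complex_GL R n) (f \o cm) B &
     forall g, B (g \o cm) -> csmooth_on (@complex_GL R n) (g \o cm) -> A (avgC nu IF iota w g \o cm)).
Proof.
move=> cw cm; have [K [cK KG wK]] := weight_wL (absval_complex R) hF cw.
have [N0 [P [Q iotaE]]] := iota_affine.
pose M (k : I) : 'M[R[i]]_n :=
  match k with
  | inl _ => N0
  | inr (inl ij) => P *m delta_mx ij.1 ij.2 *m Q
  | inr (inr ij) => 'i *: (P *m delta_mx ij.1 ij.2 *m Q)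
  end.
pose E (k : I) (x : V) : V := real_mx (M k *m complex_mx x).
have E_line k h v x : E k (h *: v + x) = h *: E k v + E k x.
  by rewrite /E complex_mx_line mulmxDr -scalemxAr real_mx_line.
have real_mx_sum (s : seq I) (c : I -> R) (X : I -> 'M[R[i]]_n) :
    \sum_(k <- s) c k *: (real_mx (X k) : V) = real_mx (\sum_(k <- s) (c k)%:C *: X k).
  elim: s => [|k s IH]; last by rewrite !big_cons real_mx_line IH.
  by rewrite !big_nil; apply: (can_inj complex_mxK); rewrite real_mxK; apply/matrixP => i j; rewrite !mxE.
have lactE y x : lact complex_coef E y x = real_mx (iota y *m complex_mx x).
  rewrite /lact /E real_mx_sum; congr real_mx.
  rewrite big_sumType/= (big_pred1 tt); last by case.
  rewrite scale1r iotaE affine_sum mulmxDl mulmx_suml; congr (_ + _).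
  rewrite big_sumType/= -big_split/=; apply: eq_bigr => ij _.
  rewrite -!scalemxAl scalerA -scalerDl; congr (_ *: _).
  by rewrite [RHS]complexE mulrC.
have T_E g : trans (@mat_int R F IF b b) complex_coef E (fun y => w y * wL nu y) (g \o cm) =
    avg nu IF iota w g \o cm.
  apply/funext => x; rewrite /= avg_mat_int /trans; congr mat_int.
  by apply/funext => y; rewrite lactE /= /cm real_mxK.
have lactU y x : GLset y -> complex_GL x -> complex_GL (lact complex_coef E y x).
  by move=> uy ux; rewrite lactE /complex_GL/= real_mxK unitmx_mul iota_unit; apply/andP.
have cE k : continuous (E k).
  move=> x; apply: (@continuous_comp _ _ _ (fun x : V => M k *m complex_mx x : 'M[F]_n) real_mx).
    apply: (@continuousMmx _ _ _ (absval_complex R) V n n n (fun=> M k)).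
      exact: continuous_cstf.
    exact: complex_mx_continuous.
  exact: real_mx_continuous.
have rJ := radon_mat (absval_complex R) hF b b.
have bY := @has_bumps_mx R F _ (absval_complex R) b b.
have hY := @hausdorff_mx R F _ (absval_complex R) b b.
have S h := @trans_smooth R V _ complex_open _ hY bY _ rJ _ K cK KG I _ E complex_coef_continuous cE E_line lactU _ h wK.
have S2 Kx s := @trans_seminorm R V _ complex_open _ hY bY _ rJ _ K cK KG I _ E complex_coef_continuous cE E_line lactU _ Kx s wK.
have TE f : reim (trans (@mat_int R F IF b b) complex_coef E (fun y => w y * wL nu y)) (f \o cm) =
    avgC nu IF iota w f \o cm.
  apply/funext => x; rewrite /reim /avgC /=.
  congr (_ +i* _); first exact: (congr1 (fun h => h x) (T_E (fun z => complex.Re (f z)))).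
  exact: (congr1 (fun h => h x) (T_E (fun z => complex.Im (f z)))).
split=> [f sf|f A sf]; first by rewrite -TE; exact: (reim_smooth S).
rewrite -TE => /(reim_continuous S2 sf) h.
by exists [set g | csmooth_on (@complex_GL R n) g ->
  A (reim (trans (@mat_int R F IF b b) complex_coef E (fun y => w y * wL nu y)) g)] => // g Bg sg; rewrite -TE; exact: Bg.
Qed.

End ComplexCase.

Section LocalField.
Variable R : realType.

Lemma localField_absval (F : localField R) : exists a : F -> R, absval a.
Proof.
case: F => [||F nF].
- by exists (@real_av R); exact: absval_real.
- by exists (@complex_av R); exact: absval_complex.
- by have [a av _] := absval_nonarch nF; exists a.
Qed.

Lemma smooth_nbhsS (V : normedModType R) (U : set V) (f : V -> R[i]) A B :
  smooth_nbhs U f A -> A `<=` B -> smooth_nbhs U f B.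
Proof.
move=> [K [s [e [cK KU e0 h]]]] AB; exists K, s, e; split=> //.
exact: subset_trans AB.
Qed.

Lemma locally_constant_part (T : topologicalType) (f : T -> R[i]) (p : R[i] -> R) x :
  (\forall y \near x, f y = f x) -> \forall y \near x, p (f y) = p (f x).
Proof. by apply: filterS => y ->. Qed.

Lemma Cinfty_GLfun (F : localField R) n (f : 'M[F]_n -> R[i]) : Cinfty_GL f ->
  GLfun (fun x => complex.Re (f x)) /\ GLfun (fun x => complex.Im (f x)).
Proof.
move=> [f0 sf].
suff cf x : x \in unitmx -> {for x, continuous (fun x => complex.Re (f x))} /\
    {for x, continuous (fun x => complex.Im (f x))}.
  by split; split=> x ux; [exact: (cf x ux).1|rewrite f0|exact: (cf x ux).2|rewrite f0].
case: F f f0 sf x => [||F nF] f f0 sf x ux.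
(* The empty word of directions gives continuity of the function itself. *)
- by split; [exact: (sf.1 [::] x ux).1|exact: (sf.2 [::] x ux).1].
- have cr := @real_mx_continuous R n x.
  have uc : @complex_GL R n (real_mx x) by rewrite /complex_GL/= real_mxK.
  have cmp (p : R[i] -> R) :
      {for real_mx x, continuous (fun z : ('M[R]_n * 'M[R]_n)%type => p (f (complex_mx z)))} ->
      {for x, continuous (fun y => p (f y))}.
    move=> c1; rewrite (_ : (fun y => _) = fun y => p (f (complex_mx (real_mx y)))).
      exact: (@continuous_comp _ _ _ (@real_mx R n)
        (fun z : ('M[R]_n * 'M[R]_n)%type => p (f (complex_mx z))) x cr c1).
    by apply/funext => y; rewrite real_mxK.
  by split; apply: cmp; [exact: (sf.1 [::] _ uc).1|exact: (sf.2 [::] _ uc).1].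
- have ncst (p : R[i] -> R) : {for x, continuous (fun x => p (f x))}.
    apply: (near_continuous (g := fun=> p (f x))); last exact: continuous_cstf.
    exact: locally_constant_part (sf x ux).
  by split; exact: ncst.
Qed.

Lemma avgC_out (F : localField R) (nu : F -> R) (IF : (F -> R) -> R) (hF : haar_fun nu IF)
    b n (iota : 'M[F]_b -> 'M[F]_n) w f x :
  Cinfty_GL f -> x \notin unitmx -> avgC nu IF iota w f x = 0.
Proof.
have [a av] := localField_absval F.
move=> /Cinfty_GLfun[gR gI] nux.
by rewrite /avgC (avg_out av hF iota w gR nux) (avg_out av hF iota w gI nux).
Qed.

Lemma avgC_Cinfty (F : localField R) (nu : F -> R) (IF : (F -> R) -> R)
    (hF : haar_fun nu IF) b n (iota : 'M[F]_b -> 'M[F]_n) w f :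
  affine_embedding iota -> continuous iota ->
  (forall y, (iota y \in unitmx) = (y \in unitmx)) ->
  csupp_on (@GLset F b) w -> Cinfty_GL f -> Cinfty_GL (avgC nu IF iota w f).
Proof.
move=> ia ic iu cw Cf; split=> [x|]; first exact: avgC_out.
case: Cf => _.
case: F nu IF hF iota w f ia ic iu cw => [||F nF] nu IF hF iota w f ia ic iu cw sf.
- exact: (avgC_real hF ia iu cw).1.
- exact: (avgC_complex hF ia iu cw).1.
- have [a av _] := absval_nonarch nF.
  move=> x ux.
  have h (p : R[i] -> R) : \forall x' \near x,
      avg nu IF iota w (fun z => p (f z)) x' = avg nu IF iota w (fun z => p (f z)) x.
    have hp y : y \in unitmx -> \forall y' \near y, p (f y') = p (f y).
      by move=> uy; exact: locally_constant_part (sf y uy).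
    exact: (@avg_locally_constant R F a nu av IF b n iota ic iu w _ x cw hp ux).
  have hI := h (@complex.Im R); move: (h (@complex.Re R)).
  by apply: filterS2 hI => x' hI hR; rewrite /avgC hR hI.
Qed.

Lemma avgC_Cinfty_nbhs (F : localField R) (nu : F -> R) (IF : (F -> R) -> R)
    (hF : haar_fun nu IF) b n (iota : 'M[F]_b -> 'M[F]_n) w f V A :
  affine_embedding iota -> (forall y, (iota y \in unitmx) = (y \in unitmx)) ->
  csupp_on (@GLset F b) w -> V `<=` @Cinfty_GL R n F -> V f ->
  Cinfty_nbhs (avgC nu IF iota w f) A ->
  within V (Cinfty_nbhs f) (avgC nu IF iota w @^-1` A).
Proof.
move=> ia iu cw VC Vf; rewrite /within /=; have [_ sf] := VC _ Vf.
case: F nu IF hF iota w f V A ia iu cw VC Vf sf => [||F nF] nu IF hF iota w f V A ia iu cw VC Vf sf hA.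
- apply: smooth_nbhsS ((avgC_real hF ia iu cw).2 _ _ sf hA) _ => g Bg Vg.
  exact/Bg/(VC _ Vg).2.
- have [B sB BA] := hA.
  have [B' sB' BB'] := (avgC_complex hF ia iu cw).2 _ _ sf sB.
  exists B' => // g /= Bg Vg; apply: BA; apply: BB' => //.
  exact: (VC _ Vg).2.
- by move=> _; exact: hA.
Qed.

End LocalField.

(** * Positive vectors in the induced representations *)

Section Elementary.
Variables (R : realType) (V : normedModType R) (U : set V).

(* Closed under directional derivatives, by [elem_derive]. *)
Inductive elementary : (V -> R) -> Prop :=
| elem_cst c : elementary (fun=> c)
| elem_lin l : continuous l -> (forall (h : R) v x, l (h *: v + x) = h * l v + l x) ->
    elementary l
| elem_add f g : elementary f -> elementary g -> elementary (fun x => f x + g x)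
| elem_mul f g : elementary f -> elementary g -> elementary (fun x => f x * g x)
| elem_pow f r : elementary f -> (forall x, U x -> 0 < f x) ->
    elementary (fun x => f x `^ r).

Lemma elem_continuous f : elementary f -> forall x, U x -> {for x, continuous f}.
Proof.
elim=> {f} [c|l cl _|f g _ cf _ cg|f g _ cf _ cg|f r _ cf f0] x Ux.
- exact: continuous_cstf.
- exact: cl.
- by apply: continuousD; [exact: cf|exact: cg].
- by apply: continuousM; [exact: cf|exact: cg].
- apply: (@continuous_comp _ _ _ f (@powR R ^~ r)); first exact: cf.
  by apply: powR_continuous; exact: f0.
Qed.

Lemma elem_derive f v : elementary f ->
  exists2 f', elementary f' & forall x, U x -> is_derive x v f (f' x).
Proof.
elim=> {f} [c|l cl ll|f g _ [f' ef fd] _ [g' eg gd]|f g ef0 [f' ef fd] eg0 [g' eg gd]|f r ef0 [f' ef fd] f0].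
- exists (fun=> 0); first exact: elem_cst.
  by move=> x _; exact: is_derive_cst.
- exists (fun=> l v); first exact: elem_cst.
  move=> x _; apply: is_derive_cvg; apply: cvg_near_cst.
  exists 1 => //= h _ h0; rewrite ll addrK mulKf//.
- exists (fun x => f' x + g' x); first exact: elem_add.
  by move=> x Ux; have := fd x Ux; have := gd x Ux => ? ?; exact: (@is_deriveD _ _ _ f g).
- exists (fun x => f x * g' x + g x * f' x).
    by apply: elem_add; exact: elem_mul.
  move=> x Ux; have := fd x Ux; have := gd x Ux => ? ?; exact: (@is_deriveM _ _ f g).
- exists (fun x => r * f x `^ (r - 1) * f' x).
    by apply: elem_mul => //; apply: elem_mul; [exact: elem_cst|exact: elem_pow].
  (* Restricting to the line through [x] turns the directional derivative into an ordinary one, to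
     which the chain rule for a real power applies. *)
  move=> x Ux; have E : 0 *: v + x = x by rewrite scale0r add0r.
  have := fd x Ux; rewrite -{1}E => /is_derive_lineE fl.
  rewrite -{1}E; apply/is_derive_lineE.
  have H1 : is_derive (f (0 *: v + x)) 1 (@powR R ^~ r) (r * f x `^ (r - 1)).
    by rewrite E; apply: is_derive1_powR; exact: f0.
  exact: (@is_derive1_comp R (@powR R ^~ r) (fun s : R => f (s *: v + x)) 0 _ _ H1 fl).
Qed.

Lemma smooth_on_eq f g : open U -> (forall x, U x -> f x = g x) ->
  smooth_on U g -> smooth_on U f.
Proof.
move=> oU fg sg.
have E w x : U x -> iter_derive w f x = iter_derive w g x.
  elim: w x => [|v w IH] x Ux; first exact: fg.
  rewrite /=; apply: near_eq_derive.
  by apply: filterS (open_nbhs_nbhs (conj oU Ux)) => y; exact: IH.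
move=> w x Ux; have nE : \forall y \near x, iter_derive w f y = iter_derive w g y.
  by apply: filterS (open_nbhs_nbhs (conj oU Ux)) => y; exact: E.
split; first exact: (near_continuous nE (sg w x Ux).1).
move=> v; apply: near_eq_derivable ((sg w x Ux).2 v).
by apply: filterS nE.
Qed.

Lemma elem_smooth f : open U -> elementary f -> smooth_on U f.
Proof.
move=> oU ef.
have H w : exists2 f', elementary f' & forall x, U x -> iter_derive w f x = f' x.
  elim: w => [|v w [g eg E]]; first by exists f.
  have [g' eg' D] := elem_derive v eg; exists g' => // x Ux.
  rewrite /= (@near_eq_derive _ _ _ _ g); last first.
    by apply: filterS (open_nbhs_nbhs (conj oU Ux)) => y; exact: E.
  exact: (@derive_val _ _ _ _ _ _ _ (D x Ux)).
move=> w x Ux; have [g eg E] := H w.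
have nE : \forall y \near x, iter_derive w f y = g y.
  by apply: filterS (open_nbhs_nbhs (conj oU Ux)) => y; exact: E.
split; first exact: (near_continuous nE (elem_continuous eg Ux)).
move=> v; have [g' _ D] := elem_derive v eg.
apply: near_eq_derivable (@ex_derive _ _ _ _ _ _ _ (D x Ux)).
by apply: filterS nE.
Qed.

Lemma elem_sum (I : Type) (s : seq I) (f : I -> V -> R) :
  (forall i, elementary (f i)) -> elementary (fun x => \sum_(i <- s) f i x).
Proof.
move=> ef; elim: s => [|i s IH].
  rewrite (_ : (fun _ => _) = fun=> 0); first exact: elem_cst.
  by apply/funext => x; rewrite big_nil.
rewrite (_ : (fun _ => _) = fun x => f i x + \sum_(i <- s) f i x); first exact: elem_add.
by apply/funext => x; rewrite big_cons.
Qed.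

End Elementary.

(** The determinant is a polynomial in the entries, so it inherits any property that constants have
    and that sums and products preserve. *)
Lemma det_closed (T : Type) (F : comNzRingType) (P : (T -> F) -> Prop) n (M : T -> 'M[F]_n) :
  (forall c, P (fun=> c)) ->
  (forall f g, P f -> P g -> P (fun x => f x + g x)) ->
  (forall f g, P f -> P g -> P (fun x => f x * g x)) ->
  (forall i j, P (fun x => M x i j)) -> P (fun x => \det (M x)).
Proof.
move=> Pc PD PM PE; rewrite /determinant.
elim: (index_enum _) => [|s r IH].
  rewrite (_ : (fun _ => _) = fun=> 0)//; by apply/funext => x; rewrite big_nil.
rewrite (_ : (fun _ => _) = fun x => (-1) ^+ s * (\prod_i M x i (s i)) +
    \sum_(s <- r) (-1) ^+ s * \prod_i M x i (s i)); last first.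
  by apply/funext => x; rewrite big_cons.
apply: (PD) IH; apply: (PM); first exact: Pc.
elim: (index_enum _) => [|i r' IH'].
  rewrite (_ : (fun _ => _) = fun=> 1)//; by apply/funext => x; rewrite big_nil.
rewrite (_ : (fun _ => _) = fun x => M x i (s i) * \prod_(i <- r') M x i (s i)).
  exact: PM.
by apply/funext => x; rewrite big_cons.
Qed.

(** * Positive vectors from the lower rows *)

Section Source.
Variables (R : realType) (F : topFieldType) (a nu : F -> R).
Hypothesis av : absval a.
Variable IF : (F -> R) -> R.
Hypothesis hF : haar_fun nu IF.
Variables (p1 p2 : nat) (s t : R).

(** A volume of the space spanned by the lower rows, measured by [nu]: multiplying these rows by [D]
    scales it by [nu (\det D)]. *)
Definition bottom_density (h : 'M[F]_(p2, p1 + p2) -> R) :=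
  (forall z, row_free z -> 0 < h z) /\
  (forall D z, D \in unitmx -> row_free z -> h (D *m z) = nu (\det D) * h z).

(** The power of [nu (\det x)] contributes the exponent [s] for both diagonal blocks; the density of
    the lower rows sees only the second block and corrects its exponent from [s] to [t]. *)
Definition source (h : 'M[F]_(p2, p1 + p2) -> R) (x : 'M[F]_(p1 + p2)) : R :=
  if x \in unitmx then nu (\det x) `^ s * h (dsubmx x) `^ (t - s) else 0.

Lemma source_gt0 h x : bottom_density h -> x \in unitmx -> 0 < source h x.
Proof.
move=> [h0 _] ux; rewrite /source ux mulr_gt0// powR_gt0//.
  exact: (nu_det_gt0 hF).
by apply: h0; exact: dsubmx_free.
Qed.

Lemma source_ind h : bottom_density h -> ind_real nu erefl s t (source h).
Proof.
move=> [h0 hD] x1 x2 x3 x u1 u3 ux; rewrite castmx_id /source ux.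
have ub : block_mx x1 x2 0 x3 \in unitmx.
  by rewrite unitmxE det_ublock unitrM -!unitmxE u1.
have -> : block_mx x1 x2 0 x3 *m x \in unitmx by rewrite unitmx_mul ub.
have -> : dsubmx (block_mx x1 x2 0 x3 *m x) = x3 *m dsubmx x.
  by rewrite -{1}[x]vsubmxK mul_block_col col_mxKd mul0mx add0r.
have n1 := nu_det_gt0 hF u1; have n3 := nu_det_gt0 hF u3; have nx := nu_det_gt0 hF ux.
have hx : 0 < h (dsubmx x) by apply: h0; exact: dsubmx_free.
rewrite hD//; last exact: dsubmx_free.
rewrite (nu_detM av hF)// det_ublock (nuM av hF) -?unitfE -?unitmxE//.
rewrite !powRM ?mulr_ge0 ?ltW//.
have -> : nu (\det x3) `^ t = nu (\det x3) `^ s * nu (\det x3) `^ (t - s).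
  by rewrite -powRD ?(gt_eqF n3) ?implybT// addrCA subrr addr0.
ring.
Qed.

Lemma minorM (D : 'M[F]_p2) z (f : {ffun 'I_p2 -> 'I_(p1 + p2)}) :
  \det (colsub f (D *m z)) = \det D * \det (colsub f z).
Proof.
rewrite -det_mulmx; congr determinant.
by apply/matrixP => i j; rewrite !mxE; apply: eq_bigr => k _; rewrite !mxE.
Qed.

Section Power.
Variables (sqn : F -> R) (kappa : R).
Hypothesis sqnE : forall z, sqn z = a z ^+ 2.
Hypothesis nuE : forall z, z != 0 -> nu z = a z `^ kappa.

(** The square of the absolute value is polynomial in real coordinates, while the absolute value
    need not be differentiable at 0; [nu] is therefore written as a real power of the square. *)
Let nu_sqn z : z != 0 -> nu z = sqn z `^ (kappa / 2).
Proof.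
move=> z0; rewrite nuE// sqnE -powR_mulrn ?(av_ge0 av)// -powRrM.
by rewrite mulrC divfK// pnatr_eq0.
Qed.

(* Up to a factor p2!, the Gram determinant of the rows of z (Cauchy-Binet). *)
Definition gram (z : 'M[F]_(p2, p1 + p2)) : R :=
  \sum_(f : {ffun 'I_p2 -> 'I_(p1 + p2)}) sqn (\det (colsub f z)).

Lemma gram_gt0 z : row_free z -> 0 < gram z.
Proof.
move=> /unit_minor[f uf]; rewrite /gram (bigD1 f)//=.
apply: ltr_pwDl; last by apply: sumr_ge0 => g _; rewrite sqnE sqr_ge0.
by rewrite sqnE exprn_gt0// (av_gt0 av) -unitfE -unitmxE.
Qed.

Lemma gram_density : bottom_density (fun z => gram z `^ (kappa / 2)).
Proof.
split=> [z fz|D z uD fz]; first by rewrite powR_gt0// gram_gt0.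
have -> : gram (D *m z) = sqn (\det D) * gram z.
  rewrite /gram mulr_sumr; apply: eq_bigr => f _.
  by rewrite minorM !sqnE (avM av) exprMn.
rewrite powRM; first by rewrite nu_sqn// -unitfE -unitmxE.
  by rewrite sqnE sqr_ge0.
exact/ltW/gram_gt0.
Qed.

Variables (V : normedModType R) (m : V -> 'M[F]_(p1 + p2)).
Variable P : (V -> F) -> Prop.
Let U : set V := [set v | m v \in unitmx].
Hypothesis oU : open U.
Hypothesis Pc : forall c, P (fun=> c).
Hypothesis PD : forall f g, P f -> P g -> P (fun x => f x + g x).
Hypothesis PM : forall f g, P f -> P g -> P (fun x => f x * g x).
Hypothesis Pm : forall i j, P (fun x => m x i j).
Hypothesis Psqn : forall f, P f -> elementary U (fun x => sqn (f x)).

(** On invertible matrices the function is a product of real powers of positive polynomials, hence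
    elementary. [P] stands for having elementary coordinates: the function itself over the reals,
    its real and imaginary parts over the complex numbers. *)
Lemma source_smooth : smooth_on U (fun v => source (fun z => gram z `^ (kappa / 2)) (m v)).
Proof.
pose g v := sqn (\det (m v)) `^ (kappa / 2 * s) *
  gram (dsubmx (m v)) `^ (kappa / 2 * (t - s)).
apply: (@smooth_on_eq _ _ _ _ g) => // [v Uv|].
  rewrite /source; have -> : m v \in unitmx by [].
  by rewrite nu_sqn -?unitfE -?unitmxE// -!powRrM.
apply: elem_smooth => //; apply: elem_mul; apply: elem_pow.
- by apply: Psqn; exact: det_closed.
- by move=> v Uv; rewrite sqnE exprn_gt0// (av_gt0 av) -unitfE -unitmxE.
- apply: elem_sum => f; apply: Psqn; apply: det_closed => // i j.
  rewrite (_ : (fun v => _) = fun v => m v (rshift p1 i) (f j)); first exact: Pm.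
  by apply/funext => v; rewrite !mxE.
- by move=> v Uv; apply: gram_gt0; exact: dsubmx_free.
Qed.

End Power.
End Source.

Section Instances.
Variables (R : realType) (p1 p2 : nat) (s t : R).
Local Notation n := (p1 + p2)%N.

Lemma source_out (F : topFieldType) (nu : F -> R) (h : 'M[F]_(p2, n) -> R) x :
  x \notin unitmx -> source nu s t h x = 0.
Proof. by rewrite /source => /negbTE ->. Qed.

Lemma smooth_on_cst (V : normedModType R) (U : set V) c : open U -> smooth_on U (fun=> c).
Proof. by move=> oU; apply: elem_smooth => //; exact: elem_cst. Qed.

Lemma real_source (nu : RealField R -> R) IF : haar_fun nu IF ->
  exists2 h : 'M[RealField R]_(p2, n) -> R, bottom_density nu h &
    Cinfty_GL (fun x : 'M[RealField R]_n => (source nu s t h x)%:C).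
Proof.
move=> hF; pose F := realTopField R.
have [k nuE] : exists k, forall x : F, x != 0 -> nu x = real_av x `^ k.
  apply: (nu_power (absval_real R) hF (emb := id)) => //.
  - by move=> x; exact: continuous_idf.
  - by move=> x x0; rewrite /real_av gtr0_norm.
pose sqn (z : F) : R := (z : R) * (z : R).
have sqnE (z : F) : sqn z = real_av z ^+ 2.
  by rewrite /real_av real_normK ?expr2// num_real.
exists (fun z => gram sqn z `^ (k / 2)).
  exact: (@gram_density R F _ nu (absval_real R) p1 p2 sqn k sqnE nuE).
split=> [x nux|]; first by rewrite source_out.
split; last exact: (smooth_on_cst 0 (@real_open R n)).
pose V := [the normedModType R of 'M[R]_n].
apply: (source_smooth (absval_real R) s t sqnE nuE (m := id : V -> 'M[F]_n)
  (P := fun f : V -> F => elementary (@real_GL R n : set V) (f : V -> R)) (@real_open R n)).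
- by move=> c; exact: elem_cst.
- by move=> f g; exact: elem_add.
- by move=> f g; exact: elem_mul.
- move=> i j; apply: elem_lin => [|h v x]; first exact: coord_continuous.
  by rewrite !mxE.
- by move=> f ef; apply: elem_mul.
Qed.

Lemma complex_source (nu : ComplexField R -> R) IF : haar_fun nu IF ->
  exists2 h : 'M[ComplexField R]_(p2, n) -> R, bottom_density nu h &
    Cinfty_GL (fun x : 'M[ComplexField R]_n => (source nu s t h x)%:C).
Proof.
move=> hF; pose F := complexTopField R.
have [k nuE] : exists k, forall x : F, x != 0 -> nu x = complex_av x `^ k.
  apply: (nu_power (absval_complex R) hF (emb := fun x : R => x%:C)) => //.
  - move=> x; apply: (@continuous_comp _ _ _ (fun x : R => (x, 0 : R))
      (fun z => z.1 +i* z.2 : F)); last exact: complex_mk_continuous.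
    by apply: continuous_pair; [exact: continuous_idf|exact: continuous_cstf].
  - by move=> x y; rewrite rmorphM.
  - by move=> x x0; rewrite complex_av_def/= expr0n addr0 sqrtr_sqr gtr0_norm.
pose sqn (z : F) : R := complex.Re (z : R[i]) ^+ 2 + complex.Im (z : R[i]) ^+ 2.
have sqnE (z : F) : sqn z = complex_av z ^+ 2.
  by rewrite complex_av_def sqr_sqrtr// addr_ge0 ?sqr_ge0.
exists (fun z => gram sqn z `^ (k / 2)).
  exact: (@gram_density R F _ nu (absval_complex R) p1 p2 sqn k sqnE nuE).
split=> [x nux|]; first by rewrite source_out.
split; last exact: (smooth_on_cst 0 (@complex_open R n)).
pose V := [the normedModType R of ('M[R]_n * 'M[R]_n)%type].
pose el (f : V -> R) := elementary (@complex_GL R n : set V) f.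
apply: (source_smooth (absval_complex R) s t sqnE nuE
  (m := (fun p : V => complex_mx p : 'M[F]_n))
  (P := fun f : V -> F => el (fun x => complex.Re (f x : R[i])) /\
    el (fun x => complex.Im (f x : R[i]))) (@complex_open R n)).
- by move=> c; split; exact: elem_cst.
- move=> f g [f1 f2] [g1 g2]; split.
    rewrite /el (_ : (fun x => _) = fun x => complex.Re (f x : R[i]) + complex.Re (g x : R[i])).
      exact: elem_add.
    by apply/funext => x; rewrite raddfD.
  rewrite /el (_ : (fun x => _) = fun x => complex.Im (f x : R[i]) + complex.Im (g x : R[i])).
    exact: elem_add.
  by apply/funext => x; rewrite raddfD.
- move=> f g [f1 f2] [g1 g2]; split.
    rewrite /el (_ : (fun x => _) = fun x => complex.Re (f x : R[i]) * complex.Re (g x : R[i]) +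
        (-1) * (complex.Im (f x : R[i]) * complex.Im (g x : R[i]))).
      by apply: elem_add; [exact: elem_mul|apply: elem_mul; [exact: elem_cst|exact: elem_mul]].
    by apply/funext => x; rewrite mulN1r; case: (f x) (g x) => [? ?] [? ?].
  rewrite /el (_ : (fun x => _) = fun x => complex.Re (f x : R[i]) * complex.Im (g x : R[i]) +
      complex.Im (f x : R[i]) * complex.Re (g x : R[i])).
    by apply: elem_add; exact: elem_mul.
  by apply/funext => x; case: (f x) (g x) => [? ?] [? ?].
- move=> i j; split.
    rewrite /el (_ : (fun x => _) = fun p : V => p.1 i j); last by apply/funext => x; rewrite mxE.
    apply: elem_lin => [p|h v x]; last by rewrite !mxE.
    by apply: (@continuous_comp _ _ _ fst (fun x : 'M[R]_n => x i j)); [exact: cvg_fst|exact: coord_continuous].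
  rewrite /el (_ : (fun x => _) = fun p : V => p.2 i j); last by apply/funext => x; rewrite mxE.
  apply: elem_lin => [p|h v x]; last by rewrite !mxE.
  by apply: (@continuous_comp _ _ _ snd (fun x : 'M[R]_n => x i j)); [exact: cvg_snd|exact: coord_continuous].
- by move=> f [f1 f2]; apply: elem_add; apply: elem_mul.
Qed.

(** * Locally constant positive vectors over a non-archimedean field *)

Section Nonarch.
Variables (F : topFieldType) (a nu : F -> R).
Hypothesis av : absval a.
Hypothesis aU : forall x y, a (x + y) <= Num.max (a x) (a y).
Variable IF : (F -> R) -> R.
Hypothesis hF : haar_fun nu IF.

(** The ultrametric inequality: an element closer to [z] than [a z] has the same absolute value as
    [z]. *)
Lemma av_locally_constant z : z != 0 -> \forall y \near z, a y = a z.
Proof.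
move=> z0; apply/(av_nbhs av); exists (a z); first by rewrite (av_gt0 av).
move=> y /= yz; apply/eqP; rewrite eq_le; apply/andP; split.
  by rewrite -[y](subrK z) (le_trans (aU _ _))// ge_max lexx andbT ltW.
have := aU y (z - y); rewrite [y + _]addrC subrK le_max => /orP[//|].
by rewrite -(avN av (z - y)) opprB leNgt yz.
Qed.

Let minor (f : {ffun 'I_p2 -> 'I_n}) (z : 'M[F]_(p2, n)) := \det (colsub f z).

(** The ultrametric counterpart of [gram]: a maximum of absolute values replaces a sum of squares. A
    set of columns is selected because [nu] is evaluated on a minor; any two optimal choices give
    the same value by [nu_av]. The last columns only serve to show that the index type is
    inhabited. *)
Definition max_minor (z : 'M[F]_(p2, n)) : {ffun 'I_p2 -> 'I_n} :=
  [arg max_(f > [ffun i => rshift p1 i] : {ffun 'I_p2 -> 'I_n}) a (minor f z)]%O.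

Lemma max_minorP z f : a (minor f z) <= a (minor (max_minor z) z).
Proof. by rewrite /max_minor; case: arg_maxP => // g _; exact. Qed.

Lemma max_minor_neq0 z : row_free z -> minor (max_minor z) z != 0.
Proof.
move=> /unit_minor[f uf]; rewrite -(av_gt0 av); apply: lt_le_trans (max_minorP z f).
by rewrite (av_gt0 av) -unitfE -unitmxE.
Qed.

Lemma max_minor_density : bottom_density nu (fun z => nu (minor (max_minor z) z)).
Proof.
split=> [z fz|D z uD fz]; first by apply: (nu_gt0 hF); exact: max_minor_neq0.
have D0 : \det D != 0 by rewrite -unitfE -unitmxE.
rewrite -(nuM av hF)//; last exact: max_minor_neq0.
apply: (nu_av av hF).
  rewrite /minor minorM mulf_neq0//.
  have aD : 0 < a (\det D) by rewrite (av_gt0 av).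
  have h := max_minorP (D *m z) (max_minor z).
  rewrite /minor !minorM !(avM av) (ler_pM2l aD) in h.
  rewrite -(av_gt0 av); apply: lt_le_trans h.
  by rewrite (av_gt0 av); exact: max_minor_neq0.
apply/eqP; rewrite eq_le; apply/andP; split.
  by rewrite /minor minorM !(avM av) ler_pM2l ?(av_gt0 av)//; exact: max_minorP.
by rewrite (avM av) -(avM av) -[\det D * _]minorM; exact: max_minorP.
Qed.

(** Near [x] the minor that is optimal at [x] keeps its absolute value [M], and no other minor
    exceeds [M]: the nonzero ones have locally constant absolute value, the vanishing ones stay
    small. *)
Lemma max_minor_locally_constant x : x \in unitmx ->
  \forall y \near x, nu (minor (max_minor (dsubmx y)) (dsubmx y)) =
    nu (minor (max_minor (dsubmx x)) (dsubmx x)).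
Proof.
move=> ux; have fz := dsubmx_free ux.
set M := a (minor (max_minor (dsubmx x)) (dsubmx x)).
have M0 : 0 < M by rewrite (av_gt0 av) max_minor_neq0.
have cminor f : {for x, continuous (fun y => minor f (dsubmx y))}.
  apply: (continuous_det av); apply: continuous_mx => i j.
  apply: (@eq_continuous _ _ _ (fun y : 'M[F]_n => y (rshift p1 i) (f j))) => [y|]; first by rewrite !mxE.
  exact: entry_continuous.
have H1 : \forall y \near x, a (minor (max_minor (dsubmx x)) (dsubmx y)) = M.
  exact: (cminor (max_minor (dsubmx x)) _ (av_locally_constant (max_minor_neq0 fz))).
have H2 : \forall y \near x, forall f, a (minor f (dsubmx y)) <= M.
  apply: (@filter_forall _ _ (fun f y => a (minor f (dsubmx y)) <= M) (nbhs x)) => f.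
  have [f0|f0] := eqVneq (minor f (dsubmx x)) 0.
    have h0 : nbhs (minor f (dsubmx x)) [set y | a y <= M].
      rewrite f0; apply/(av_nbhs av); exists M => // y /=.
      by rewrite subr0 => /ltW.
    exact: (cminor f _ h0).
  have h1 : \forall y \near x, a (minor f (dsubmx y)) = a (minor f (dsubmx x)).
    exact: (cminor f _ (av_locally_constant f0)).
  by apply: filterS h1 => y /= ->; exact: max_minorP.
move: H2; apply: filterS2 H1 => y H1 H2; apply/esym/(nu_av av hF).
  exact: max_minor_neq0.
by apply/eqP; rewrite eq_le H2 andbT -/M -H1 max_minorP.
Qed.

End Nonarch.

Lemma nonarch_source (F : topFieldType) (nF : nonarch_local_field R F) (nu : F -> R) IF :
  haar_fun nu IF ->
  exists2 h : 'M[F]_(p2, n) -> R, bottom_density nu h &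
    @Cinfty_GL R n (NonarchField nF) (fun x => (source nu s t h x)%:C).
Proof.
move=> hF; have [a av aU] := absval_nonarch nF.
exists (fun z => nu (\det (colsub (max_minor a z) z))); first exact: (max_minor_density av hF).
split=> [x nux|x ux]; first by rewrite source_out.
have H1 := max_minor_locally_constant av aU hF ux.
have H2 : \forall y \near x, a (\det y) = a (\det x).
  have dx : \det x != 0 by rewrite -unitfE -unitmxE.
  exact: (@continuous_det R F a av _ n id x (@continuous_idf _ x) _ (av_locally_constant av aU dx)).
have H3 : \forall y \near x, y \in unitmx.
  exact: (open_nbhs_nbhs (conj (@open_unitmx R F _ av n) ux)).
have H : \forall y \near x, nu (\det (colsub (max_minor a (dsubmx y)) (dsubmx y))) =
    nu (\det (colsub (max_minor a (dsubmx x)) (dsubmx x))) /\ a (\det y) = a (\det x) /\ y \in unitmx.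
  by near=> y; split; [near: y|split; near: y].
apply: filterS H => y [E1 [E2 uy]].
have y0 : \det y != 0 by rewrite -unitfE -unitmxE.
by rewrite /source uy ux (nu_av av hF y0 E2) E1.
Unshelve. all: by end_near. Qed.

Lemma localField_source (F : localField R) (nu : F -> R) IF : haar_fun nu IF ->
  exists2 h : 'M[F]_(p2, n) -> R, bottom_density nu h &
    Cinfty_GL (fun x : 'M[F]_n => (source nu s t h x)%:C).
Proof.
case: F nu IF => [||F nF] nu IF hF.
- exact: real_source hF.
- exact: complex_source hF.
- exact: nonarch_source hF.
Qed.

End Instances.

(** * Intertwining operators *)

Lemma iota_dr_affine (F : topFieldType) c b : affine_embedding (@iota_dr F c b).
Proof.
exists (block_mx 1%:M 0 0 0), (col_mx 0 1%:M), (row_mx 0 1%:M) => y.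
rewrite mul_col_mx mul0mx mul1mx mul_col_row !mul0mx mulmx0 mulmx1.
by rewrite add_block_mx !addr0 add0r.
Qed.

Lemma iota_ul_affine (F : topFieldType) c b : affine_embedding (fun y => @iota_ul F b c y).
Proof.
exists (block_mx 0 0 0 1%:M), (col_mx 1%:M 0), (row_mx 1%:M 0) => y.
rewrite mul_col_mx mul0mx mul1mx mul_col_row !mul0mx mulmx0 mulmx1.
by rewrite add_block_mx !add0r addr0.
Qed.

Section Assembly.
Variables (R : realType) (F : localField R) (a nu : F -> R).
Hypothesis av : absval a.
Variable IF : (F -> R) -> R.
Hypothesis hF : haar_fun nu IF.

Definition ind_cplx n p1 p2 (e : (p1 + p2)%N = n) (s t : R) : set ('M[F]_n -> R[i]) :=
  [set f | Cinfty_GL f /\ (ind_real nu e s t (fun x => complex.Re (f x)) /\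
    ind_real nu e s t (fun x => complex.Im (f x)))].

(** The square root of the modular function adds half the size of the second block to the first
    exponent, and subtracts half the size of the first block from the second. *)
Lemma segment_prod_ind n i1 j1 i2 j2 (e : ((j1 - i1) + (j2 - i2))%N = n) :
  segment_prod nu e = ind_cplx e ((i1 + j1)%:R / 2 + (j2 - i2)%:R / 2)
    ((i2 + j2)%:R / 2 - (j1 - i1)%:R / 2).
Proof.
set s := _ + _; set t := _ - _.
have chiE (x1 : 'M[F]_(j1 - i1)) (x3 : 'M[F]_(j2 - i2)) : x1 \in unitmx -> x3 \in unitmx ->
    segment_char nu x1 * segment_char nu x3 * (modular_sqrt nu x1 x3)%:C =
    (nu (\det x1) `^ s * nu (\det x3) `^ t)%:C.
  move=> u1 u3; have n1 := nu_det_gt0 hF u1; have n3 := nu_det_gt0 hF u3.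
  rewrite /segment_char /modular_sqrt -!rmorphM/=; congr _%:C.
  rewrite powRM ?exprn_ge0 ?invr_ge0 ?exprn_ge0 ?(ltW n1) ?(ltW n3)//.
  rewrite -[(_ ^+ (j1 - i1))^-1]powR_inv1 ?exprn_ge0 ?(ltW n3)// powRAC powR_inv1 ?powR_ge0//.
  rewrite -!powR_mulrn ?(ltW n1) ?(ltW n3)// -!powRrM /s /t.
  rewrite powRD ?(gt_eqF n1) ?implybT// powRB ?(gt_eqF n3) ?implybT//.
  by ring.
have ReM (c : R) (z : R[i]) : complex.Re (c%:C * z) = c * complex.Re z.
  by case: z => z1 z2; rewrite /= mul0r subr0.
have ImM (c : R) (z : R[i]) : complex.Im (c%:C * z) = c * complex.Im z.
  by case: z => z1 z2; rewrite /= mul0r addr0.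
rewrite eqEsubset; split=> f [Cf hf]; split=> //.
  split=> x1 x2 x3 x u1 u3 ux; by rewrite hf// chiE// ?ReM ?ImM.
move=> x1 x2 x3 x u1 u3 ux; rewrite chiE//; apply/eqP; rewrite eq_complex ReM ImM.
by apply/andP; split; apply/eqP; [apply: hf.1|apply: hf.2].
Qed.

Lemma ind_cplx_source n p1 p2 (e : (p1 + p2)%N = n) s t :
  exists f : 'M[F]_n -> R, (forall x, x \in unitmx -> 0 < f x) /\
    ind_cplx e s t (fun x => (f x)%:C).
Proof.
case: n / e; have [h dh Ch] := localField_source p1 p2 s t hF.
exists (source nu s t h); split=> [x ux|]; first exact: (source_gt0 hF).
split=> //; split; first exact: (source_ind av hF).
by move=> x1 x2 x3 x _ _ _; rewrite /= mulr0.
Qed.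

Lemma GLfun_lin n c (f g : 'M[F]_n -> R) : GLfun f -> GLfun g ->
  GLfun (fun x => c * f x + g x).
Proof.
move=> [cf f0] [cg g0]; split=> x ux; last by rewrite f0// g0// mulr0 addr0.
apply: (@continuousD _ _ _ (fun x => c * f x)); last exact: cg.
by apply: (@continuousM _ _ (fun=> c)); [exact: continuous_cstf|exact: cf].
Qed.

Lemma avgC_intertwining b n (iota : 'M[F]_b -> 'M[F]_n) w (V1 V2 : set ('M[F]_n -> R[i])) :
  affine_embedding iota -> continuous iota ->
  (forall y, (iota y \in unitmx) = (y \in unitmx)) ->
  csupp_on (@GLset F b) w -> (forall y, 0 <= w y) -> 0 < w 1%:M ->
  V1 `<=` @Cinfty_GL R n F ->
  (forall f, V1 f -> V2 (avgC nu IF iota w f)) ->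
  (exists f : 'M[F]_n -> R, (forall x, x \in unitmx -> 0 < f x) /\ V1 (fun x => (f x)%:C)) ->
  exists_nonzero_intertwining V1 V2.
Proof.
move=> ia ic iu cw w0 w1 VC V12 [f0 [f0pos Vf0]].
exists (avgC nu IF iota w).
  split=> //.
  - move=> c f g Vf Vg; apply/funext => x.
    have [fR fI] := Cinfty_GLfun (VC _ Vf); have [gR gI] := Cinfty_GLfun (VC _ Vg).
    have L := avg_lin av hF ic iu.
    rewrite /avgC; case: c => c1 c2.
    (* A complex scalar mixes real and imaginary parts; the combination is nested so that real
       linearity in the form [c * g + h] applies twice. *)
    have -> : (fun z => complex.Re ((c1 +i* c2) * f z + g z)) =
        fun z => c1 * complex.Re (f z) + ((- c2) * complex.Im (f z) + complex.Re (g z)).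
      by apply/funext => z; case: (f z) (g z) => [? ?] [? ?] /=; ring.
    have -> : (fun z => complex.Im ((c1 +i* c2) * f z + g z)) =
        fun z => c1 * complex.Im (f z) + (c2 * complex.Re (f z) + complex.Im (g z)).
      by apply/funext => z; case: (f z) (g z) => [? ?] [? ?] /=; ring.
    rewrite (L _ _ _ _ x cw fR (GLfun_lin (- c2) fI gR)) (L _ _ _ _ x cw fI gR).
    rewrite (L _ _ _ _ x cw fI (GLfun_lin c2 fR gI)) (L _ _ _ _ x cw fR gI).
    by apply/eqP; rewrite eq_complex/=; apply/andP; split; apply/eqP; ring.
  - move=> g f ug Vf; apply/funext => x; rewrite /avgC /right_transl.
    by rewrite (avg_right nu IF iota w (fun z => complex.Re (f z)))
      (avg_right nu IF iota w (fun z => complex.Im (f z))).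
  - by move=> f Vf A; exact: avgC_Cinfty_nbhs.
exists (fun x => (f0 x)%:C) => // /(congr1 (fun h => complex.Re (h 1%:M))) /=.
have [fR _] := Cinfty_GLfun (VC _ Vf0).
have := avg_gt0 av hF ic iu cw w0 w1 fR f0pos (unitmx1 _ _).
by move=> h E; move: h; rewrite E ltxx.
Qed.

Lemma twist_ge0 m l e (w : 'M[F]_(m + l) -> R) y : (forall y, 0 <= w y) -> 0 <= twist nu e w y.
Proof. by move=> w0; rewrite /twist mulr_ge0// powR_ge0. Qed.

Lemma twist1_gt0 m l e (w : 'M[F]_(m + l) -> R) : 0 < w 1%:M -> 0 < twist nu e w 1%:M.
Proof. by move=> w1; rewrite /twist det1 (nu1 av hF) powR1 mulr1. Qed.

(** Moves [m] rows from the first block to the second. The sizes are given by equations because the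
    truncated differences of the segments agree with [c + m] and the like only after arithmetic. *)
Lemma lower_intertwining c m l p1 p2 q1 q2 n (e1 : (p1 + p2)%N = n) (e2 : (q1 + q2)%N = n)
    (s t s' t' : R) :
  p1 = (c + m)%N -> p2 = l -> q1 = c -> q2 = (m + l)%N ->
  s' = s -> s - t' = l%:R -> t - t' = - m%:R ->
  exists_nonzero_intertwining (ind_cplx e1 s t) (ind_cplx e2 s' t').
Proof.
move=> ? ? ? ? ?; subst p1 p2 q1 q2 s'; case: n / e2 e1 => e1 hs ht.
have [w [cw w0 w1 winv]] := invariant_density av hF m l.
apply: (@avgC_intertwining _ _ (iota_dr c (b := m + l)) (twist nu t' w)).
- exact: iota_dr_affine.
- exact: iota_dr_continuous.
- exact: iota_dr_unit.
- exact: (csupp_twist av hF).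
- by move=> y; exact: twist_ge0.
- exact: twist1_gt0.
- by move=> f [].
- move=> f [Cf [fR fI]]; have [gR gI] := Cinfty_GLfun Cf; split.
    apply: avgC_Cinfty => //; [exact: iota_dr_affine|exact: iota_dr_continuous|
      exact: iota_dr_unit|exact: (csupp_twist av hF)].
  by split; exact: (avg_lower av hF hs ht cw winv).
- exact: ind_cplx_source.
Qed.

(** Moves [l] rows from the second block to the first. *)
Lemma upper_intertwining c m l p1 p2 q1 q2 n (e1 : (p1 + p2)%N = n) (e2 : (q1 + q2)%N = n)
    (s t s' t' : R) :
  p1 = m -> p2 = (l + c)%N -> q1 = (m + l)%N -> q2 = c ->
  t' = t -> s - s' = l%:R -> t - s' = - m%:R ->
  exists_nonzero_intertwining (ind_cplx e1 s t) (ind_cplx e2 s' t').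
Proof.
move=> ? ? ? ? ?; subst p1 p2 q1 q2 t'; case: n / e2 e1 => e1 hs ht.
have [w [cw w0 w1 winv]] := invariant_density av hF m l.
apply: (@avgC_intertwining _ _ (fun y => iota_ul c y) (twist nu s' w)).
- exact: iota_ul_affine.
- exact: iota_ul_continuous.
- by move=> y; exact: iota_ul_unit.
- exact: (csupp_twist av hF).
- by move=> y; exact: twist_ge0.
- exact: twist1_gt0.
- by move=> f [].
- move=> f [Cf [fR fI]]; have [gR gI] := Cinfty_GLfun Cf; split.
    apply: avgC_Cinfty => //; [exact: iota_ul_affine|exact: iota_ul_continuous|
      by move=> y; exact: iota_ul_unit|exact: (csupp_twist av hF)].
  by split; exact: (avg_upper av hF hs ht cw winv).
- exact: ind_cplx_source.
Qed.

End Assembly.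

Theorem proposition1p3 (R : realType) (F : localField R)
    (nu : F -> R) (nu_modulus : is_modulus nu)
    (i j k : nat) (i_gt0 : (0 < i)%N) (ij : (i < j)%N) (jk : (j < k)%N) :
  let beta := segment_prod nu (beta_size ij jk) in
  let tbeta := segment_prod nu (tbeta_size ij jk) in
  let gamma := segment_prod nu (gamma_size ij jk) in
  let tgamma := segment_prod nu (tgamma_size ij jk) in
  [/\ exists_nonzero_intertwining gamma beta,
      exists_nonzero_intertwining tgamma beta,
      exists_nonzero_intertwining tbeta gamma
    & exists_nonzero_intertwining tbeta tgamma].
Proof.
have [a av] := localField_absval F.
have [IF hF] := is_modulus_haar_fun av nu_modulus.
rewrite /= !(segment_prod_ind hF).
have ik := ltn_trans ij jk.
have [Eij Eik Ejk] : [/\ (j - i)%:R = j%:R - i%:R :> R, (k - i)%:R = k%:R - i%:R :> R &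
    (k - j)%:R = k%:R - j%:R :> R] by rewrite !natrB// ltnW.
split.
(* From block sizes [k], [j - i] to [j], [k - i]: [k - j] rows leave the first block. *)
- apply: (lower_intertwining av hF (c := j) (m := k - j) (l := j - i)).
  1-4: by rewrite ?subn0; lia.
  1-3: by rewrite ?subn0 ?natrD ?Eij ?Eik ?Ejk; field.
(* From block sizes [j - i], [k] to [j], [k - i]: [i] rows leave the second block. *)
- apply: (upper_intertwining av hF (c := k - i) (m := j - i) (l := i)).
  1-4: by rewrite ?subn0; lia.
  1-3: by rewrite ?subn0 ?natrD ?Eij ?Eik ?Ejk; field.
(* From block sizes [k - i], [j] to [k], [j - i]: [i] rows leave the second block. *)
- apply: (upper_intertwining av hF (c := j - i) (m := k - i) (l := i)).
  1-4: by rewrite ?subn0; lia.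
  1-3: by rewrite ?subn0 ?natrD ?Eij ?Eik ?Ejk; field.
(* From block sizes [k - i], [j] to [j - i], [k]: [k - j] rows leave the first block. *)
- apply: (lower_intertwining av hF (c := j - i) (m := k - j) (l := j)).
  1-4: by rewrite ?subn0; lia.
  1-3: by rewrite ?subn0 ?natrD ?Eij ?Eik ?Ejk; field.
Qed.
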